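(* Let $\gamma<0$, let $(\nu_h)\in\mathcal M(\gamma,\mathbb{R}^{2n})$ with $\widehat\nu_h=e^{h\varphi}$, and let $0<\delta<4|\gamma|$. Then, for each $h>0$: (i) The measure $\nu_h$ is absolutely continuous with respect to the Lebesgue measure. Its density $\Phi_h$ has a holomorphic extension to $\mathbb{C}^{2n}$, and there is a constant $C$ such that for any $Y\in\mathbb{R}^{2n}$, $$\int_{\mathbb{R}^{2n}}|\Phi_h(X+iY)|\,dX\le C\,e^{\frac1{\delta h}|Y|^2}.$$ (ii) The convolution product by $\nu_h$ maps $L^\infty(\mathbb{R}^{2n})$ into $D_{\delta h}(\mathbb{R}^{2n})$. (iii) The symbol of the convolution operator by $\nu_h$ is the function $u\mapsto e^{h\varphi(u)}$.
   Context: A translation-commuting operator $T$ has symbol $\varphi$ if $T(e^{ia\cdot X})=\varphi(a)e^{ia\cdot X}$ for every $a\in\mathbb{R}^{2n}$. A bounded measure is a finite complex Borel measure, $\widehat\nu(u)=\int e^{-iu\cdot X}d\nu(X)$, and $(F\star\nu)(X)=\int F(X-T)d\nu(T)$. For $\gamma<0$, $\mathcal M(\gamma,\mathbb{R}^{2n})$ is the set of families $(\nu_h)_{h>0}$ of bounded measures on $\mathbb{R}^{2n}$ such that $\widehat\nu_h(u)=e^{h\varphi(u)}$, where $\varphi=\varphi_1+\varphi_2$ is a function on $\mathbb{R}^{2n}$ such that: 1. $\varphi_1$ is the symbol of a bounded operator in $L^\infty(\mathbb{R}^{2n})$ commuting with translations; 2. $\varphi_2\in C^\infty(\mathbb{R}^{2n})$;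 for every $\alpha\in\mathbb{N}^{2n}$ there is $A_\alpha>0$ with $|\partial^\alpha\varphi_2(u)|\le A_\alpha(|u|^2+1)$ for all $u$; and ${\rm Re}\,\varphi_2(u)\le\gamma|u|^2$ for every $u$ large enough. For $\kappa>0$, $D_\kappa(\mathbb{R}^{2n})$ is the set of functions $F:\mathbb{R}^{2n}\to\mathbb{C}$ for which there is a real-analytic function $F^{\rm ext}(X,Y)$ on $\mathbb{R}^{2n}\times\mathbb{R}^{2n}$ (unique) such that, with $X=(x,\xi)$, $Y=(y,\eta)$: (1) $(\partial_{x_j}+i\partial_{\xi_j})F^{\rm ext}=0$ and $(\partial_{y_j}-i\partial_{\eta_j})F^{\rm ext}=0$ for $1\le j\le n$; (2) $F^{\rm ext}(X,X)=F(X)$; (3) there is $\psi_F\in L^1(\mathbb{R}^{2n})\cap L^\infty(\mathbb{R}^{2n})$ with $|F^{\rm ext}(X,Y)|\le e^{\frac1{4\kappa}|X-Y|^2}\psi_F(X-Y)$. *)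

(* Defs.v *)
From HB Require Import structures.
From mathcomp Require Import all_boot all_order all_algebra.
From mathcomp Require Import complex.
From mathcomp Require Import all_classical all_reals all_analysis measurable_realfun.
From mathcomp Require Import lra.

Set Implicit Arguments.
Unset Strict Implicit.
Unset Printing Implicit Defensive.

Import Order.TTheory GRing.Theory Num.Theory.
Import numFieldNormedType.Exports.

Local Open Scope classical_set_scope.
Local Open Scope ring_scope.

Import ComplexField.Normc.

Notation borelV R m := (g_sigma_algebraType (@open 'rV[R]_m)).

Section consV.
Variables (R : realType) (m : nat).

Definition consV (p : measurableTypeR R * borelV R m) : borelV R (1 + m) :=
  row_mx (const_mx p.1 : 'rV[R]_1) (p.2 : 'rV[R]_m).

Definition unconsV (x : borelV R (1 + m)) : measurableTypeR R * borelV R m :=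
  (x ord0 (lshift m (ord0 : 'I_1)), rsubmx (x : 'rV[R]_(1 + m))).

Lemma consVK : cancel consV unconsV.
Proof.
case=> a v; rewrite /unconsV /consV; congr pair; last by rewrite row_mxKr.
by rewrite row_mxEl mxE.
Qed.

Lemma unconsVK : cancel unconsV consV.
Proof.
move=> x; rewrite /unconsV /consV /=.
rewrite -[RHS](@hsubmxK _ 1 1 m); congr row_mx.
by apply/rowP => i; rewrite !mxE (ord1 i).
Qed.

Lemma measurable_unconsV : measurable_fun setT unconsV.
Proof.
apply/measurable_fun_pair => /=.
  apply: (@measurability _ _ _ (measurableTypeR R) _ _ _
    (RGenOpens.measurableE R)) => _ [_ [a [b ->]] <-].
  rewrite setTI; apply: sub_sigma_algebra.
  apply: open_comp; last exact: interval_open.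
  by move=> x _; exact: coord_continuous.
apply: (@measurability _ _ _ (borelV R m) setT _ (@open 'rV[R]_m) erefl) => _ [U oU <-].
rewrite setTI; apply: sub_sigma_algebra.
apply: open_comp => // x _.
exact: continuous_rsubmx.
Qed.

Let box (qe : 'rV[rat]_(1 + m) * rat) : set 'rV[R]_(1 + m) :=
  [set x | forall j, `|ratr (qe.1 ord0 j) - x ord0 j| < ratr qe.2].

Lemma measurable_consV : measurable_fun setT consV.
Proof.
apply: (@measurability _ _ _ (borelV R (1 + m)) setT _ (@open 'rV[R]_(1 + m)) erefl).
move=> _ [U oU <-]; rewrite setTI.
have mbox qe : measurable (consV @^-1` (box qe)).
  have -> : consV @^-1` box qe =
    (ball (ratr (qe.1 ord0 (lshift m ord0)) : R) (ratr qe.2 : R) : set (measurableTypeR R)) `*`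
    [set v : borelV R m | forall j, `|ratr (qe.1 ord0 (rshift 1 j)) - v ord0 j| < ratr qe.2].
    apply/seteqP; split => [[a v]/= av|[a v]/= [av1 av2] j].
      split.
        by have := av (lshift m ord0); rewrite row_mxEl mxE.
      by move=> j; have := av (rshift 1 j); rewrite row_mxEr.
    case: (split_ordP j) => k ->; last by rewrite row_mxEr; exact: av2.
    by rewrite row_mxEl mxE (ord1 k); exact: av1.
  apply: measurableX; first exact: measurable_ball.
  apply: sub_sigma_algebra.
  rewrite /= openE => v vb; rewrite /interior.
  apply: (@filter_forall _ _ (fun j (v : 'rV[R]_m) =>
    `|ratr (qe.1 ord0 (rshift 1 j)) - v ord0 j| < ratr qe.2) (nbhs v)) => j.
  pose c : R := ratr (qe.1 ord0 (rshift 1 j)).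
  apply: (@coord_continuous _ 1 m ord0 j v (ball c (ratr qe.2))).
  by apply: open_nbhs_nbhs; split; [exact: ball_open|exact: vb].
have -> : U = \bigcup_(k in [set k : nat |
    exists2 qe, box qe `<=` U & pickle qe = k])
    (if unpickle k is Some qe then box qe else set0).
  apply/seteqP; split => [x Ux|x [k [qe gqe <-]]]; last first.
    by rewrite pickleK => /gqe.
  have [e /= e0 xeU] : exists2 e : R, 0 < e & ball x e `<=` U.
    by have /nbhs_ballP := open_nbhs_nbhs (conj oU Ux).
  have [d dI] : exists d : rat, ratr d \in `]0, e / 2[%R.
    by apply: rat_in_itvoo; rewrite divr_gt0.
  move: dI; rewrite in_itv/= => /andP[d0 de].
  have qP j : {q : rat | `|ratr q - x ord0 j| < ratr d}.
    apply: cid.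
    have [q] := @rat_in_itvoo R (x ord0 j - ratr d) (x ord0 j + ratr d)
      ltac:(lra).
    by rewrite in_itv/= => qI; exists q; rewrite ltr_distl.
  pose q : 'rV[rat]_(1 + m) := \row_j sval (qP j).
  have bxU : box (q, d) `<=` U.
    move=> y yb; apply: xeU; split => // i j; rewrite ord1.
    rewrite /ball /= (le_lt_trans (ler_distD (ratr (q ord0 j)) _ _))//.
    have := yb j; rewrite /= => yj.
    have := svalP (qP j); rewrite -/(q ord0 j) => qj.
    have : sval (qP j) = q ord0 j by rewrite mxE.
    move=> eqq; rewrite eqq in qj; rewrite (distrC (x _ _)).
    lra.
  exists (pickle (q, d)); first by exists (q, d).
  rewrite pickleK => j; rewrite /= mxE; exact: svalP (qP j).
rewrite preimage_bigcup; apply: bigcup_measurable => k _.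
case: unpickle => [qe|]; first exact: mbox.
by rewrite preimage_set0.
Qed.

Variable mu : {sigma_finite_measure set (borelV R m) -> \bar R}.

Definition lebesgueS : set (borelV R (1 + m)) -> \bar R :=
  pushforward (lebesgue_measure \x mu)%E consV.

Let lebesgueS0 : lebesgueS set0 = 0%E.
Proof. by rewrite /lebesgueS /pushforward preimage_set0 measure0. Qed.

Let lebesgueS_ge0 A : (0 <= lebesgueS A)%E.
Proof. by rewrite /lebesgueS /pushforward measure_ge0. Qed.

Let mpre A : measurable A -> measurable (consV @^-1` A).
Proof.
by move=> mA; rewrite -[X in measurable X]setTI; exact: measurable_consV.
Qed.

Let lebesgueS_sigma_additive : semi_sigma_additive lebesgueS.
Proof.
move=> F mF tF mUF; rewrite /lebesgueS /pushforward preimage_bigcup.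
apply: measure_semi_sigma_additive.
- by move=> k; exact: mpre.
- apply/trivIsetP => /= i j _ _ ij; rewrite -preimage_setI.
  by move/trivIsetP : tF => /(_ _ _ _ _ ij) ->//; rewrite preimage_set0.
- by rewrite -preimage_bigcup; exact: mpre.
Qed.

HB.instance Definition _ := isMeasure.Build _ _ _ lebesgueS
  lebesgueS0 lebesgueS_ge0 lebesgueS_sigma_additive.

Let lebesgueS_sigma_finite : sigma_finite setT lebesgueS.
Proof.
have /sigma_finiteP[F [TF ndF Foo]] := sigma_finiteT (@lebesgue_measure R).
have /sigma_finiteP[G [TG ndG Goo]] := sigma_finiteT mu.
exists (fun k => unconsV @^-1` (F k `*` G k)).
  rewrite -preimage_bigcup (_ : \bigcup_k _ = setT) ?preimage_setT//.
  rewrite -setXTT TF TG predeqE => -[x y]; split.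
    by move=> [k _ []/= ? ?]; split; exists k.
  move=> [/= [k _ Fkx] [l _ Gly]]; exists (maxn k l) => //; split.
    by move: x Fkx; exact/subsetPset/ndF/leq_maxl.
  by move: y Gly; exact/subsetPset/ndG/leq_maxr.
move=> k; have [mF Fk] := Foo k; have [mG Gk] := Goo k; split.
  rewrite -[X in measurable X]setTI; apply: measurable_unconsV => //.
  exact: measurableX.
have uncK : unconsV \o consV = id by apply/funext => p; exact: consVK.
rewrite /lebesgueS /pushforward -comp_preimage uncK preimage_id.
by rewrite product_measure1E// lte_mul_pinfty// ge0_fin_numE.
Qed.

HB.instance Definition _ :=
  Measure_isSigmaFinite.Build _ _ _ lebesgueS lebesgueS_sigma_finite.

End consV.

(** Lebesgue measure on the Borel sets of R^m, as an iterated product of the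
    Lebesgue measure of R. *)
Fixpoint lebesgueV (R : realType) (m : nat) :
    {sigma_finite_measure set (borelV R m) -> \bar R} :=
  match m with
  | 0%N => @dirac _ (borelV R 0) (0 : 'rV[R]_0) R
  | p.+1 => lebesgueS (lebesgueV R p)
  end.

Section complex_valued.
Variable R : realType.
Local Open Scope complex_scope.

(** [R[i]] with the topology, and the normed space structure over itself,
    that come with its structure of numFieldType. *)
Definition Cfield : numFieldType := R[i].

Definition expi (t : R) : R[i] := cos t +i* sin t.

Definition cexp (z : R[i]) : R[i] := (expR (complex.Re z))%:C * expi (complex.Im z).

Definition cmeasurable d (T : measurableType d) (f : T -> R[i]) : Prop :=
  measurable_fun setT (fun x => complex.Re (f x)) /\
  measurable_fun setT (fun x => complex.Im (f x)).

Definition cintegrable d (T : measurableType d)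
    (mu : {measure set T -> \bar R}) (f : T -> R[i]) : Prop :=
  mu.-integrable setT (fun x => (complex.Re (f x))%:E) /\
  mu.-integrable setT (fun x => (complex.Im (f x))%:E).

(** A finite complex measure is given by its real and imaginary parts, which are
    finite signed measures (the charges of the library are finite). *)
Record cmeasure d (T : measurableType d) := CMeasure {
  re_meas : {charge set T -> \bar R};
  im_meas : {charge set T -> \bar R} }.

Definition charge_integral d (T : measurableType d)
    (nu : {charge set T -> \bar R}) (f : T -> R) : R :=
  let PN := svalP (cid (svalP (cid (Hahn_decomposition nu)))) in
  \int[jordan_pos PN]_x f x - \int[jordan_neg PN]_x f x.

Definition cmeas_integral d (T : measurableType d)
    (nu : cmeasure T) (f : T -> R[i]) : R[i] :=
  let re x := complex.Re (f x) in let im x := complex.Im (f x) in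
  (charge_integral (re_meas nu) re - charge_integral (im_meas nu) im)
  +i* (charge_integral (re_meas nu) im + charge_integral (im_meas nu) re).

End complex_valued.

Section euclidean.
Variables (R : realType) (m : nat).
Local Open Scope complex_scope.
Implicit Types (F : 'rV[R]_m -> R[i]) (nu : cmeasure R (borelV R m)).

Definition dot (x y : 'rV[R]_m) : R := \sum_i x ord0 i * y ord0 i.

(** The norm of ['rV[R]_m] in the library is the max norm. *)
Definition enorm (x : 'rV[R]_m) : R := Num.sqrt (dot x x).

Definition toC (x y : 'rV[R]_m) : 'rV[Cfield R]_m :=
  \row_i (x ord0 i +i* y ord0 i).

Definition holomorphic (Phi : 'rV[Cfield R]_m -> Cfield R) : Prop :=
  forall z, differentiable (Phi : 'rV[Cfield R]_m -> (Cfield R)^o) z.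

Definition cderivable (i : 'I_m) F (x : 'rV[R]_m) : Prop :=
  derivable (fun y => complex.Re (F y) : R^o) x (delta_mx ord0 i) /\
  derivable (fun y => complex.Im (F y) : R^o) x (delta_mx ord0 i).

Definition cpartial (i : 'I_m) F : 'rV[R]_m -> R[i] := fun x =>
  'D_(delta_mx ord0 i) (fun y => complex.Re (F y) : R^o) x +i*
  'D_(delta_mx ord0 i) (fun y => complex.Im (F y) : R^o) x.

Definition ccontinuous F : Prop :=
  continuous (fun x => complex.Re (F x) : R^o) /\
  continuous (fun x => complex.Im (F x) : R^o).

Definition smooth F : Prop := forall s : seq 'I_m,
  let G := foldr cpartial F s in
  ccontinuous G /\ forall i x, cderivable i G x.

Definition partial_multi (al : {ffun 'I_m -> nat}) F : 'rV[R]_m -> R[i] :=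
  foldr (fun i G => iter (al i) (cpartial i) G) F (enum 'I_m).

Definition monomial (al : {ffun 'I_m -> nat}) (x : 'rV[R]_m) : R :=
  \prod_i x ord0 i ^+ al i.

(** Sum of the terms of a multiple series over the cube of the multi-indices
    whose entries are all less than [k]. *)
Definition cube_sum (V : nmodType) (k : nat) (t : {ffun 'I_m -> nat} -> V) : V :=
  \sum_(al : {ffun 'I_m -> 'I_k}) t [ffun i => al i : nat].

Definition real_analytic F : Prop := forall x,
  exists (c : {ffun 'I_m -> nat} -> R[i]) (r : R), 0 < r /\
  forall y : 'rV[R]_m, `|y| < r ->
    (exists M : R, forall k,
      cube_sum k (fun al => normc (c al) * `|monomial al y|) <= M) /\
    (fun k => normc (F (x + y) - cube_sum k (fun al => c al * (monomial al y)%:C)))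
      @ \oo --> (0 : R).

Definition Linfty_norm F : \bar R :=
  Lnorm (lebesgueV R m) +oo%E (fun x : borelV R m => (normc (F x))%:E).

Definition Linfty F : Prop :=
  cmeasurable (F : borelV R m -> R[i]) /\ (Linfty_norm F < +oo)%E.

Definition eq_ae F G : Prop :=
  (F : borelV R m -> R[i]) = G %[ae lebesgueV R m].

(** An operator in L^infinity is a map on functions that is compatible with
    almost everywhere equality; only its values on [Linfty] are relevant. *)
Definition bounded_operator (T : ('rV[R]_m -> R[i]) -> ('rV[R]_m -> R[i])) : Prop :=
  [/\ forall F, Linfty F -> Linfty (T F),
      forall F G, Linfty F -> Linfty G -> eq_ae F G -> eq_ae (T F) (T G),
      forall (a : R[i]) F G, Linfty F -> Linfty G ->
        eq_ae (T (fun x => a * F x + G x)) (fun x => a * T F x + T G x) &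
      exists M : R, forall F, Linfty F ->
        (Linfty_norm (T F) <= M%:E * Linfty_norm F)%E].

Definition translate (a : 'rV[R]_m) F : 'rV[R]_m -> R[i] := fun x => F (x - a).

Definition translation_commuting
    (T : ('rV[R]_m -> R[i]) -> ('rV[R]_m -> R[i])) : Prop :=
  forall a F, Linfty F -> eq_ae (T (translate a F)) (translate a (T F)).

Definition character (a : 'rV[R]_m) : 'rV[R]_m -> R[i] := fun x => expi (dot a x).

Definition has_symbol (T : ('rV[R]_m -> R[i]) -> ('rV[R]_m -> R[i]))
    (phi : 'rV[R]_m -> R[i]) : Prop :=
  translation_commuting T /\
  forall a, eq_ae (T (character a)) (fun x => phi a * character a x).

Definition fourier nu (u : 'rV[R]_m) : R[i] :=
  cmeas_integral nu (fun x => expi (- dot u x)).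

Definition convolution nu F : 'rV[R]_m -> R[i] := fun x =>
  cmeas_integral nu (fun t : borelV R m => F (x - t)).

Definition abs_continuous nu : Prop :=
  re_meas nu `<< lebesgueV R m /\ im_meas nu `<< lebesgueV R m.

Definition has_density nu F : Prop :=
  cintegrable (lebesgueV R m) F /\
  forall A : set (borelV R m), measurable A ->
    re_meas nu A = (\int[lebesgueV R m]_(x in A) (complex.Re (F x))%:E)%E /\
    im_meas nu A = (\int[lebesgueV R m]_(x in A) (complex.Im (F x))%:E)%E.

(** The functions [phi] allowed in the exponent of the elements of [M_class]. *)
Definition exponent_class (gamma : R) (phi : 'rV[R]_m -> R[i]) : Prop :=
  exists phi1 phi2 : 'rV[R]_m -> R[i],
  [/\ forall u, phi u = phi1 u + phi2 u,
      exists T, bounded_operator T /\ has_symbol T phi1,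
      smooth phi2,
      forall al, exists A : R, 0 < A /\
        forall u, normc (partial_multi al phi2 u) <= A * (enorm u ^+ 2 + 1) &
      exists M : R, forall u, M <= enorm u ->
        complex.Re (phi2 u) <= gamma * enorm u ^+ 2].

Definition has_exponent (nu : R -> cmeasure R (borelV R m))
    (phi : 'rV[R]_m -> R[i]) : Prop :=
  forall h, 0 < h -> forall u, fourier (nu h) u = cexp (h%:C * phi u).

(** Families indexed by [h > 0]; the values at [h <= 0] are irrelevant. *)
Definition M_class (gamma : R) (nu : R -> cmeasure R (borelV R m)) : Prop :=
  exists phi, exponent_class gamma phi /\ has_exponent nu phi.

End euclidean.

(** A point of R^2n is [(x, xi)], with [x_j] and [xi_j] the coordinates of
    indices [lshift n j] and [rshift n j]. *)
Definition D_class (R : realType) (n : nat) (kappa : R)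
    (F : 'rV[R]_(n + n) -> R[i]) : Prop :=
  exists Fext : 'rV[R]_(n + n) -> 'rV[R]_(n + n) -> R[i],
  [/\ real_analytic (fun Z : 'rV[R]_((n + n) + (n + n)) =>
        Fext (lsubmx Z) (rsubmx Z)),
      forall (j : 'I_n) X Y,
        cpartial (lshift n j) (fun X' => Fext X' Y) X +
          (0 +i* 1)%C * cpartial (rshift n j) (fun X' => Fext X' Y) X = 0 /\
        cpartial (lshift n j) (fun Y' => Fext X Y') Y -
          (0 +i* 1)%C * cpartial (rshift n j) (fun Y' => Fext X Y') Y = 0,
      forall X, Fext X X = F X &
      exists psi : borelV R (n + n) -> R,
        [/\ psi \in Lfun (lebesgueV R (n + n)) 1,
            psi \in Lfun (lebesgueV R (n + n)) +oo &
            forall X Y, normc (Fext X Y) <=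
              expR ((4 * kappa)^-1 * enorm (X - Y) ^+ 2) * psi (X - Y)]].

(* Main.v *)
From HB Require Import structures.
Require Import Defs.
From mathcomp Require Import all_boot all_order all_algebra.
From mathcomp Require Import complex.
From mathcomp Require Import all_classical all_reals all_analysis.
From mathcomp Require Import measurable_realfun ess_sup_inf ring lra.

Import Order.TTheory GRing.Theory Num.Theory.
Import numFieldNormedType.Exports.
Import ComplexField.Normc.

Local Open Scope classical_set_scope.
Local Open Scope ring_scope.

Set Implicit Arguments.
Unset Strict Implicit.
Unset Printing Implicit Defensive.

(** Write [m = 2 n] and [psi = exp (h phi1)], so that the Fourier transform of
    [nu h] is [psi * exp (h phi2)]. For [Y] in R^m let
    [a_Y(u) = exp (h phi2(u) - u . Y)]. The second exponent makes [a_Y] smooth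
    with Gaussian decay, while [psi] is merely bounded and measurable. The
    density at the complex point [X + i Y] has to be
    [(2 pi)^(-m) int e^(i u . X) a_Y(u) psi(u) du], and everything rests on
    one estimate: its L^1 norm in [X] is at most a constant times the size of
    finitely many derivatives of [a_Y], measured with the weight
    [exp (- |u_1| - ... - |u_m|)].

    That estimate combines two facts. First, the L^1 norm of the inverse
    Fourier transform of a smooth symbol is controlled by its pure derivatives
    of order up to [2 m] ([ift_integrable]): they give decay in the largest
    coordinate of [X]. Second, multiplying the symbol by [psi] costs a factor
    only ([multiplier_L1]). The operator with symbol [phi1] acts on
    trigonometric polynomials, and summing the exponential series of its powers
    gives [|sum_i c_i psi(u_i)| <= A sup_x |sum_i c_i e^(i u_i . x)|]
    ([multiplier_bound_cexp]). This inequality passes from finite sums to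
    integrals by transference: an integral is an average over lattice offsets
    of lattice sums, and lattice sums weighted by a Fejer kernel keep an L^1
    bound because that kernel is nonnegative ([transference]). No regularity
    of [psi] is needed for this.

    The bound for [a_Y] ([sym_gsym]) is where [delta < 4 |gamma|] enters: in each
    coordinate the exponent is at most
    [- h |gamma| u^2 - u y + c |u| + c |y|], and the quadratic form
    [h |gamma| u^2 + u y + y^2 / (delta' h)] is positive definite for
    [delta' < 4 |gamma|]. Choosing [delta < delta'] leaves room for the integrable
    factor in the definition of [D_class].

    Fourier inversion and the uniqueness of measures with a given Fourier
    transform identify the density of [nu h] ([density_has_density]); the real and
    the imaginary parts are signed measures, treated separately.

    Holomorphy and the extension to pairs of points follow from one principle.
    The kernel at a point, and its convolution with a bounded function at a
    point, are linear functionals of the symbol bounded by the norms above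
    ([symfun]). A displacement of the complex point multiplies the symbol by the
    exponential of a complex linear form in [u], so Taylor expansions of the
    exponential turn into expansions in the displacement: order 2 gives
    derivatives ([symfun_line], [holomorphic_symfun]), and products of truncated
    exponentials give the convergent multiple power series
    ([symfun_analytic]). The extension of [F * nu h] to [(X, Y)] is the
    convolution evaluated at [(X + Y) / 2 + i J (X - Y) / 2], where
    [J (x, xi) = (xi, - x)]; the forms attached to [x_j] and [xi_j] differ by a
    factor [i], which gives the Cauchy-Riemann equations. *)

Notation cre := complex.Re.
Notation cim := complex.Im.

(** * Complex numbers *)

Section complex_facts.
Variable R : realType.
Local Open Scope complex_scope.
Implicit Types (x y z : R[i]) (s t : R).

Lemma ceqP x y : cre x = cre y -> cim x = cim y -> x = y.
Proof. by case: x y => [a b] [c d] /= -> ->. Qed.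

Lemma reD x y : cre (x + y) = cre x + cre y. Proof. by case: x y => [? ?] []. Qed.
Lemma imD x y : cim (x + y) = cim x + cim y. Proof. by case: x y => [? ?] []. Qed.
Lemma reN x : cre (- x) = - cre x. Proof. by case: x. Qed.
Lemma imN x : cim (- x) = - cim x. Proof. by case: x. Qed.
Lemma reM x y : cre (x * y) = cre x * cre y - cim x * cim y.
Proof. by case: x y => [? ?] []. Qed.
Lemma imM x y : cim (x * y) = cre x * cim y + cim x * cre y.
Proof. by case: x y => [? ?] []. Qed.
Lemma reZ s y : cre (s%:C * y) = s * cre y.
Proof. by rewrite reM /= mul0r subr0. Qed.
Lemma imZ s y : cim (s%:C * y) = s * cim y.
Proof. by rewrite imM /= mul0r addr0. Qed.

Definition cE := (reD, imD, reN, imN, reM, imM).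

Lemma re_sum I (r : seq I) (P : pred I) (F : I -> R[i]) :
  cre (\sum_(i <- r | P i) F i) = \sum_(i <- r | P i) cre (F i).
Proof. exact: (big_morph _ reD). Qed.

Lemma im_sum I (r : seq I) (P : pred I) (F : I -> R[i]) :
  cim (\sum_(i <- r | P i) F i) = \sum_(i <- r | P i) cim (F i).
Proof. exact: (big_morph _ imD). Qed.

Lemma sqr_normcE x : normc x ^+ 2 = cre x ^+ 2 + cim x ^+ 2.
Proof. by case: x => a b; rewrite /= sqr_sqrtr// addr_ge0 ?sqr_ge0. Qed.

Lemma normcE x : normc x = Num.sqrt (cre x ^+ 2 + cim x ^+ 2).
Proof. by case: x. Qed.

Lemma cnorm_ge0 x : 0 <= normc x.
Proof. by rewrite normcE sqrtr_ge0. Qed.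

Lemma re_le_normc x : `|cre x| <= normc x.
Proof.
by rewrite normcE -sqrtr_sqr ler_wsqrtr// lerDl sqr_ge0.
Qed.

Lemma im_le_normc x : `|cim x| <= normc x.
Proof.
by rewrite normcE -sqrtr_sqr ler_wsqrtr// lerDr sqr_ge0.
Qed.

Lemma normc_le_reim x : normc x <= `|cre x| + `|cim x|.
Proof.
rewrite -(@ler_pXn2r _ 2)// ?nnegrE ?cnorm_ge0 ?addr_ge0//.
rewrite sqr_normcE sqrrD !real_normK ?num_real// lerD2r lerDl.
by rewrite mulrn_wge0// mulr_ge0.
Qed.

Lemma normc_rc s : normc (s%:C) = `|s|.
Proof. by rewrite normcE /= expr0n addr0 sqrtr_sqr. Qed.

Lemma normcB x y : normc (x - y) = normc (y - x).
Proof. by rewrite -normcN opprB. Qed.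

Lemma normc_sum I (r : seq I) (P : pred I) (F : I -> R[i]) :
  normc (\sum_(i <- r | P i) F i) <= \sum_(i <- r | P i) normc (F i).
Proof.
elim/big_rec2: _ => [|i a b _ ab]; first by rewrite normc0.
by rewrite (le_trans (le_normcD _ _))// lerD2l.
Qed.

Lemma normc_prod I (r : seq I) (P : pred I) (F : I -> R[i]) :
  normc (\prod_(i <- r | P i) F i) = \prod_(i <- r | P i) normc (F i).
Proof. exact: (big_morph _ (@normcM R) (@normc1 R)). Qed.

Lemma normc_conj x : normc (conjc x) = normc x.
Proof. by case: x => a b; rewrite /= sqrrN. Qed.

Lemma mulc_conj x : conjc x * x = (normc x ^+ 2)%:C.
Proof.
apply: ceqP; case: x => a b /=; last ring.
by rewrite sqr_sqrtr ?addr_ge0 ?sqr_ge0//; ring.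
Qed.

Lemma expiD s t : expi (s + t) = expi s * expi t.
Proof. by apply: ceqP; rewrite !cE /= ?cosD ?sinD //; ring. Qed.

Lemma expi0 : expi (0 : R) = 1.
Proof. by rewrite /expi cos0 sin0. Qed.

Lemma expiN t : expi (- t) = conjc (expi t).
Proof. by rewrite /expi cosN sinN. Qed.

Lemma normc_expi t : normc (expi t) = 1.
Proof. by rewrite normcE /= cos2Dsin2 sqrtr1. Qed.

Lemma expi_sum I (r : seq I) (P : pred I) (F : I -> R) :
  expi (\sum_(i <- r | P i) F i) = \prod_(i <- r | P i) expi (F i).
Proof. exact: (big_morph _ expiD expi0). Qed.

Lemma cexpD x y : cexp (x + y) = cexp x * cexp y.
Proof.
by rewrite /cexp reD imD expRD expiD rmorphM /= mulrACA.
Qed.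

Lemma cexp0 : cexp (0 : R[i]) = 1.
Proof. by rewrite /cexp /= expR0 expi0 mulr1. Qed.

Lemma normc_cexp x : normc (cexp x) = expR (cre x).
Proof. by rewrite /cexp normcM normc_expi mulr1 normc_rc ger0_norm// expR_ge0. Qed.

Lemma re_cexp x : cre (cexp x) = expR (cre x) * cos (cim x).
Proof. by rewrite /cexp reZ. Qed.
Lemma im_cexp x : cim (cexp x) = expR (cre x) * sin (cim x).
Proof. by rewrite /cexp imZ. Qed.

Lemma cexp_im t : cexp (0 +i* t) = expi t.
Proof. by rewrite /cexp /= expR0 mul1r. Qed.

Lemma cexp_sum I (r : seq I) (P : pred I) (F : I -> R[i]) :
  cexp (\sum_(i <- r | P i) F i) = \prod_(i <- r | P i) cexp (F i).
Proof. exact: (big_morph _ cexpD cexp0). Qed.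

Lemma rcM s t : (s * t)%:C = s%:C * t%:C. Proof. by rewrite rmorphM. Qed.

Lemma rc_prod I (r : seq I) (P : pred I) (F : I -> R) :
  (\prod_(i <- r | P i) F i)%:C = \prod_(i <- r | P i) (F i)%:C.
Proof. exact: rmorph_prod. Qed.

Lemma rc_sum I (r : seq I) (P : pred I) (F : I -> R) :
  (\sum_(i <- r | P i) F i)%:C = \sum_(i <- r | P i) (F i)%:C.
Proof. exact: rmorph_sum. Qed.

End complex_facts.

(** * Integrals of complex-valued functions *)

Section cmeasurable_facts.
Variable R : realType.
Local Open Scope complex_scope.
Context d (T : measurableType d).
Implicit Types (f g : T -> R[i]) (k : T -> R).

Lemma cmeasurableD f g : cmeasurable f -> cmeasurable g ->
  cmeasurable (fun x => f x + g x).
Proof.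
move=> [f1 f2] [g1 g2]; split.
  under eq_fun do rewrite reD; exact: measurable_funD.
under eq_fun do rewrite imD; exact: measurable_funD.
Qed.

Lemma cmeasurableM f g : cmeasurable f -> cmeasurable g ->
  cmeasurable (fun x => f x * g x).
Proof.
move=> [f1 f2] [g1 g2]; split.
  under eq_fun do rewrite reM.
  by apply: measurable_funB; apply: measurable_funM.
under eq_fun do rewrite imM.
by apply: measurable_funD; apply: measurable_funM.
Qed.

Lemma cmeasurable_cst (c : R[i]) : cmeasurable (fun _ : T => c).
Proof. by split; exact: measurable_cst. Qed.

Lemma cmeasurable_rc k : measurable_fun setT k -> cmeasurable (fun x => (k x)%:C).
Proof. by split => //; exact: measurable_cst. Qed.

Lemma cmeasurable_conj f : cmeasurable f -> cmeasurable (fun x => conjc (f x)).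
Proof.
move=> [f1 f2]; split.
  by rewrite (_ : (fun _ => _) = (fun x => cre (f x)))//; apply/funext => x; case: (f x).
rewrite (_ : (fun _ => _) = (fun x => - cim (f x))).
  exact: measurable_funN.
by apply/funext => x; case: (f x).
Qed.

Lemma cmeasurable_expi k : measurable_fun setT k -> cmeasurable (fun x => expi (k x)).
Proof.
move=> mk; split => /=.
  by apply: (measurableT_comp _ mk); apply: continuous_measurable_fun; exact: continuous_cos.
by apply: (measurableT_comp _ mk); apply: continuous_measurable_fun; exact: continuous_sin.
Qed.

Lemma cmeasurable_cexp f : cmeasurable f -> cmeasurable (fun x => cexp (f x)).
Proof.
move=> [f1 f2]; apply: cmeasurableM; last exact: cmeasurable_expi.
by apply: cmeasurable_rc; apply: (measurableT_comp _ f1); exact: measurable_expR.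
Qed.

Lemma cmeasurable_sum I (r : seq I) (P : pred I) (F : I -> T -> R[i]) :
  (forall i, cmeasurable (F i)) -> cmeasurable (fun x => \sum_(i <- r | P i) F i x).
Proof.
move=> mF; elim: r => [|i r IH].
  under eq_fun do rewrite big_nil; exact: cmeasurable_cst.
under eq_fun do rewrite big_cons; case: (P i) => //.
exact: cmeasurableD.
Qed.

Lemma cmeasurable_prod I (r : seq I) (P : pred I) (F : I -> T -> R[i]) :
  (forall i, cmeasurable (F i)) -> cmeasurable (fun x => \prod_(i <- r | P i) F i x).
Proof.
move=> mF; elim: r => [|i r IH].
  under eq_fun do rewrite big_nil; exact: cmeasurable_cst.
under eq_fun do rewrite big_cons; case: (P i) => //.
exact: cmeasurableM.
Qed.

Lemma measurable_normc f : cmeasurable f -> measurable_fun setT (fun x => normc (f x)).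
Proof.
move=> [f1 f2]; under eq_fun do rewrite normcE.
have m : measurable_fun setT (fun x => cre (f x) ^+ 2 + cim (f x) ^+ 2).
  by apply: measurable_funD; exact: measurable_funX.
apply: (measurableT_comp _ m).
by apply: continuous_measurable_fun; exact: sqrt_continuous.
Qed.

End cmeasurable_facts.

Lemma cmeasurable_comp (R : realType) d d' (T : measurableType d)
    (T' : measurableType d') (f : T' -> R[i]) (k : T -> T') :
  measurable_fun setT k -> cmeasurable f -> cmeasurable (fun x => f (k x)).
Proof.
move=> mk [f1 f2]; split; first exact: (measurableT_comp f1 mk).
exact: (measurableT_comp f2 mk).
Qed.

Lemma integrable_measurable (R : realType) d (T : measurableType d)
    (mu : {measure set T -> \bar R}) (f : T -> R) :
  mu.-integrable setT (EFin \o f) -> measurable_fun setT f.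
Proof. by case/integrableP => /measurable_EFinP. Qed.

Lemma measurable_EFin (R : realType) d (T : measurableType d) (f : T -> R) :
  measurable_fun setT f -> measurable_fun setT (fun x => (f x)%:E).
Proof. by move/measurable_EFinP. Qed.

Lemma integrable_le (R : realType) d (T : measurableType d)
    (mu : {measure set T -> \bar R}) (f g : T -> R) :
  measurable_fun setT f -> (forall x, `|f x| <= g x) ->
  mu.-integrable setT (EFin \o g) -> mu.-integrable setT (EFin \o f).
Proof.
move=> mf fg ig; apply: (le_integrable _ _ _ ig) => //; first exact/measurable_EFinP.
by move=> x _ /=; rewrite lee_fin (le_trans (fg x))// ler_norm.
Qed.

Section cintegral.
Variable R : realType.
Local Open Scope complex_scope.
Context d (T : measurableType d) (mu : {measure set T -> \bar R}).
Implicit Types (f g : T -> R[i]) (k : T -> R).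

Definition Cint f : R[i] :=
  (\int[mu]_x cre (f x)) +i* (\int[mu]_x cim (f x)).

Lemma re_Cint f : cre (Cint f) = \int[mu]_x cre (f x). Proof. by []. Qed.
Lemma im_Cint f : cim (Cint f) = \int[mu]_x cim (f x). Proof. by []. Qed.

Lemma eq_Cint f g : f =1 g -> Cint f = Cint g.
Proof. by move=> fg; congr Cint; apply/funext. Qed.

Lemma cintegrable_le f k : cmeasurable f -> (forall x, normc (f x) <= k x) ->
  mu.-integrable setT (EFin \o k) -> cintegrable mu f.
Proof.
move=> [f1 f2] fk ik; split.
  by apply: (integrable_le f1 _ ik) => x; rewrite (le_trans (re_le_normc _)).
by apply: (integrable_le f2 _ ik) => x; rewrite (le_trans (im_le_normc _)).
Qed.

Lemma cintegrable_cmeasurable f : cintegrable mu f -> cmeasurable f.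
Proof.
by move=> [/integrableP[f1 _] /integrableP[f2 _]]; split; apply/measurable_EFinP.
Qed.

Lemma integrable_normc f : cintegrable mu f ->
  mu.-integrable setT (EFin \o (fun x => normc (f x))).
Proof.
move=> fi; have mf := cintegrable_cmeasurable fi; case: fi => [f1 f2].
apply: (@integrable_le _ _ _ _ _ (fun x => `|cre (f x)| + `|cim (f x)|)).
- exact: measurable_normc.
- by move=> x; rewrite ger0_norm ?cnorm_ge0// normc_le_reim.
- rewrite (_ : _ \o _ = (fun x => `|(cre (f x))%:E| + `|(cim (f x))%:E|)%E)//.
  by apply: integrableD => //; exact: integrable_abse.
Qed.

Lemma cintegrable_norm_lty f : cmeasurable f ->
  (\int[mu]_x (normc (f x))%:E < +oo)%E -> cintegrable mu f.
Proof.
move=> mf fi; apply: (cintegrable_le mf (fun x => lexx _)).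
apply/integrableP; split; first exact/measurable_EFinP/measurable_normc.
rewrite (eq_integral (fun x => (normc (f x))%:E))// => x _ /=.
by rewrite ger0_norm// cnorm_ge0.
Qed.

Lemma cintegrableD f g : cintegrable mu f -> cintegrable mu g ->
  cintegrable mu (fun x => f x + g x).
Proof.
move=> [f1 f2] [g1 g2]; split.
  under eq_fun do rewrite reD EFinD; exact: integrableD.
under eq_fun do rewrite imD EFinD; exact: integrableD.
Qed.

Lemma cintegrableZ (c : R[i]) f : cintegrable mu f -> cintegrable mu (fun x => c * f x).
Proof.
move=> fi; apply: (@cintegrable_le _ (fun x => normc c * normc (f x))).
- apply: cmeasurableM; first exact: cmeasurable_cst.
  exact: cintegrable_cmeasurable fi.
- by move=> x; rewrite normcM.
- have := integrable_normc fi => /(integrableZl measurableT (normc c)).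
  by apply: eq_integrable => // x _ /=; rewrite EFinM.
Qed.

Lemma CintD f g : cintegrable mu f -> cintegrable mu g ->
  Cint (fun x => f x + g x) = Cint f + Cint g.
Proof.
move=> [f1 f2] [g1 g2]; apply: ceqP; rewrite ?reD ?imD /=.
  by under eq_Rintegral do rewrite reD; rewrite RintegralD.
by under eq_Rintegral do rewrite imD; rewrite RintegralD.
Qed.

Lemma CintZ (c : R[i]) f : cintegrable mu f -> Cint (fun x => c * f x) = c * Cint f.
Proof.
move=> [f1 f2].
have iZ r k : mu.-integrable setT (fun x => (k x)%:E) ->
    mu.-integrable setT (EFin \o (fun x => r * k x)).
  move=> /(integrableZl measurableT r); apply: eq_integrable => // x _ /=.
apply: ceqP; rewrite ?reM ?imM /=.
  under eq_Rintegral do rewrite reM.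
  by rewrite RintegralB// ?RintegralZl//; exact: iZ.
under eq_Rintegral do rewrite imM.
by rewrite RintegralD// ?RintegralZl//; exact: iZ.
Qed.

Lemma CintZr (c : R[i]) f : cintegrable mu f -> Cint (fun x => f x * c) = Cint f * c.
Proof.
move=> fi; rewrite mulrC -CintZ//; apply: eq_Cint => x; exact: mulrC.
Qed.

Lemma CintN f : cintegrable mu f -> Cint (fun x => - f x) = - Cint f.
Proof.
move=> fi; rewrite -mulN1r -CintZ//; apply: eq_Cint => x; by rewrite mulN1r.
Qed.

Lemma cintegrableN f : cintegrable mu f -> cintegrable mu (fun x => - f x).
Proof.
by move=> /(cintegrableZ (-1)); under eq_fun do rewrite mulN1r.
Qed.

Lemma cintegrable0 : cintegrable mu (fun=> 0).
Proof. by split => /=; exact: integrable0. Qed.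

Lemma Cint0 : Cint (fun=> 0) = 0.
Proof. by apply: ceqP => /=; rewrite /Rintegral integral0. Qed.

Lemma cintegrable_sum I (r : seq I) (P : pred I) (F : I -> T -> R[i]) :
  (forall i, cintegrable mu (F i)) ->
  cintegrable mu (fun x => \sum_(i <- r | P i) F i x).
Proof.
move=> iF; elim: r => [|i r IH].
  by under eq_fun do rewrite big_nil; exact: cintegrable0.
under eq_fun do rewrite big_cons; case: (P i) => //.
exact: cintegrableD.
Qed.

Lemma Cint_sum I (r : seq I) (P : pred I) (F : I -> T -> R[i]) :
  (forall i, cintegrable mu (F i)) ->
  Cint (fun x => \sum_(i <- r | P i) F i x) = \sum_(i <- r | P i) Cint (F i).
Proof.
move=> iF; elim: r => [|i r IH].
  by under eq_Cint do rewrite big_nil; rewrite Cint0 big_nil.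
under eq_Cint do rewrite big_cons; rewrite big_cons; case: (P i) => //.
by rewrite CintD// ?IH//; exact: cintegrable_sum.
Qed.

(** Multiplying by the conjugate of the integral turns it into a real
    number, whose integrand is bounded by the modulus. *)
Lemma normc_Cint f : cintegrable mu f -> normc (Cint f) <= \int[mu]_x normc (f x).
Proof.
move=> fi; set I := Cint f; set J := Rintegral _ _ _.
have iN := integrable_normc fi.
have J0 : 0 <= J by apply: Rintegral_ge0 => x _; exact: cnorm_ge0.
have [I0|I0] := eqVneq (normc I) 0; first by rewrite I0.
have Ip : 0 < normc I by rewrite lt_neqAle eq_sym I0 cnorm_ge0.
rewrite -(ler_pM2l Ip) -expr2.
have -> : normc I ^+ 2 = cre (Cint (fun x => conjc I * f x)).
  by rewrite CintZ// mulc_conj.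
rewrite /J -RintegralZl// re_Cint; apply: le_Rintegral => //.
- by case: (cintegrableZ (conjc I) fi).
- have := iN => /(integrableZl measurableT (normc I)).
  by apply: eq_integrable => // x _ /=; rewrite EFinM.
- move=> x _; rewrite (le_trans (ler_norm _))// (le_trans (re_le_normc _))//.
  by rewrite normcM normc_conj.
Qed.

Lemma normc_Cint_le f k : cmeasurable f -> (forall x, normc (f x) <= k x) ->
  mu.-integrable setT (EFin \o k) -> normc (Cint f) <= \int[mu]_x k x.
Proof.
move=> mf fk ik; have fi := cintegrable_le mf fk ik.
rewrite (le_trans (normc_Cint fi))//; apply: le_Rintegral => //.
exact: integrable_normc.
Qed.

Lemma cintegrable_rc k : mu.-integrable setT (EFin \o k) ->
  cintegrable mu (fun x => (k x)%:C).
Proof. by move=> ik; split => //=; exact: integrable0. Qed.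

Lemma Cint_rc k : Cint (fun x => (k x)%:C) = (\int[mu]_x k x)%:C.
Proof. by apply: ceqP => //=; rewrite /Rintegral integral0. Qed.

Lemma cintegrableM_bounded f g (B : R) : cintegrable mu f -> cmeasurable g ->
  (forall x, normc (g x) <= B) -> cintegrable mu (fun x => f x * g x).
Proof.
move=> fi mg gB; apply: (@cintegrable_le _ (fun x => B * normc (f x))).
- apply: cmeasurableM => //; exact: cintegrable_cmeasurable fi.
- by move=> x; rewrite normcM mulrC ler_wpM2r// cnorm_ge0.
- have := integrable_normc fi => /(integrableZl measurableT B).
  by apply: eq_integrable => // x _ /=; rewrite EFinM.
Qed.

End cintegral.
(** * Limits and exchange of integrals *)

Section ccvg.
Variable R : realType.
Local Open Scope complex_scope.
Implicit Types (u v : nat -> R[i]) (l c : R[i]).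

Definition ccvg u l : Prop := (fun n => normc (u n - l)) @ \oo --> (0 : R).

Lemma ccvg_squeeze u l (e : nat -> R) : (forall n, normc (u n - l) <= e n) ->
  e @ \oo --> (0 : R) -> ccvg u l.
Proof.
move=> ue e0; apply: (@squeeze_cvgr _ _ _ _ (fun=> 0) e) => //; last exact: cvg_cst.
by apply: nearW => n; rewrite cnorm_ge0 ue.
Qed.

Lemma ccvg_cst l : ccvg (fun=> l) l.
Proof. by rewrite /ccvg; under eq_fun do rewrite subrr normc0; exact: cvg_cst. Qed.

Lemma ccvgD u v l c : ccvg u l -> ccvg v c -> ccvg (fun n => u n + v n) (l + c).
Proof.
move=> ul vc; apply: (ccvg_squeeze (e := fun n => normc (u n - l) + normc (v n - c))).
  by move=> n; rewrite opprD addrACA le_normcD.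
rewrite -[X in _ --> X](addr0 0); exact: cvgD.
Qed.

Lemma ccvgZ c u l : ccvg u l -> ccvg (fun n => c * u n) (c * l).
Proof.
move=> ul; apply: (ccvg_squeeze (e := fun n => normc c * normc (u n - l))).
  by move=> n; rewrite -mulrBr normcM.
rewrite -[X in _ --> X](mulr0 (normc c)).
by apply: cvgM => //; exact: cvg_cst.
Qed.

Lemma ccvg_sum I (r : seq I) (P : pred I) (F : I -> nat -> R[i]) (G : I -> R[i]) :
  (forall i, ccvg (F i) (G i)) ->
  ccvg (fun n => \sum_(i <- r | P i) F i n) (\sum_(i <- r | P i) G i).
Proof.
move=> FG; elim: r => [|i r IH].
  by under eq_fun do rewrite big_nil; rewrite big_nil; exact: ccvg_cst.
under eq_fun do rewrite big_cons; rewrite big_cons; case: (P i) => //.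
exact: ccvgD.
Qed.

Lemma ccvg_normc_le u l (B : R) : ccvg u l -> (forall n, normc (u n) <= B) ->
  normc l <= B.
Proof.
move=> ul uB.
have c1 : (fun n => B + normc (u n - l)) @ \oo --> (B + 0 : R).
  by apply: cvgD => //; exact: cvg_cst.
rewrite -[leRHS]addr0.
apply: (ler_cvg_to (cvg_cst (normc l)) c1); apply: nearW => n.
have := le_normcD (u n) (l - u n); rewrite addrC subrK normcB => /le_trans; apply.
by rewrite lerD2r.
Qed.

Lemma ccvg_unique u l c : ccvg u l -> ccvg u c -> l = c.
Proof.
move=> ul uc; apply/eqP; rewrite -subr_eq0; apply/eqP/eq0_normc.
have : ccvg (fun=> 0) (l - c).
  move: (ccvgD ul (ccvgZ (-1) uc)); rewrite mulN1r.
  by under eq_fun do rewrite mulN1r subrr.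
move=> /ccvg_normc_le h; apply/eqP; rewrite eq_le cnorm_ge0 andbT.
by apply: h => n; rewrite normc0.
Qed.

Lemma ccvg_reim u l : (fun n => cre (u n)) @ \oo --> cre l ->
  (fun n => cim (u n)) @ \oo --> cim l -> ccvg u l.
Proof.
move=> rl il; apply: (ccvg_squeeze
    (e := fun n => `|cre (u n) - cre l| + `|cim (u n) - cim l|)).
  by move=> n; rewrite (le_trans (normc_le_reim _))// !reD !imD !reN !imN.
rewrite -[X in _ --> X](addr0 0); apply: cvgD.
  rewrite -(normr0 R) -(subrr (cre l)); apply: cvg_norm.
  by apply: cvgB => //; exact: cvg_cst.
rewrite -(normr0 R) -(subrr (cim l)); apply: cvg_norm.
by apply: cvgB => //; exact: cvg_cst.
Qed.

Lemma ccvg_re u l : ccvg u l -> (fun n => cre (u n)) @ \oo --> cre l.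
Proof.
move=> ul; apply/cvgrPdist_le => e e0.
have /cvgrPdist_le /(_ e e0) := ul; apply: filterS => n /=.
rewrite sub0r normrN ger0_norm ?cnorm_ge0// => /(le_trans _); apply.
by rewrite -reN -reD normcB re_le_normc.
Qed.

Lemma ccvg_im u l : ccvg u l -> (fun n => cim (u n)) @ \oo --> cim l.
Proof.
move=> ul; apply/cvgrPdist_le => e e0.
have /cvgrPdist_le /(_ e e0) := ul; apply: filterS => n /=.
rewrite sub0r normrN ger0_norm ?cnorm_ge0// => /(le_trans _); apply.
by rewrite -imN -imD normcB im_le_normc.
Qed.

Lemma cvg_expi (t : nat -> R) (s : R) : t @ \oo --> s -> ccvg (fun n => expi (t n)) (expi s).
Proof.
move=> tl; apply: ccvg_reim => /=.
  by apply: (cvg_comp _ _ tl); exact: continuous_cos.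
by apply: (cvg_comp _ _ tl); exact: continuous_sin.
Qed.

End ccvg.

Section limits_of_integrals.
Variable R : realType.
Local Open Scope complex_scope.
Context d (T : measurableType d) (mu : {measure set T -> \bar R}).

Lemma Rdominated_cvg (f_ : nat -> T -> R) (f k : T -> R) :
  (forall n, measurable_fun setT (f_ n)) -> measurable_fun setT f ->
  (forall x, f_ ^~ x @ \oo --> f x) -> (forall n x, `|f_ n x| <= k x) ->
  mu.-integrable setT (EFin \o k) ->
  (fun n => \int[mu]_x f_ n x) @ \oo --> \int[mu]_x f x.
Proof.
move=> mf_ mf ff fk ik.
have [|||||fi _] := @dominated_convergence _ _ _ mu setT measurableT
    (fun n => EFin \o f_ n) (EFin \o f) (EFin \o k).
- by move=> n; apply/measurable_EFinP.
- exact/measurable_EFinP.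
- by apply: nearW => x _ /=; apply: cvg_EFin; [exact: nearW|exact: ff].
- exact: ik.
- by apply: nearW => x n _ /=; rewrite lee_fin.
move=> h; apply: fine_cvg; rewrite /Rintegral fineK; last exact: integrable_fin_num.
exact: h.
Qed.

Lemma cdominated_cvg (f_ : nat -> T -> R[i]) (f : T -> R[i]) (k : T -> R) :
  (forall n, cmeasurable (f_ n)) -> cmeasurable f ->
  (forall x, ccvg (f_ ^~ x) (f x)) -> (forall n x, normc (f_ n x) <= k x) ->
  mu.-integrable setT (EFin \o k) ->
  ccvg (fun n => Cint mu (f_ n)) (Cint mu f).
Proof.
move=> mf_ mf ff fk ik; apply: ccvg_reim.
  apply: (@Rdominated_cvg (fun n x => cre (f_ n x)) _ k) => //.
  - by move=> n; case: (mf_ n).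
  - by case: mf.
  - by move=> x; exact: (ccvg_re (ff x)).
  - by move=> n x; rewrite (le_trans (re_le_normc _)).
apply: (@Rdominated_cvg (fun n x => cim (f_ n x)) _ k) => //.
- by move=> n; case: (mf_ n).
- by case: mf.
- by move=> x; exact: (ccvg_im (ff x)).
- by move=> n x; rewrite (le_trans (im_le_normc _)).
Qed.

End limits_of_integrals.

Section fubini.
Variable R : realType.
Local Open Scope complex_scope.
Context d1 d2 (T1 : measurableType d1) (T2 : measurableType d2).
Variables (m1 : {sigma_finite_measure set T1 -> \bar R})
          (m2 : {sigma_finite_measure set T2 -> \bar R}).

Lemma product_dominated_integrable (f : T1 * T2 -> R) (g : T1 -> R) (h : T2 -> R) :
  measurable_fun setT f -> (forall x y, `|f (x, y)| <= g x * h y) ->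
  m1.-integrable setT (EFin \o g) -> m2.-integrable setT (EFin \o h) ->
  (m1 \x m2)%E.-integrable setT (EFin \o f).
Proof.
move=> mf fgh ig ih; apply/integrable12ltyP; first exact/measurable_EFinP.
have mg : measurable_fun setT g by case/integrableP : ig => /measurable_EFinP.
have mh : measurable_fun setT h by case/integrableP : ih => /measurable_EFinP.
pose Ih := (\int[m2]_y `|(h y)%:E|)%E.
have Ihf : Ih \is a fin_num.
  by rewrite ge0_fin_numE ?integral_ge0//; case/integrableP : ih.
apply: (@le_lt_trans _ _ (\int[m1]_x (`|(g x)%:E| * Ih))%E); last first.
  rewrite ge0_integralZr//.
  - rewrite lte_mul_pinfty// ?integral_ge0// ?ge0_fin_numE ?integral_ge0//.
      by case/integrableP : ig.
    by rewrite -ge0_fin_numE ?integral_ge0//.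
  - by apply/measurableT_comp => //; exact/measurable_EFinP.
  - exact: integral_ge0.
apply: ge0_le_integral => //.
- by move=> x _; exact: integral_ge0.
- apply: (@measurable_fun_fubini_tonelli_F _ _ _ _ _ m2 (fun z => `|(f z)%:E|%E)) => //.
  by apply/measurableT_comp => //; exact/measurable_EFinP.
- apply: emeasurable_funM => //.
  by apply/measurableT_comp => //; exact/measurable_EFinP.
move=> x _; rewrite -ge0_integralZl//; last first.
  by apply/measurableT_comp => //; exact/measurable_EFinP.
apply: ge0_le_integral => //=.
- apply/measurable_EFinP/measurableT_comp => //.
  exact: measurableT_comp.
- apply/measurable_EFinP; apply: measurable_funM => //.
  exact: measurableT_comp.
- move=> y _; rewrite lee_fin (le_trans (fgh x y))//.
  by rewrite -normrM ler_norm.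
Qed.

Lemma RFubini_dominated (f : T1 * T2 -> R) (g : T1 -> R) (h : T2 -> R) :
  measurable_fun setT f -> (forall x y, `|f (x, y)| <= g x * h y) ->
  m1.-integrable setT (EFin \o g) -> m2.-integrable setT (EFin \o h) ->
  [/\ \int[m1]_x \int[m2]_y f (x, y) = \int[m2]_y \int[m1]_x f (x, y),
      \int[(m1 \x m2)%E]_z f z = \int[m1]_x \int[m2]_y f (x, y) &
      measurable_fun setT (fun x => \int[m2]_y f (x, y))].
Proof.
move=> mf fgh ig ih; have fi := product_dominated_integrable mf fgh ig ih.
have i2 x : m2.-integrable setT (EFin \o (fun y => f (x, y))).
  apply: (@integrable_le _ _ _ _ _ (fun y => g x * h y)) => //.
    exact: measurableT_comp.
  have := integrableZl measurableT (g x) ih.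
  by apply: eq_integrable => // y _ /=; rewrite EFinM.
have i1 y : m1.-integrable setT (EFin \o (fun x => f (x, y))).
  apply: (@integrable_le _ _ _ _ _ (fun x => h y * g x)) => //.
  - exact: measurableT_comp.
  - by move=> x; rewrite mulrC.
  - have := integrableZl measurableT (h y) ig.
    by apply: eq_integrable => // x _ /=; rewrite EFinM.
have e1 x : (\int[m2]_y f (x, y))%:E = (\int[m2]_y (EFin \o f) (x, y))%E.
  by rewrite fineK// integrable_fin_num//; exact: i2.
have e2 y : (\int[m1]_x f (x, y))%:E = (\int[m1]_x (EFin \o f) (x, y))%E.
  by rewrite fineK// integrable_fin_num//; exact: i1.
split.
- congr fine; under eq_integral do rewrite e1.
  by under [RHS]eq_integral do rewrite e2; exact: Fubini.
- by congr fine; under [RHS]eq_integral do rewrite e1; rewrite integral12_prod_meas1.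
- apply/measurable_EFinP; rewrite (_ : _ \o _ = fubini_F m2 (EFin \o f)).
    exact: (measurable_fubini_F fi).
  by apply/funext => x /=; rewrite e1.
Qed.

(** A product bound makes every section integrable, so the two iterated
    integrals are honest complex numbers everywhere. *)
Lemma cFubini (f : T1 * T2 -> R[i]) (g : T1 -> R) (h : T2 -> R) :
  cmeasurable f -> (forall x y, normc (f (x, y)) <= g x * h y) ->
  m1.-integrable setT (EFin \o g) -> m2.-integrable setT (EFin \o h) ->
  [/\ Cint m1 (fun x => Cint m2 (fun y => f (x, y))) =
        Cint m2 (fun y => Cint m1 (fun x => f (x, y))),
      Cint (m1 \x m2)%E f = Cint m1 (fun x => Cint m2 (fun y => f (x, y))) &
      cmeasurable (fun x => Cint m2 (fun y => f (x, y)))].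
Proof.
move=> [mf1 mf2] fgh ig ih.
have [|r1 r2 r3] := RFubini_dominated mf1 _ ig ih.
  by move=> x y; rewrite (le_trans (re_le_normc _)).
have [|i1 i2 i3] := RFubini_dominated mf2 _ ig ih.
  by move=> x y; rewrite (le_trans (im_le_normc _)).
by split; [apply: ceqP|apply: ceqP|split].
Qed.

End fubini.
(** * Lebesgue measure on row vectors *)

Section measurability.
Variables (R : realType).
Local Open Scope complex_scope.

Lemma measurable_continuousV m (f : 'rV[R]_m -> R) :
  continuous (f : 'rV[R]_m -> R^o) -> measurable_fun setT (f : borelV R m -> R).
Proof.
move=> cf; apply: (@measurability _ _ _ (measurableTypeR R) _ _ _
  (RGenOpens.measurableE R)) => _ [_ [a [b ->]] <-].
rewrite setTI; apply: sub_sigma_algebra.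
by apply: open_comp; [move=> x _; exact: cf|exact: interval_open].
Qed.

Lemma measurable_coord m (j : 'I_m) :
  measurable_fun setT (fun x : borelV R m => x ord0 j).
Proof. by apply: measurable_continuousV => x; exact: coord_continuous. Qed.

(** [consV] is measurable for the Borel sets, so coordinates can be added one at
    a time. *)
Lemma measurable_rV d (T : measurableType d) m (k : T -> borelV R m) :
  (forall j, measurable_fun setT (fun x => k x ord0 j)) -> measurable_fun setT k.
Proof.
elim: m k => [|m IH] k mk.
  rewrite (_ : k = cst 0); first exact: measurable_cst.
  by apply/funext => x; exact: thinmx0.
pose k0 x : measurableTypeR R := k x ord0 (lshift m (ord0 : 'I_1)).
pose k1 x : borelV R m := rsubmx (k x : 'rV[R]_(1 + m)).
rewrite (_ : k = @consV R m \o (fun x => (k0 x, k1 x))); last first.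
  by apply/funext => x; rewrite -[LHS](@unconsVK R m).
apply: (measurableT_comp (@measurable_consV R m)).
apply/measurable_fun_pair => /=; first exact: mk.
apply: IH => j; rewrite (_ : (fun _ => _) = (fun x => k x ord0 (rshift 1 j)))//.
by apply/funext => x; rewrite mxE.
Qed.

Lemma measurable_dot d (T : measurableType d) m (k l : T -> borelV R m) :
  measurable_fun setT k -> measurable_fun setT l ->
  measurable_fun setT (fun x => dot (k x) (l x)).
Proof.
move=> mk ml; apply: measurable_sum => j.
apply: measurable_funM.
  exact: (measurableT_comp (measurable_coord j) mk).
exact: (measurableT_comp (measurable_coord j) ml).
Qed.

Lemma measurable_affineV m (al : R) (b : 'rV[R]_m) :
  measurable_fun setT (fun x : borelV R m => al *: x + b : borelV R m).
Proof.
apply: measurable_rV => j; under eq_fun do rewrite !mxE.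
apply: measurable_funD => //; apply: measurable_funM => //; exact: measurable_coord.
Qed.

Lemma measurable_prod_coord m (f : 'I_m -> R -> R) :
  (forall j, measurable_fun setT (f j)) ->
  measurable_fun setT (fun x : borelV R m => \prod_j f j (x ord0 j)).
Proof.
move=> mf; apply: measurable_prod => j _.
exact: (measurableT_comp (mf j) (measurable_coord j)).
Qed.

End measurability.

Definition push_measure (R : realType) d d' (T : measurableType d)
    (T' : measurableType d') (mu : {measure set T -> \bar R}) (f : T -> T')
    (mf : measurable_fun setT f) : {measure set T' -> \bar R} :=
  measure_function_pushforward__canonical__measure_function_Measure mu mf.

Section affine_line.
Variable R : realType.
Local Notation leb := (@lebesgue_measure R).

Definition affine1 (al b x : R) : R := al * x + b.

Lemma measurable_affine1 al b :
  measurable_fun setT (affine1 al b : measurableTypeR R -> measurableTypeR R).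
Proof. by apply: measurable_funD => //; exact: measurable_funM. Qed.

(** The two sides are measures that agree on intervals. *)
Lemma lebesgue_affine al b (A : set (measurableTypeR R)) : al != 0 -> measurable A ->
  (leb A = `|al|%:E * leb (affine1 al b @^-1` A))%E.
Proof.
move=> al0 mA.
pose mu : {measure set (measurableTypeR R) -> \bar R} :=
  mscale (NngNum (normr_ge0 al)) (push_measure leb (@measurable_affine1 al b)).
rewrite (@lebesgue_measure_unique R mu)// => X [[x y] _ <-]{A mA}.
rewrite [RHS]/(mscale _ _ _)/= /pushforward.
have [yx|xy] := leP y x.
  rewrite set_itv_ge ?bnd_simp -?leNgt// preimage_set0 !measure0 mule0//.
rewrite lebesgue_measure_itv/= lte_fin xy.
have alV : al * al^-1 = 1 by rewrite mulfV.
have [alp|aln] := ltP 0 al.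
  have -> : affine1 al b @^-1` `]x, y] = `](x - b) / al, (y - b) / al]%classic.
    apply/seteqP; split => z /=; rewrite !in_itv/= /affine1;
    by rewrite ltr_pdivrMr// ler_pdivlMr// ltrBlDr lerBrDr (mulrC al).
  rewrite lebesgue_measure_itv/= lte_fin ltr_pM2r ?invr_gt0// ltrD2r xy.
  by rewrite gtr0_norm// -!EFinB -EFinM; congr EFin; field.
have {aln}aln : al < 0 by rewrite lt_neqAle al0.
have -> : affine1 al b @^-1` `]x, y] = `[(y - b) / al, (x - b) / al[%classic.
  apply/seteqP; split => z /=; rewrite !in_itv/= /affine1;
  by rewrite ltr_ndivlMr// ler_ndivrMr// ltrBlDr lerBrDr (mulrC al) andbC.
rewrite lebesgue_measure_itv/= lte_fin ltr_nM2r ?invr_lt0// ltrD2r xy.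
by rewrite ltr0_norm// -!EFinB -EFinM; congr EFin; field.
Qed.

End affine_line.

Section lebesgueV_tonelli.
Variable R : realType.
Local Open Scope complex_scope.
Local Notation leb := (@lebesgue_measure R).

Lemma lebesgueVS_integral m (f : borelV R (1 + m) -> \bar R) :
  measurable_fun setT f -> (forall x, 0 <= f x)%E ->
  (\int[lebesgueV R m.+1]_x f x =
   \int[(leb \x lebesgueV R m)%E]_z f (consV z))%E.
Proof.
move=> mf f0.
by rewrite -[RHS](@ge0_integral_pushforward _ _ _ _ _ _ (@measurable_consV R m) _ setT f).
Qed.

Lemma lebesgueVS_tonelli m (f : borelV R (1 + m) -> \bar R) :
  measurable_fun setT f -> (forall x, 0 <= f x)%E ->
  (\int[lebesgueV R m.+1]_x f x =
   \int[leb]_a \int[lebesgueV R m]_v f (consV (a, v)))%E.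
Proof.
move=> mf f0; rewrite lebesgueVS_integral// fubini_tonelli1//.
exact: (measurableT_comp mf (@measurable_consV R m)).
Qed.

Lemma lebesgueVS_Rintegral m (f : borelV R (1 + m) -> R) :
  (lebesgueV R m.+1).-integrable setT (EFin \o f) ->
  \int[lebesgueV R m.+1]_x f x = \int[(leb \x lebesgueV R m)%E]_z f (consV z).
Proof.
move=> fi; have mf : measurable_fun setT (EFin \o f) by case/integrableP : fi.
congr fine.
rewrite -[RHS](@integral_pushforward _ _ _ _ _ _ (@measurable_consV R m) _ setT (EFin \o f))//.
apply/integrableP; split.
  exact: (measurableT_comp mf (@measurable_consV R m)).
rewrite preimage_setT -(@lebesgueVS_integral _ (fun x => `|(f x)%:E|%E))//.
- by case/integrableP : fi.
- exact: measurableT_comp.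
Qed.

Lemma consV_lift m (p : measurableTypeR R * borelV R m) (j : 'I_m) :
  consV p ord0 (lift ord0 j : 'I_(1 + m)) = p.2 ord0 j.
Proof.
rewrite /consV (_ : lift ord0 j = rshift 1 j); last exact: val_inj.
by rewrite row_mxEr.
Qed.

Lemma consV0 m (p : measurableTypeR R * borelV R m) :
  consV p ord0 (ord0 : 'I_(1 + m)) = p.1.
Proof.
rewrite /consV (_ : ord0 = lshift m (ord0 : 'I_1)); last exact: val_inj.
by rewrite row_mxEl mxE.
Qed.

Lemma integral_prod_coord m (f : 'I_m -> R -> R) (c : 'I_m -> R) :
  (forall j, measurable_fun setT (f j)) -> (forall j x, 0 <= f j x) ->
  (forall j, \int[leb]_x (f j x)%:E = (c j)%:E)%E ->
  (\int[lebesgueV R m]_x (\prod_j f j (x ord0 j))%:E = (\prod_j c j)%:E)%E.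
Proof.
elim: m f c => [|m IH] f c mf f0 fc.
  rewrite integral_dirac ?diracT ?mul1e ?big_ord0//.
  by under eq_fun do rewrite big_ord0; exact: measurable_cst.
have mp : measurable_fun setT
    (fun x : borelV R m => (\prod_(i < m) f (lift ord0 i) (x ord0 i))%:E).
  apply/measurable_EFinP; apply: (@measurable_prod_coord _ _ (fun i => f (lift ord0 i))).
  by move=> j; exact: mf.
rewrite lebesgueVS_tonelli; last 2 first.
- by apply/measurable_EFinP; exact: (@measurable_prod_coord _ m.+1 f).
- by move=> x; rewrite lee_fin prodr_ge0.
have inner a : (\int[lebesgueV R m]_v
      (\prod_j f j (consV (a, v) ord0 (j : 'I_(1 + m))))%:E =
    (f ord0 a)%:E * (\prod_(i < m) c (lift ord0 i))%:E)%E.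
  rewrite -(IH (fun i => f (lift ord0 i)))//.
  rewrite -ge0_integralZl ?lee_fin//; last first.
    by move=> v _; rewrite lee_fin prodr_ge0.
  apply: eq_integral => v _; rewrite -EFinM big_ord_recl consV0; congr EFin.
  by congr (_ * _); apply: eq_bigr => j _; rewrite consV_lift.
under eq_integral do rewrite inner.
have c0 j : 0 <= c j by rewrite -lee_fin -fc integral_ge0// => x _; rewrite lee_fin.
rewrite ge0_integralZr ?lee_fin ?prodr_ge0//; last first.
- by move=> x _; rewrite lee_fin.
- exact: (measurable_EFin (mf ord0)).
by rewrite fc -EFinM big_ord_recl.
Qed.

Lemma integrable_prod_coord m (f : 'I_m -> R -> R) :
  (forall j x, 0 <= f j x) -> (forall j, leb.-integrable setT (EFin \o f j)) ->
  (lebesgueV R m).-integrable setT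
     (EFin \o (fun x : borelV R m => \prod_j f j (x ord0 j))) /\
  \int[lebesgueV R m]_x (\prod_j f j (x ord0 j)) = \prod_j \int[leb]_x f j x.
Proof.
move=> f0 fi.
have mf j : measurable_fun setT (f j) by exact: (integrable_measurable (fi j)).
have fE j : (\int[leb]_x (f j x)%:E = (\int[leb]_x f j x)%:E)%E.
  by rewrite fineK// integrable_fin_num//; exact: fi.
have iE := integral_prod_coord mf f0 fE.
split; last by rewrite /Rintegral iE.
apply/integrableP; split; first exact: (measurable_EFin (measurable_prod_coord mf)).
rewrite (eq_integral (fun x : borelV R m => (\prod_j f j (x ord0 j))%:E)).
  by rewrite iE ltry.
by move=> x _ /=; rewrite ger0_norm// prodr_ge0.
Qed.

Lemma Cint_prod_coord m (f : 'I_m -> R -> R[i]) (g : 'I_m -> R -> R) :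
  (forall j, cmeasurable (f j : measurableTypeR R -> R[i])) ->
  (forall j x, normc (f j x) <= g j x) ->
  (forall j, leb.-integrable setT (EFin \o g j)) ->
  Cint (lebesgueV R m) (fun x => \prod_j f j (x ord0 j)) = \prod_j Cint leb (f j).
Proof.
elim: m f g => [|m IH] f g mf fg ig.
  rewrite big_ord0; under eq_Cint do rewrite big_ord0.
  apply: ceqP => /=; rewrite /Rintegral integral_dirac ?diracT ?mul1e//;
  exact: measurable_cst.
have g0 j x : 0 <= g j x by rewrite (le_trans _ (fg j x)) ?cnorm_ge0.
have mF : cmeasurable (fun x : borelV R m.+1 => \prod_j f j (x ord0 j)).
  apply: cmeasurable_prod => j.
  exact: (cmeasurable_comp (measurable_coord j) (mf j)).
have [ip _] := integrable_prod_coord g0 ig.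
have [ip' _] := integrable_prod_coord (fun j => g0 (lift ord0 j)) (fun j => ig (lift ord0 j)).
have iF : cintegrable (lebesgueV R m.+1) (fun x => \prod_j f j (x ord0 j)).
  apply: (cintegrable_le mF _ ip) => x; rewrite normc_prod.
  by apply: ler_prod => j _; rewrite cnorm_ge0 fg.
have -> : Cint (lebesgueV R m.+1) (fun x => \prod_j f j (x ord0 j)) =
    Cint (leb \x lebesgueV R m)%E (fun z => \prod_j f j (consV z ord0 j)).
  by case: iF => i1 i2; apply: ceqP; rewrite /= lebesgueVS_Rintegral.
have [||_ -> _] := @cFubini R _ _ _ _ leb (lebesgueV R m)
    (fun z => \prod_j f j (consV z ord0 j)) (g ord0)
    (fun v => \prod_j g (lift ord0 j) (v ord0 j)) _ _ (ig ord0) ip'.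
- exact: (cmeasurable_comp (@measurable_consV R m) mF).
- move=> x v; rewrite big_ord_recl consV0 normcM ler_pM ?cnorm_ge0//.
  rewrite normc_prod; apply: ler_prod => j _.
  by rewrite cnorm_ge0 consV_lift fg.
rewrite big_ord_recl -(IH _ (fun j => g (lift ord0 j)))// -CintZr; last first.
  apply: (cintegrable_le (mf ord0) (fg ord0)) => //.
apply: eq_Cint => a; rewrite -CintZ; last first.
  apply: (cintegrable_le _ _ ip').
    apply: cmeasurable_prod => j.
    exact: (cmeasurable_comp (measurable_coord j) (mf _)).
  move=> x; rewrite normc_prod; apply: ler_prod => j _.
  by rewrite cnorm_ge0 fg.
apply: eq_Cint => v; rewrite big_ord_recl consV0; congr (_ * _).
by apply: eq_bigr => j _; rewrite consV_lift.
Qed.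

End lebesgueV_tonelli.
Section affine_change_of_variables.
Variable R : realType.
Local Open Scope complex_scope.
Local Notation leb := (@lebesgue_measure R).

Lemma ge0_integral_affine1 (al b : R) (f : measurableTypeR R -> \bar R) : al != 0 ->
  measurable_fun setT f -> (forall x, 0 <= f x)%E ->
  (\int[leb]_x f x = `|al|%:E * \int[leb]_x f (affine1 al b x))%E.
Proof.
move=> al0 mf f0.
transitivity (\int[mscale (NngNum (normr_ge0 al))
    (push_measure leb (@measurable_affine1 R al b))]_x f x)%E.
  by apply: eq_measure_integral => A mA _; exact: (lebesgue_affine b al0 mA).
rewrite ge0_integral_mscale//; congr (_ * _)%E.
by rewrite (@ge0_integral_pushforward _ _ _ _ _ _ (@measurable_affine1 R al b) leb setT f).
Qed.

(** By Tonelli, the change of variables is made in one coordinate at a time. *)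
Lemma ge0_integral_affineV m (al : R) (b : 'rV[R]_m) (f : borelV R m -> \bar R) :
  al != 0 -> measurable_fun setT f -> (forall x, 0 <= f x)%E ->
  (\int[lebesgueV R m]_x f x =
    (`|al| ^+ m)%:E * \int[lebesgueV R m]_x f ((al *: x + b)%R : 'rV[R]_m))%E.
Proof.
move=> al0; elim: m b f => [|m IH] b f mf f0.
  rewrite !integral_dirac//; last first.
    exact: (measurableT_comp mf (measurable_affineV al b)).
  by rewrite !diracT expr0 !mul1e; congr f; rewrite [RHS]thinmx0.
pose b0 : R := b ord0 ord0; pose b' : 'rV[R]_m := \row_i b ord0 (lift ord0 i).
have consb a v : al *: (consV (a, v) : 'rV[R]_m.+1) + b =
    consV (affine1 al b0 a, al *: v + b').
  apply/rowP => j; rewrite mxE [X in X + _]mxE.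
  case: (unliftP ord0 j) => [i ->|->]; last by rewrite !consV0.
  by rewrite !consV_lift /= !mxE.
have mfc : measurable_fun setT (fun z : measurableTypeR R * borelV R m => f (consV z)).
  exact: (measurableT_comp mf (@measurable_consV R m)).
have mfb : measurable_fun setT
    (fun z : measurableTypeR R * borelV R m => f (consV (z.1, (al *: z.2 + b' : 'rV[R]_m)))).
  apply: (measurableT_comp mfc).
  apply/measurable_fun_pair => //=.
  exact: (measurableT_comp (measurable_affineV al b') measurable_snd).
rewrite !lebesgueVS_tonelli//; last first.
  exact: (measurableT_comp mf (measurable_affineV al b)).
under eq_integral => a _.
  rewrite (IH b' (fun v => f (consV (a, v))))//; last first.
    exact: (measurableT_comp mfc (measurable_pair1 a)).
  over.
have mg := @measurable_fun_fubini_tonelli_F _ _ _ _ _ (lebesgueV R m) _ mfb (fun _ => f0 _).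
have IG a : (0 <= \int[lebesgueV R m]_v f (consV (a, (al *: v + b')%R)))%E.
  exact: integral_ge0.
transitivity ((`|al| ^+ m)%:E * \int[leb]_a
    \int[lebesgueV R m]_v f (consV (a, (al *: v + b')%R)))%E.
  by rewrite -ge0_integralZl// lee_fin exprn_ge0.
rewrite (@ge0_integral_affine1 al b0 _ al0 mg); last by move=> a; exact: integral_ge0.
rewrite muleA -EFinM -exprSr; congr (_ * _)%E.
apply: eq_integral => a _; apply: eq_integral => v _ /=.
by rewrite consb.
Qed.

Lemma Rintegral_affineV m (al : R) (b : 'rV[R]_m) (f : borelV R m -> R) : al != 0 ->
  (lebesgueV R m).-integrable setT (EFin \o f) ->
  (lebesgueV R m).-integrable setT (EFin \o (fun x => f ((al *: x + b)%R : 'rV[R]_m))) /\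
  \int[lebesgueV R m]_x f x =
    `|al| ^+ m * \int[lebesgueV R m]_x f ((al *: x + b)%R : 'rV[R]_m).
Proof.
move=> al0 fi.
have c0 : 0 < `|al| ^+ m by rewrite exprn_gt0// normr_gt0.
have ia (g : borelV R m -> R) : (lebesgueV R m).-integrable setT (EFin \o g) ->
    (lebesgueV R m).-integrable setT (EFin \o (fun x => g ((al *: x + b)%R : 'rV[R]_m))).
  move=> ig; have mg := integrable_measurable ig; apply/integrableP; split.
    exact: (measurable_EFin (measurableT_comp mg (measurable_affineV al b))).
  case/integrableP : ig => mg' ig.
  move: ig; rewrite (@ge0_integral_affineV _ al b _ al0)//; last exact: measurableT_comp.
  move=> h; rewrite ltey; apply/eqP => hoo; move: h.
  by rewrite hoo gt0_muley ?lte_fin ?ltxx.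
have ge0E (g : borelV R m -> R) : (lebesgueV R m).-integrable setT (EFin \o g) ->
    (forall x, 0 <= g x) -> \int[lebesgueV R m]_x g x =
    `|al| ^+ m * \int[lebesgueV R m]_x g ((al *: x + b)%R : 'rV[R]_m).
  move=> ig g0; rewrite /Rintegral.
  rewrite (@ge0_integral_affineV _ al b (fun x => (g x)%:E) al0); last 2 first.
  - exact: (measurable_EFin (integrable_measurable ig)).
  - by move=> x; rewrite lee_fin.
  by rewrite fineM//; apply: integrable_fin_num => //; exact: ia.
split; first exact: ia.
pose fp x := Num.max (f x) 0; pose fn x := Num.max (- f x) 0.
have mf := integrable_measurable fi.
have fpn x : f x = fp x - fn x.
  rewrite /fp /fn; have [h|h] := leP (f x) 0.
    by rewrite max_l ?oppr_ge0// sub0r opprK.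
  by rewrite max_r ?subr0// oppr_le0 ltW.
have fnrm : (lebesgueV R m).-integrable setT (EFin \o (fun x => `|f x|)).
  by have := integrable_abse fi.
have ifp : (lebesgueV R m).-integrable setT (EFin \o fp).
  apply: (integrable_le _ _ fnrm); first exact: measurable_maxr.
  by move=> x; rewrite /fp ger0_norm ?le_max ?lexx ?orbT// ge_max normr_ge0 ler_norm.
have ifn : (lebesgueV R m).-integrable setT (EFin \o fn).
  apply: (integrable_le _ _ fnrm).
    by apply: measurable_maxr => //; exact: measurable_funN.
  by move=> x; rewrite /fn ger0_norm ?le_max ?lexx ?orbT// ge_max normr_ge0 -normrN ler_norm.
under eq_Rintegral do rewrite fpn.
under [in RHS]eq_Rintegral do rewrite fpn.
rewrite !RintegralB//; [|exact: ia|exact: ia].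
rewrite mulrBr; congr (_ - _); apply: ge0E => // x;
by rewrite le_max lexx orbT.
Qed.

Lemma Cint_affineV m (al : R) (b : 'rV[R]_m) (f : borelV R m -> R[i]) : al != 0 ->
  cintegrable (lebesgueV R m) f ->
  cintegrable (lebesgueV R m) (fun x => f (al *: x + b : 'rV[R]_m)) /\
  Cint (lebesgueV R m) f =
    (`|al| ^+ m)%:C * Cint (lebesgueV R m) (fun x => f (al *: x + b : 'rV[R]_m)).
Proof.
move=> al0 [fr fi].
have [r1 r2] := Rintegral_affineV b al0 fr; have [i1 i2] := Rintegral_affineV b al0 fi.
by split; [split|apply: ceqP; rewrite ?reZ ?imZ].
Qed.

Lemma Cint_shift m (b : 'rV[R]_m) (f : borelV R m -> R[i]) :
  cintegrable (lebesgueV R m) f ->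
  cintegrable (lebesgueV R m) (fun x => f (x + b : 'rV[R]_m)) /\
  Cint (lebesgueV R m) (fun x => f (x + b : 'rV[R]_m)) = Cint (lebesgueV R m) f.
Proof.
move=> fi; have [] := Cint_affineV b (oner_neq0 _) fi.
rewrite normr1 expr1n mul1r => h1 ->.
split; last by apply: eq_Cint => x; rewrite scale1r.
by move: h1; under eq_fun do rewrite scale1r.
Qed.

Lemma Cint_reflect m (b : 'rV[R]_m) (f : borelV R m -> R[i]) :
  cintegrable (lebesgueV R m) f ->
  cintegrable (lebesgueV R m) (fun x => f (b - x : 'rV[R]_m)) /\
  Cint (lebesgueV R m) (fun x => f (b - x : 'rV[R]_m)) = Cint (lebesgueV R m) f.
Proof.
move=> fi; have N10 : -1 != 0 :> R by rewrite oppr_eq0 oner_neq0.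
have [] := Cint_affineV b N10 fi.
rewrite normrN normr1 expr1n mul1r => h1 ->.
have E x : b - x = -1 *: x + b by rewrite scaleN1r addrC.
split; last by apply: eq_Cint => x; rewrite E.
by under eq_fun do rewrite E.
Qed.

Lemma ge0_integral_reflect m (b : 'rV[R]_m) (f : borelV R m -> \bar R) :
  measurable_fun setT f -> (forall x, 0 <= f x)%E ->
  (\int[lebesgueV R m]_x f ((b - x)%R : 'rV[R]_m) = \int[lebesgueV R m]_x f x)%E.
Proof.
move=> mf f0; have N10 : -1 != 0 :> R by rewrite oppr_eq0 oner_neq0.
rewrite [RHS](@ge0_integral_affineV _ (-1) b _ N10)// normrN normr1 expr1n mul1e.
by apply: eq_integral => x _; rewrite scaleN1r addrC.
Qed.

End affine_change_of_variables.

Section open_sets.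
Variable R : realType.
Local Notation leb := (@lebesgue_measure R).

Definition openbox m (c : 'rV[R]_m) (r : R) : set (borelV R m) :=
  [set x : 'rV[R]_m | forall j, `|c ord0 j - x ord0 j| < r].

Lemma openbox_gt0 m (c : 'rV[R]_m) (r : R) : 0 < r ->
  (0 < lebesgueV R m (openbox c r))%E /\ measurable (openbox c r).
Proof.
move=> r0.
pose I j : set R := ball (c ord0 j) r.
have -> : openbox c r =
    (fun x : borelV R m => \prod_j (\1_(I j) (x ord0 j) : R)) @^-1` [set 1].
  apply/seteqP; split => x /= h.
    by rewrite big1// => j _; rewrite indicE mem_set//; exact: h.
  move=> j; apply: contrapT => nh; move: h; rewrite (bigD1 j)//= indicE memNset//.
  by rewrite mul0r => /esym/eqP; rewrite oner_eq0.
have mI j : measurable (I j : set (measurableTypeR R)) by exact: measurable_ball.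
have mp : measurable_fun setT (fun x : borelV R m => \prod_j (\1_(I j) (x ord0 j) : R)).
  by apply: (@measurable_prod_coord R m (fun j => \1_(I j))) => j; exact: (measurable_indic (mI j)).
have mS : measurable ((fun x : borelV R m => \prod_j (\1_(I j) (x ord0 j) : R)) @^-1` [set 1]).
  by rewrite -[X in measurable X]setTI; exact: mp.
split; last exact: mS.
set S := _ @^-1` _ in mS *.
have -> : lebesgueV R m S = (\int[lebesgueV R m]_x (\prod_j (\1_(I j) (x ord0 j) : R))%:E)%E.
  rewrite -[S in LHS]setIT -integral_indic//; apply: eq_integral => x _; congr EFin.
  rewrite indicE; case: (boolP (x \in S)) => [/set_mem h|/negP nh]; first by rewrite [RHS]h.
  apply/esym/eqP; apply: contra_notT nh => h; apply/mem_set; rewrite /S /=.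
  rewrite big1// => j _; move: h => /prodf_neq0 /(_ j isT).
  by rewrite indicE; case: (_ \in _); rewrite ?eqxx.
rewrite (@integral_prod_coord _ _ (fun j => \1_(I j)) (fun=> r *+ 2))//.
- by rewrite lte_fin prodr_gt0// => j _; rewrite pmulrn_lgt0.
- by move=> j; exact: (measurable_indic (mI j)).
- move=> j; rewrite integral_indic ?setIT//.
  exact: (lebesgue_measure_ball (c ord0 j) (ltW r0)).
Qed.

(** A nonempty open set contains a box, whose measure is positive. *)
Lemma ae_open m (P : set (borelV R m)) (U : set 'rV[R]_m) : open U -> U !=set0 ->
  {ae lebesgueV R m, forall x, P x} -> exists x, U x /\ P x.
Proof.
move=> oU [c Uc] [N [mN N0 PN]].
have /nbhs_ballP[r /= r0 rU] : nbhs c U by exact: open_nbhs_nbhs.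
have [b0 mb] := openbox_gt0 c r0.
apply: contrapT => h.
have bN : openbox c r `<=` N.
  move=> x /= xb; apply: PN => Px; apply: h; exists x; split => //.
  by apply: rU; split => // i j; rewrite !ord1; exact: xb.
have : (lebesgueV R m (openbox c r) <= 0)%E.
  by rewrite -N0; apply: le_measure => //; exact/mem_set.
by rewrite leNgt b0.
Qed.

(** The open set where [B < f] would have positive measure. *)
Lemma ae_le_continuous m (f : 'rV[R]_m -> R) (B : R) :
  continuous (f : 'rV[R]_m -> R^o) ->
  {ae lebesgueV R m, forall x, f x <= B} -> forall x, f x <= B.
Proof.
move=> cf fB x; rewrite leNgt; apply/negP => Bx.
pose U : set 'rV[R]_m := f @^-1` [set y | B < y].
have oU : open U by apply: open_comp; [move=> y _; exact: cf|exact: open_gt].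
have [y [/= Uy]] := ae_open oU (ex_intro _ x Bx) fB.
by rewrite leNgt => /negP; apply; exact: Uy.
Qed.

End open_sets.
(** * The Poisson kernel *)

Section exponential_line.
Variable R : realType.
Local Open Scope complex_scope.
Local Notation leb := (@lebesgue_measure R).
Variables (t y : R) (t0 : 0 < t).

Let den_gt0 : 0 < t ^+ 2 + y ^+ 2.
Proof. by rewrite ltr_pwDl ?exprn_gt0// sqr_ge0. Qed.

Let F v := expR (- t * v) * (- t^-1 + (y * sin (y * v) - t * cos (y * v)) / (t ^+ 2 + y ^+ 2)).
Let f v := expR (- t * v) * (1 + cos (y * v)).

Let dF v : is_derive (v : R) 1 F (f v).
Proof.
have d1 : is_derive v 1 (fun v : R => - t * v) (- t).
  by apply: is_derive_eq; rewrite /GRing.scale /=; ring.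
have d2 : is_derive v 1 (fun v : R => y * v) y.
  by apply: is_derive_eq; rewrite /GRing.scale /=; ring.
have d3 := is_derive1_comp (is_derive_expR _) d1.
have d4 := is_derive1_comp (is_derive_sin _) d2.
have d5 := is_derive1_comp (is_derive_cos _) d2.
rewrite /F; apply: is_derive_eq.
rewrite /f /GRing.scale /=; field; rewrite ?gt_eqF ?den_gt0 ?t0//.
Qed.

Let cvg_expNy : expR (- t * v) @[v --> +oo] --> (0 : R).
Proof.
have : (fun v : R => expR (- t * v)) = (fun v => (expR (t * v))^-1).
  by apply/funext => v; rewrite mulNr expRN.
move=> ->.
apply: (@squeeze_cvgr _ _ _ _ (fun=> 0) (fun v => t^-1 * v^-1)).
- near=> v; rewrite invr_ge0 expR_ge0/= -invfM lef_pV2 ?posrE ?expR_gt0//.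
    by rewrite (le_trans _ (expR_ge1Dx _))// ler_wpDl.
  by rewrite mulr_gt0.
- exact: cvg_cst.
- rewrite -[X in _ --> X](mulr0 t^-1); apply: cvgM; first exact: cvg_cst.
  apply/cvgrPdist_le => e e0; near=> v; rewrite sub0r normrN ger0_norm.
    rewrite -[leRHS]invrK lef_pV2 ?posrE ?invr_gt0//.
  by rewrite invr_ge0.
Unshelve. all: by end_near. Qed.

Let FV : F v @[v --> +oo] --> (0 : R).
Proof.
apply/norm_cvg0P.
pose K := t^-1 + (`|y| + t) / (t ^+ 2 + y ^+ 2).
apply: (@squeeze_cvgr _ _ _ _ (fun=> 0) (fun v => expR (- t * v) * K)).
- apply: nearW => v; rewrite normr_ge0/= /F normrM ger0_norm ?expR_ge0//.
  rewrite ler_wpM2l ?expR_ge0// (le_trans (ler_normD _ _))// lerD//.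
    by rewrite normrN ger0_norm// invr_ge0 ltW.
  have iden : 0 <= (t ^+ 2 + y ^+ 2)^-1 by rewrite invr_ge0 ltW.
  rewrite normrM (ger0_norm iden) ler_wpM2r//.
  rewrite (le_trans (ler_normB _ _))// lerD// normrM.
    by rewrite ler_piMr// ler_norml sin_geN1 sin_le1.
  by rewrite gtr0_norm// ler_piMr ?(ltW t0)// ler_norml cos_geN1 cos_le1.
- exact: cvg_cst.
- by rewrite -[X in _ --> X](mul0r K); apply: cvgM => //; exact: cvg_cst.
Qed.

(** The integrand has the explicit primitive [F]. Adding 1 to the cosine keeps it
    nonnegative, so that its integral is the increment of [F] at infinity. *)
Lemma integral_expR_cos :
  (\int[leb]_v (expR (- t * `|v|) * (1 + cos (y * v)))%:E =
   (2 / t + 2 * t / (t ^+ 2 + y ^+ 2))%:E)%E.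
Proof.
have cf : continuous f.
  move=> v; apply: cvgM.
    apply: (cvg_comp (fun v => - t * v) expR); last exact: continuous_expR.
    by apply: cvgM; [exact: cvg_cst|exact: cvg_id].
  apply: cvgD; first exact: cvg_cst.
  apply: (cvg_comp (fun v => y * v) cos); last exact: continuous_cos.
  by apply: cvgM; [exact: cvg_cst|exact: cvg_id].
have f0 v w : 0 <= expR v * (1 + cos w).
  by rewrite mulr_ge0 ?expR_ge0// -lerBlDl sub0r cos_geN1.
rewrite ge0_symfun_integralT//=; last 2 first.
- move=> v; apply: cvgM.
    apply: (cvg_comp (fun v : R => - t * `|v|) expR); last exact: continuous_expR.
    by apply: cvgM; [exact: cvg_cst|exact: norm_continuous].
  apply: cvgD; first exact: cvg_cst.
  apply: (cvg_comp (fun v => y * v) cos); last exact: continuous_cos.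
  by apply: cvgM; [exact: cvg_cst|exact: cvg_id].
- by move=> v /=; rewrite normrN mulrN cosN.
rewrite -set_itvcy.
have -> : (\int[leb]_(v in `[0%R, +oo[) (expR (- t * `|v|) * (1 + cos (y * v)))%:E =
    \int[leb]_(v in `[0%R, +oo[) (f v)%:E)%E.
  apply: eq_integral => v; rewrite inE/= in_itv/= andbT => v0.
  by rewrite /f ger0_norm.
rewrite (@ge0_continuous_FTC2y _ f F 0 0)//.
- rewrite /F !mulr0 expR0 sin0 cos0 mulr0 mulr1 mul1r sub0r -EFinB -EFinM.
  by congr EFin; field; rewrite ?gt_eqF.
- by move=> v _; exact: f0.
- by apply: continuous_subspaceT.
- apply: cvg_at_right_filter; apply/differentiable_continuous/derivable1_diffP.
  by case: (dF 0).
- by move=> v _; rewrite derive1E; exact: derive_val.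
Qed.

End exponential_line.
Section poisson.
Variable R : realType.
Local Open Scope complex_scope.
Local Notation leb := (@lebesgue_measure R).

Lemma measurable_exp_abs (t : R) : measurable_fun setT (fun v : R => expR (- t * `|v|)).
Proof.
have m1 : measurable_fun setT (fun v : R => - t * `|v|).
  by apply: measurable_funM => //; exact: measurable_normr.
exact: (measurableT_comp (@measurable_expR R) m1).
Qed.

Lemma integral_exp_abs (t : R) : 0 < t ->
  (\int[leb]_v (expR (- t * `|v|))%:E = (2 / t)%:E)%E.
Proof.
move=> t0; have := integral_expR_cos 0 t0.
have -> : (\int[leb]_v (expR (- t * `|v|) * (1 + cos (0 * v)))%:E =
    2%:E * \int[leb]_v (expR (- t * `|v|))%:E)%E.
  rewrite -ge0_integralZl ?lee_fin//; last exact: (measurable_EFin (measurable_exp_abs t)).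
  by apply: eq_integral => v _; rewrite mul0r cos0 -EFinM mulrC.
have -> : 2 / t + 2 * t / (t ^+ 2 + 0 ^+ 2) = 2 * (2 / t).
  by rewrite expr0n addr0; field; rewrite gt_eqF.
rewrite EFinM => /(congr1 (fun x => (2^-1)%:E * x)%E).
by rewrite !muleA -!EFinM mulVf// mul1r mul1e.
Qed.

Lemma integrable_exp_abs (t : R) : 0 < t ->
  leb.-integrable setT (EFin \o (fun v => expR (- t * `|v|))) /\
  \int[leb]_v expR (- t * `|v|) = 2 / t.
Proof.
move=> t0; split; last by rewrite /Rintegral integral_exp_abs.
apply/integrableP; split; first exact: (measurable_EFin (measurable_exp_abs t)).
rewrite [X in (X < _)%E](_ : _ = (\int[leb]_v (expR (- t * `|v|))%:E)%E).
  by rewrite integral_exp_abs// ltry.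
by apply: eq_integral => v _ /=; rewrite ger0_norm ?expR_ge0.
Qed.

Lemma measurable_Mr (y : R) : measurable_fun setT (fun v : R => y * v).
Proof. exact: measurable_funM. Qed.

(** The real part follows from [integral_expR_cos], and the imaginary part is the
    integral of an odd function. *)
Lemma Cint_expi_exp_abs (t y : R) : 0 < t ->
  Cint leb (fun v => expi (y * v) * (expR (- t * `|v|))%:C) =
  (2 * t / (t ^+ 2 + y ^+ 2))%:C.
Proof.
move=> t0; have [ie iE] := integrable_exp_abs t0.
have mc : measurable_fun setT (fun v : R => cos (y * v)).
  apply: (measurableT_comp _ (measurable_Mr y)).
  by apply: continuous_measurable_fun; exact: continuous_cos.
have ms : measurable_fun setT (fun v : R => sin (y * v)).
  apply: (measurableT_comp _ (measurable_Mr y)).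
  by apply: continuous_measurable_fun; exact: continuous_sin.
have ic : leb.-integrable setT (EFin \o (fun v => expR (- t * `|v|) * cos (y * v))).
  apply: (integrable_le _ _ ie).
    by apply: measurable_funM => //; exact: measurable_exp_abs.
  move=> v; rewrite normrM ger0_norm ?expR_ge0// ler_piMr ?expR_ge0//.
  by rewrite ler_norml cos_geN1 cos_le1.
have iS : leb.-integrable setT (EFin \o (fun v => expR (- t * `|v|) * sin (y * v))).
  apply: (integrable_le _ _ ie).
    by apply: measurable_funM => //; exact: measurable_exp_abs.
  move=> v; rewrite normrM ger0_norm ?expR_ge0// ler_piMr ?expR_ge0//.
  by rewrite ler_norml sin_geN1 sin_le1.
apply: ceqP => /=.
  have := integral_expR_cos y t0 => /(congr1 fine).
  rewrite [fine (\int[leb]_v _)%E](_ : _ =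
      \int[leb]_v (expR (- t * `|v|) + expR (- t * `|v|) * cos (y * v))); last first.
    by apply: eq_Rintegral => v _; rewrite mulrDr mulr1.
  rewrite RintegralD// iE => /addrI <-.
  by apply: eq_Rintegral => v _; rewrite mulr0 subr0 mulrC.
rewrite (_ : \int[leb]_v _ = \int[leb]_v (expR (- t * `|v|) * sin (y * v))); last first.
  by apply: eq_Rintegral => v _; rewrite mulr0 add0r mulrC.
have N10 : -1 != 0 :> R by rewrite oppr_eq0 oner_neq0.
have s0 v : 0 <= expR (- t * `|v|) + expR (- t * `|v|) * sin (y * v).
  by rewrite -[X in X + _]mulr1 -mulrDr mulr_ge0 ?expR_ge0// -lerBlDl sub0r sin_geN1.
have mS : measurable_fun setT
    (fun v : R => (expR (- t * `|v|) + expR (- t * `|v|) * sin (y * v))%:E).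
  apply: measurable_EFin; apply: measurable_funD; first exact: measurable_exp_abs.
  by apply: measurable_funM => //; exact: measurable_exp_abs.
have := congr1 fine (@ge0_integral_affine1 R (-1) 0 _ N10 mS s0).
rewrite normrN normr1 mul1e.
have -> : fine (\int[leb]_x (expR (- t * `|affine1 (-1) 0 x|) +
      expR (- t * `|affine1 (-1) 0 x|) * sin (y * affine1 (-1) 0 x))%:E) =
    \int[leb]_v (expR (- t * `|v|) - expR (- t * `|v|) * sin (y * v)).
  apply: eq_Rintegral => v _; rewrite /affine1 mulN1r addr0 normrN mulrN sinN.
  by rewrite mulrN.
rewrite [fine _](_ : _ = \int[leb]_v (expR (- t * `|v|) + expR (- t * `|v|) * sin (y * v)))//.
rewrite RintegralD// RintegralB// => /addrI /eqP.
by rewrite -subr_eq0 opprK -mulr2n mulrn_eq0 => /eqP.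
Qed.

Lemma integral_oneDsqr : (\int[leb]_v ((1 + v ^+ 2)^-1)%:E = (pi : R)%:E)%E.
Proof.
rewrite ge0_symfun_integralT//=; last 2 first.
- exact: continuous_oneDsqrV.
- by move=> v /=; rewrite sqrrN.
rewrite -set_itvcy (_ : (\int[leb]_(x in _) _ = (pi / 2)%:E)%E).
  by rewrite -EFinM mulrC mulfVK.
  exact: integral0y_oneDsqr.
by move=> v; rewrite invr_ge0 addr_ge0 ?sqr_ge0.
Qed.

Lemma measurable_oneDsqr : measurable_fun setT (fun v : R => (1 + v ^+ 2)^-1).
Proof. by apply: continuous_measurable_fun; exact: continuous_oneDsqrV. Qed.

Lemma oneDsqrV_ge0 (v : R) : 0 <= (1 + v ^+ 2)^-1.
Proof. by rewrite invr_ge0 addr_ge0 ?sqr_ge0. Qed.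

Lemma integrable_oneDsqr :
  leb.-integrable setT (EFin \o (fun v => (1 + v ^+ 2)^-1)) /\
  \int[leb]_v (1 + v ^+ 2)^-1 = pi :> R.
Proof.
split; last by rewrite /Rintegral integral_oneDsqr.
apply/integrableP; split; first exact: (measurable_EFin measurable_oneDsqr).
rewrite [X in (X < _)%E](_ : _ = (\int[leb]_v ((1 + v ^+ 2)^-1)%:E)%E).
  by rewrite integral_oneDsqr ltry.
by apply: eq_integral => v _ /=; rewrite ger0_norm ?oneDsqrV_ge0.
Qed.

(** The product weight; its integrability is what makes decay in each
    coordinate separately enough. *)
Definition cauchyw m (y : 'rV[R]_m) : R := \prod_j (1 + y ord0 j ^+ 2)^-1.

Lemma integrable_cauchyw m :
  (lebesgueV R m).-integrable setT (EFin \o @cauchyw m) /\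
  \int[lebesgueV R m]_y cauchyw y = pi ^+ m.
Proof.
have [i1 e1] := integrable_oneDsqr.
have [] := @integrable_prod_coord R m (fun _ v => (1 + v ^+ 2)^-1)
  (fun _ => oneDsqrV_ge0) (fun _ => i1).
by move=> h1 h2; split => //; rewrite /cauchyw h2 prodr_const card_ord e1.
Qed.

Lemma cauchyw_ge0 m (y : 'rV[R]_m) : 0 <= cauchyw y.
Proof. by rewrite prodr_ge0// => j _; exact: oneDsqrV_ge0. Qed.

Definition l1 m (u : 'rV[R]_m) : R := \sum_j `|u ord0 j|.

Lemma expR_l1 m (t : R) (u : 'rV[R]_m) :
  expR (- t * l1 u) = \prod_j expR (- t * `|u ord0 j|).
Proof. by rewrite /l1 mulr_sumr expR_sum. Qed.

Lemma integrable_exp_l1 m (t : R) : 0 < t ->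
  (lebesgueV R m).-integrable setT (EFin \o (fun u => expR (- t * l1 u))).
Proof.
move=> t0; have [i1 e1] := integrable_exp_abs t0.
have [h _] := @integrable_prod_coord R m (fun _ v => expR (- t * `|v|))
  (fun _ v => expR_ge0 _) (fun _ => i1).
by under [X in _ \o X]eq_fun do rewrite expR_l1.
Qed.

Lemma measurable_exp_l1 m (t : R) :
  measurable_fun setT (fun u : borelV R m => expR (- t * l1 u)).
Proof.
under eq_fun do rewrite expR_l1.
apply: (@measurable_prod_coord R m (fun _ v => expR (- t * `|v|))) => j.
exact: measurable_exp_abs.
Qed.

(** The Fourier transform of [exp (- t l1)]; the choice of the l1 norm makes it a
    product of Poisson kernels of the line. *)
Definition poisson m (t : R) (y : 'rV[R]_m) : R :=
  \prod_j (2 * t / (t ^+ 2 + y ord0 j ^+ 2)).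

Lemma Cint_poisson m (t : R) (y : 'rV[R]_m) : 0 < t ->
  Cint (lebesgueV R m) (fun u => expi (dot u y) * (expR (- t * l1 u))%:C) =
  (poisson t y)%:C.
Proof.
move=> t0; have [i1 e1] := integrable_exp_abs t0.
transitivity (Cint (lebesgueV R m) (fun u : borelV R m =>
    \prod_j (expi (y ord0 j * u ord0 j) * (expR (- t * `|u ord0 j|))%:C))).
  apply: eq_Cint => u; rewrite big_split/= -expi_sum -rc_prod -expR_l1; congr (expi _ * _).
  by apply: eq_bigr => j _; rewrite mulrC.
rewrite (@Cint_prod_coord R m (fun j v => expi (y ord0 j * v) * (expR (- t * `|v|))%:C)
  (fun _ v => expR (- t * `|v|)))//.
- by rewrite /poisson rc_prod; apply: eq_bigr => j _; rewrite Cint_expi_exp_abs.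
- move=> j; apply: cmeasurableM; first exact: (cmeasurable_expi (measurable_Mr _)).
  exact: (cmeasurable_rc (measurable_exp_abs t)).
- by move=> j v; rewrite normcM normc_expi mul1r normc_rc ger0_norm ?expR_ge0.
Qed.

Lemma poisson_scale m (t : R) (z : 'rV[R]_m) : 0 < t ->
  t ^+ m * poisson t (t *: z) = 2 ^+ m * cauchyw z.
Proof.
move=> t0; have cpow (c : R) : c ^+ m = \prod_(j < m) c by rewrite prodr_const card_ord.
rewrite (cpow t) (cpow 2) /poisson /cauchyw -!big_split; apply: eq_bigr => j _ /=; rewrite mxE.
have zj : 1 + z ord0 j ^+ 2 != 0 by rewrite gt_eqF// ltr_pwDl// sqr_ge0.
have tz : t ^+ 2 + (t * z ord0 j) ^+ 2 != 0.
  by rewrite gt_eqF// ltr_pwDl ?exprn_gt0// sqr_ge0.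
field; rewrite zj tz ?andbT// gt_eqF//.
Qed.

Lemma poisson_ge0 m (t : R) (y : 'rV[R]_m) : 0 < t -> 0 <= poisson t y.
Proof.
move=> t0; apply: prodr_ge0 => j _.
by apply: divr_ge0; [rewrite mulr_ge0// ltW|rewrite addr_ge0// sqr_ge0].
Qed.

Lemma measurable_poisson m (t : R) : 0 < t ->
  measurable_fun setT (fun y : borelV R m => poisson t y).
Proof.
move=> t0.
apply: (@measurable_prod_coord R m (fun _ v => 2 * t / (t ^+ 2 + v ^+ 2))) => j.
apply: continuous_measurable_fun => v; apply: cvgM; first exact: cvg_cst.
apply: cvgV; first by rewrite gt_eqF// ltr_pwDl ?exprn_gt0// sqr_ge0.
by apply: cvgD; [exact: cvg_cst|exact: exprn_continuous].
Qed.

Lemma poisson_le m (t : R) (y : 'rV[R]_m) : 0 < t -> poisson t y <= (2 / t) ^+ m.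
Proof.
move=> t0; have -> : (2 / t) ^+ m = \prod_(j < m) (2 / t) by rewrite prodr_const card_ord.
apply: ler_prod => j _; apply/andP; split.
  by apply: divr_ge0; [rewrite mulr_ge0// ltW|rewrite addr_ge0// sqr_ge0].
rewrite ler_pdivrMr ?ltr_pwDl ?exprn_gt0 ?sqr_ge0//.
rewrite mulrDr [X in _ <= X + _](_ : _ = 2 * t).
  by rewrite lerDl mulr_ge0 ?divr_ge0 ?sqr_ge0// ltW.
by field; rewrite gt_eqF.
Qed.

End poisson.
(** * Fourier inversion and uniqueness *)

Opaque Cint expi cexp.

Section fourier_inversion.
Variable R : realType.
Local Open Scope complex_scope.

Lemma dotC m (x y : 'rV[R]_m) : dot x y = dot y x.
Proof. by apply: eq_bigr => i _; rewrite mulrC. Qed.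

Lemma dotDl m (x y z : 'rV[R]_m) : dot (x + y) z = dot x z + dot y z.
Proof. by rewrite /dot -big_split; apply: eq_bigr => i _; rewrite mxE mulrDl. Qed.

Lemma dotNl m (x z : 'rV[R]_m) : dot (- x) z = - dot x z.
Proof. by rewrite /dot -sumrN; apply: eq_bigr => i _; rewrite mxE mulNr. Qed.

Lemma dotZl m (c : R) (x z : 'rV[R]_m) : dot (c *: x) z = c * dot x z.
Proof. by rewrite /dot mulr_sumr; apply: eq_bigr => i _; rewrite mxE mulrA. Qed.

Lemma dotDr m (x y z : 'rV[R]_m) : dot z (x + y) = dot z x + dot z y.
Proof. by rewrite !(dotC z) dotDl. Qed.

Lemma dotNr m (x z : 'rV[R]_m) : dot z (- x) = - dot z x.
Proof. by rewrite !(dotC z) dotNl. Qed.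

Lemma dotZr m (c : R) (x z : 'rV[R]_m) : dot z (c *: x) = c * dot z x.
Proof. by rewrite !(dotC z) dotZl. Qed.

Lemma dot0r m (z : 'rV[R]_m) : dot z 0 = 0.
Proof. by rewrite -(scale0r z) dotZr mul0r. Qed.

Lemma dot_delta m (u : 'rV[R]_m) (j : 'I_m) : dot u (delta_mx ord0 j) = u ord0 j.
Proof.
rewrite /dot (bigD1 j)//= mxE !eqxx mulr1 big1 ?addr0// => i ij.
by rewrite mxE (negbTE ij) andbF mulr0.
Qed.

Lemma cmeasurable_char m (y : 'rV[R]_m) :
  cmeasurable (fun u : borelV R m => expi (dot u y)).
Proof.
apply: cmeasurable_expi.
exact: (@measurable_dot _ _ _ _ id (cst y) (@measurable_id _ _ _) (@measurable_cst _ _ _ _ _ _)).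
Qed.

Lemma cmeasurable_char2 m :
  cmeasurable (fun z : borelV R m * borelV R m => expi (dot z.1 z.2)).
Proof.
apply: cmeasurable_expi; exact: (measurable_dot measurable_fst measurable_snd).
Qed.

(** The inverse Fourier transform, without the factor [(2 pi)^(-m)]. *)
Definition ift m (a : 'rV[R]_m -> R[i]) (x : 'rV[R]_m) : R[i] :=
  Cint (lebesgueV R m) (fun u : borelV R m => a u * expi (dot u x)).

Lemma cintegrable_char m (a : 'rV[R]_m -> R[i]) (x : 'rV[R]_m) :
  cintegrable (lebesgueV R m) a ->
  cintegrable (lebesgueV R m) (fun u => a u * expi (dot u x)).
Proof.
move=> ia; apply: (cintegrableM_bounded (B := 1)) => //.
  exact: cmeasurable_char.
by move=> u; rewrite normc_expi.
Qed.

Lemma cmeasurable_ift m (a : 'rV[R]_m -> R[i]) :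
  cintegrable (lebesgueV R m) a -> cmeasurable (ift a : borelV R m -> R[i]).
Proof.
move=> ia; pose f (z : borelV R m * borelV R m) :=
  (expR (- 1 * l1 z.1))%:C * (a z.2 * expi (dot z.2 z.1)).
have ma := cintegrable_cmeasurable ia.
have mf : cmeasurable f.
  apply: cmeasurableM; first exact: (cmeasurable_comp measurable_fst
    (cmeasurable_rc (@measurable_exp_l1 R m 1))).
  apply: cmeasurableM; first exact: (cmeasurable_comp measurable_snd ma).
  by apply: cmeasurable_expi; exact: (measurable_dot measurable_snd measurable_fst).
have [|_ _ mF] := cFubini mf _ (integrable_exp_l1 m ltr01) (integrable_normc ia).
  move=> x u; rewrite !normcM normc_expi mulr1 normc_rc ger0_norm ?expR_ge0//.
rewrite (_ : ift a = (fun x => (expR (1 * l1 x))%:C *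
    Cint (lebesgueV R m) (fun u => f (x, u)))).
  apply: cmeasurableM => //; apply: cmeasurable_rc.
  by have := @measurable_exp_l1 R m (-1); rewrite opprK.
apply/funext => x.
have -> : Cint (lebesgueV R m) (fun u => f (x, u)) = (expR (- 1 * l1 x))%:C * ift a x.
  by rewrite /ift -CintZ//; exact: cintegrable_char.
by rewrite mulrA -rcM -expRD mulN1r mul1r subrr expR0 mul1r.
Qed.

Definition inv_nat n : R := n.+1%:R^-1.

Lemma inv_nat_gt0 n : 0 < inv_nat n. Proof. by rewrite invr_gt0. Qed.

Lemma inv_nat_le1 n : inv_nat n <= 1.
Proof. by rewrite invf_le1// ler1n. Qed.

Lemma cvg_inv_nat : inv_nat n @[n --> \oo] --> (0 : R).
Proof. exact: cvg_harmonic. Qed.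

(** Continuity at [u] along the sequences [u + z/(n+1)]; this is all that the
    approximation of the identity by dilations requires. *)
Definition rcont m (a : 'rV[R]_m -> R[i]) : Prop :=
  forall u z, ccvg (fun n => a (inv_nat n *: z + u)) (a u).

Lemma cvg_exp_inv_nat (c : R) : expR (- inv_nat n * c) @[n --> \oo] --> (1 : R).
Proof.
have h : - inv_nat n * c @[n --> \oo] --> (- 0 * c : R).
  by apply: cvgM; [apply: cvgN; exact: cvg_inv_nat|exact: cvg_cst].
have := @continuous_expR R (- 0 * c); rewrite oppr0 mul0r in h *.
by move=> /(cvg_comp _ _ h); rewrite expR0.
Qed.

(** After the change of variables [v = u + z / (n + 1)] the kernel does not depend
    on [n], and dominated convergence applies. *)
Lemma poisson_approximation m (a : 'rV[R]_m -> R[i]) (B : R) (u : 'rV[R]_m) :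
  cintegrable (lebesgueV R m) a -> (forall u, normc (a u) <= B) -> rcont a ->
  (forall n, normc (Cint (lebesgueV R m)
     (fun v => a v * (poisson (inv_nat n) (v - u))%:C)) <= (2 * pi) ^+ m * B) /\
  ccvg (fun n => Cint (lebesgueV R m) (fun v => a v * (poisson (inv_nat n) (v - u))%:C))
    (((2 * pi) ^+ m)%:C * a u).
Proof.
move=> ia aB ca.
have ma := cintegrable_cmeasurable ia.
have [ic ec] := integrable_cauchyw R m.
have -> : ((2 * pi) ^+ m)%:C * a u =
    (2 ^+ m)%:C * Cint (lebesgueV R m) (fun z => a u * (cauchyw z)%:C).
  rewrite CintZ ?Cint_rc ?ec; last exact: cintegrable_rc.
  by rewrite exprMn rcM -mulrA; congr (_ * _); exact: mulrC.
have E n : Cint (lebesgueV R m) (fun v => a v * (poisson (inv_nat n) (v - u))%:C) =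
    (2 ^+ m)%:C * Cint (lebesgueV R m) (fun z => a (inv_nat n *: z + u) * (cauchyw z)%:C).
  have t0 := inv_nat_gt0 n.
  have mp : measurable_fun setT (fun v : borelV R m => poisson (inv_nat n) (v - u)).
    apply: (measurableT_comp (measurable_poisson t0)).
    by have := measurable_affineV 1 (- u); under eq_fun do rewrite scale1r.
  have iap : cintegrable (lebesgueV R m) (fun v => a v * (poisson (inv_nat n) (v - u))%:C).
    apply: (cintegrableM_bounded (B := (2 / inv_nat n) ^+ m)) => //.
    by move=> v; rewrite normc_rc ger0_norm ?poisson_ge0// poisson_le.
  have [i1 ->] := Cint_affineV u (lt0r_neq0 t0) iap.
  rewrite (gtr0_norm t0) -CintZ// -CintZ; last first.
    have maz : cmeasurable (fun z : borelV R m => a (inv_nat n *: z + u)).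
      exact: (cmeasurable_comp (measurable_affineV (inv_nat n) u) ma).
    apply: (@cintegrable_le _ _ _ _ _ (fun z : borelV R m => B * cauchyw z)).
    - apply: cmeasurableM => //; apply: cmeasurable_rc; exact: integrable_measurable ic.
    - by move=> z; rewrite normcM normc_rc ger0_norm ?cauchyw_ge0// ler_wpM2r ?cauchyw_ge0.
    - have := integrableZl measurableT B ic.
      by apply: eq_integrable => // z _ /=; rewrite EFinM.
  apply: eq_Cint => z; rewrite addrK !(mulrCA _ (a _)); congr (_ * _).
  by rewrite -!rcM poisson_scale.
split.
  move=> n; rewrite E normcM normc_rc ger0_norm ?exprn_ge0// exprMn -mulrA.
  rewrite ler_wpM2l ?exprn_ge0// mulrC -ec -RintegralZl//.
  apply: normc_Cint_le.
  - apply: cmeasurableM.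
      exact: (cmeasurable_comp (measurable_affineV (inv_nat n) u) ma).
    apply: cmeasurable_rc; exact: integrable_measurable ic.
  - move=> z; rewrite normcM normc_rc ger0_norm ?cauchyw_ge0//.
    by rewrite ler_wpM2r ?cauchyw_ge0.
  - have := integrableZl measurableT B ic.
    by apply: eq_integrable => // z _ /=; rewrite EFinM.
under eq_fun do rewrite E.
apply: ccvgZ; apply: (@cdominated_cvg _ _ _ _ _ _ (fun z : borelV R m => B * cauchyw z)).
- move=> n; apply: cmeasurableM.
    exact: (cmeasurable_comp (measurable_affineV (inv_nat n) u) ma).
  apply: cmeasurable_rc; exact: integrable_measurable ic.
- apply: cmeasurableM; first exact: cmeasurable_cst.
  apply: cmeasurable_rc; exact: integrable_measurable ic.
- move=> z; under eq_fun do rewrite mulrC; rewrite mulrC.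
  by apply: ccvgZ; exact: ca.
- move=> n z; rewrite normcM normc_rc ger0_norm ?cauchyw_ge0//.
  by rewrite ler_wpM2r ?cauchyw_ge0.
- have := integrableZl measurableT B ic.
  by apply: eq_integrable => // z _ /=; rewrite EFinM.
Qed.

(** With the convergence factor [exp (- l1 / (n + 1))] the order of the integrals
    can be exchanged, which produces the Poisson averages of [a]. *)
Lemma fourier_inversion m (a : 'rV[R]_m -> R[i]) (B : R) (u : 'rV[R]_m) :
  cintegrable (lebesgueV R m) a -> (forall u, normc (a u) <= B) -> rcont a ->
  cintegrable (lebesgueV R m) (ift a) ->
  Cint (lebesgueV R m) (fun y => ift a y * expi (- dot u y)) =
    ((2 * pi) ^+ m)%:C * a u.
Proof.
move=> ia aB ca iG; have ma := cintegrable_cmeasurable ia.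
have mG := cintegrable_cmeasurable iG.
have mu_ : cmeasurable (fun y : borelV R m => expi (- dot u y)).
  have := @cmeasurable_char m (- u).
  by under eq_fun do rewrite dotC dotNl.
apply: ccvg_unique (proj2 (poisson_approximation u ia aB ca)).
have E n : Cint (lebesgueV R m) (fun v => a v * (poisson (inv_nat n) (v - u))%:C) =
    Cint (lebesgueV R m) (fun y =>
      (ift a y * expi (- dot u y)) * (expR (- inv_nat n * l1 y))%:C).
  have t0 := inv_nat_gt0 n.
  pose f (z : borelV R m * borelV R m) := a z.2 * expi (dot z.2 z.1) *
    (expi (- dot u z.1) * (expR (- inv_nat n * l1 z.1))%:C).
  have mf : cmeasurable f.
    apply: cmeasurableM.
      apply: cmeasurableM; first exact: (cmeasurable_comp measurable_snd ma).
      by apply: cmeasurable_expi; exact: (measurable_dot measurable_snd measurable_fst).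
    apply: cmeasurableM; first exact: (cmeasurable_comp measurable_fst mu_).
    exact: (cmeasurable_comp measurable_fst
      (cmeasurable_rc (@measurable_exp_l1 R m (inv_nat n)))).
  have [|e _ _] := cFubini mf _ (integrable_exp_l1 m t0) (integrable_normc ia).
    move=> y v; rewrite !normcM !normc_expi mulr1 mul1r normc_rc ger0_norm ?expR_ge0//.
    by rewrite mulrC.
  transitivity (Cint (lebesgueV R m)
      (fun v => Cint (lebesgueV R m) (fun y => f (y, v)))).
    apply: eq_Cint => v; rewrite /f -(Cint_poisson (v - u) t0) -CintZ.
      apply: eq_Cint => y; rewrite -mulrA; congr (_ * _); rewrite mulrA -expiD.
      by rewrite !(dotC _ y) dotDr dotNr.
    apply: (cintegrable_le _ _ (integrable_exp_l1 m t0)).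
      apply: cmeasurableM; first exact: cmeasurable_char.
      exact: cmeasurable_rc (measurable_exp_l1 _).
    by move=> y; rewrite normcM normc_expi mul1r normc_rc ger0_norm ?expR_ge0.
  rewrite -e; apply: eq_Cint => y; rewrite -mulrA.
  exact: (CintZr (expi (- dot u y) * (expR (- inv_nat n * l1 y))%:C)
    (cintegrable_char y ia)).
under eq_fun do rewrite E.
apply: (@cdominated_cvg _ _ _ _ _ _ (fun y : borelV R m => normc (ift a y))).
- move=> n; apply: cmeasurableM; last exact: cmeasurable_rc (measurable_exp_l1 _).
  exact: cmeasurableM.
- exact: cmeasurableM.
- move=> y; rewrite -[X in ccvg _ X]mulr1; apply: ccvgZ.
  apply: ccvg_reim => /=; last exact: cvg_cst.
  exact: cvg_exp_inv_nat.
- move=> n y; rewrite !normcM normc_expi mulr1 normc_rc ger0_norm ?expR_ge0//.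
  rewrite ler_piMr ?cnorm_ge0// -expR0 ler_expR mulNr oppr_le0 mulr_ge0//.
    exact: ltW (inv_nat_gt0 n).
  exact: sumr_ge0.
- exact: integrable_normc.
Qed.

End fourier_inversion.

(** * Uniqueness of measures with a given Fourier transform *)

Section open_approximation.
Variable R : realType.

(** Distance functions exhibit an open set as the support of a continuous
    function. *)
Lemma open_continuous_support m (U : set 'rV[R]_m) : open U -> (~` U) !=set0 ->
  exists d : 'rV[R]_m -> R, [/\ continuous (d : 'rV[R]_m -> R^o),
    forall x, 0 <= d x & forall x, U x <-> 0 < d x].
Proof.
move=> oU [y0 Uy0]; pose S x : set R := [set `|x - y| | y in ~` U].
have Sn x : S x !=set0 by exists `|x - y0|, y0.
have S0 x : lbound (S x) 0 by move=> _ [y _ <-].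
have Sl x : has_lbound (S x) by exists 0; exact: S0.
have lip x x' : inf (S x) <= `|x - x'| + inf (S x').
  rewrite -lerBlDl; apply: lb_le_inf => // _ [y Uy <-]; rewrite lerBlDl.
  apply: (@le_trans _ _ `|x - y|); last exact: ler_distD.
  by apply: ge_inf => //; exists y.
have d0 x : 0 <= inf (S x) by apply: lb_le_inf.
exists (fun x => inf (S x)); split => // [x|x].
  apply/(@cvgrPdist_le R R^o _ (nbhs x) (nbhs_filter x)) => e e0.
  have : nbhs x (ball x e) by exact: nbhsx_ballx.
  apply: filterS => z; rewrite -ball_normE /= => /ltW xz.
  have := lip x z; have := lip z x; rewrite (distrC z x) ler_norml => h1 h2.
  by apply/andP; split; lra.
split=> [Ux|dx].
  have /nbhs_ballP[e /= e0 eU] : nbhs x U by exact: open_nbhs_nbhs.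
  apply: (lt_le_trans e0); apply: lb_le_inf => // _ [y Uy <-].
  rewrite leNgt; apply/negP => xy; apply: Uy; apply: eU.
  by rewrite -ball_normE.
apply: contrapT => Ux; move: dx; rewrite ltNge => /negP; apply.
by apply: ge_inf => //; exists x => //; rewrite subrr normr0.
Qed.

End open_approximation.

Section uniqueness.
Variable R : realType.
Local Open Scope complex_scope.
Variable m : nat.
Local Notation V := (borelV R m).
Implicit Types mu : {finite_measure set (borelV R m) -> \bar R}.

Definition charf mu (u : 'rV[R]_m) : R[i] := Cint mu (fun y : borelV R m => expi (dot u y)).

Lemma finite_integrable_cst mu (c : R) : mu.-integrable setT (EFin \o cst c).
Proof. by apply: finite_measure_integrable_cst. Qed.

Lemma Cint_poisson_charf mu (t : R) (v : 'rV[R]_m) : 0 < t ->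
  Cint mu (fun y => (poisson t (v - y))%:C) =
  Cint (lebesgueV R m) (fun u => (expi (dot u v) * (expR (- t * l1 u))%:C) * charf mu (- u)).
Proof.
move=> t0.
pose f (z : V * V) := (expi (dot z.1 v) * (expR (- t * l1 z.1))%:C) * expi (dot (- z.1) z.2).
have mN : measurable_fun setT (fun u : V => - u : V).
  by have := @measurable_affineV R m (-1) 0; under eq_fun do rewrite scaleN1r addr0.
have me : cmeasurable (fun u : V => expi (dot u v) * (expR (- t * l1 u))%:C).
  apply: cmeasurableM; first exact: cmeasurable_char.
  exact: (cmeasurable_rc (measurable_exp_l1 _)).
have mf : cmeasurable f.
  apply: cmeasurableM; first exact: (cmeasurable_comp measurable_fst me).
  apply: cmeasurable_expi.
  exact: (measurable_dot (measurableT_comp mN measurable_fst) measurable_snd).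
have [|e _ _] := cFubini mf _ (integrable_exp_l1 m t0) (finite_integrable_cst mu 1).
  by move=> u y; rewrite !normcM !normc_expi !mulr1 mul1r normc_rc ger0_norm ?expR_ge0.
transitivity (Cint mu (fun y => Cint (lebesgueV R m) (fun u => f (u, y)))).
  apply: eq_Cint => y; rewrite -(Cint_poisson _ t0); apply: eq_Cint => u.
  rewrite /f /= mulrAC -expiD; congr (expi _ * _).
  by rewrite dotDr dotNr dotNl.
rewrite -e; apply: eq_Cint => u.
have ic : cintegrable mu (fun y : V => expi (dot (- u) y)).
  apply: (cintegrable_le _ _ (finite_integrable_cst mu 1)).
    have := @cmeasurable_char R m (- u).
    by under eq_fun do rewrite dotC.
  by move=> y; rewrite normc_expi.
by rewrite /charf -(CintZ _ ic).
Qed.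

(** The Poisson averages of [f] have integrals that depend on the measure through
    [charf] only, and they converge boundedly to [f]. *)
Lemma charf_Cint_eq mu1 mu2 (f : 'rV[R]_m -> R[i]) (B : R) :
  (forall u, charf mu1 u = charf mu2 u) ->
  cintegrable (lebesgueV R m) f -> (forall u, normc (f u) <= B) -> rcont f ->
  Cint mu1 f = Cint mu2 f.
Proof.
move=> mu12 fi fB cf; have mf := cintegrable_cmeasurable fi.
pose g n u := Cint (lebesgueV R m) (fun v => f v * (poisson (inv_nat R n) (v - u))%:C).
have gB n u : normc (g n u) <= (2 * pi) ^+ m * B.
  by have [h _] := poisson_approximation u fi fB cf; exact: h.
have gf u : ccvg (g ^~ u) (((2 * pi) ^+ m)%:C * f u).
  by have [_ h] := poisson_approximation u fi fB cf; exact: h.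
have gE mu n : cmeasurable (g n : V -> R[i]) /\ Cint mu (g n) =
    Cint (lebesgueV R m) (fun v => f v * Cint mu (fun u => (poisson (inv_nat R n) (v - u))%:C)).
  have t0 := inv_nat_gt0 R n.
  pose F (z : V * V) := f z.2 * (poisson (inv_nat R n) (z.2 - z.1))%:C.
  have mp : measurable_fun setT (fun z : V * V => poisson (inv_nat R n) (z.2 - z.1)).
    have mS : measurable_fun setT (fun z : V * V => z.2 - z.1 : V).
      apply: measurable_rV => j; under eq_fun do rewrite !mxE.
      apply: measurable_funB.
        exact: (measurableT_comp (measurable_coord j) measurable_snd).
      exact: (measurableT_comp (measurable_coord j) measurable_fst).
    exact: (measurableT_comp (measurable_poisson t0) mS).
  have mF : cmeasurable F.
    apply: cmeasurableM; first exact: (cmeasurable_comp measurable_snd mf).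
    exact: cmeasurable_rc.
  have [|e _ mg] := cFubini mF _ (finite_integrable_cst mu ((2 / inv_nat R n) ^+ m))
      (integrable_normc fi).
    move=> u v; rewrite normcM mulrC ler_wpM2r ?cnorm_ge0//.
    by rewrite normc_rc ger0_norm ?poisson_ge0// poisson_le.
  split; first exact: mg.
  have ip v : cintegrable mu (fun u : V => (poisson (inv_nat R n) (v - u))%:C).
    apply: (cintegrable_le _ _ (finite_integrable_cst mu ((2 / inv_nat R n) ^+ m))).
      apply: cmeasurable_rc; apply: (measurableT_comp (measurable_poisson t0)).
      have := @measurable_affineV R m (-1) v.
      by under eq_fun do rewrite scaleN1r addrC.
    by move=> u; rewrite normc_rc ger0_norm ?poisson_ge0// poisson_le.
  by rewrite [LHS]e; apply: eq_Cint => v; rewrite -(CintZ _ (ip v)).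
have gg n : Cint mu1 (g n) = Cint mu2 (g n).
  have [_ ->] := gE mu1 n; have [_ ->] := gE mu2 n.
  apply: eq_Cint => v; congr (_ * _).
  rewrite !(Cint_poisson_charf _ _ (inv_nat_gt0 R n)); apply: eq_Cint => u.
  by rewrite mu12.
have lim mu : ccvg (fun n => Cint mu (g n)) (((2 * pi) ^+ m)%:C * Cint mu f).
  have fmu : cintegrable mu f := cintegrable_le mf fB (finite_integrable_cst mu B).
  rewrite -(CintZ _ fmu); apply: (@cdominated_cvg _ _ _ mu g
      (fun u : V => ((2 * pi) ^+ m)%:C * f u) (fun _ : V => (2 * pi) ^+ m * B)) => //.
  - by move=> n; have [] := gE mu n.
  - by apply: cmeasurableM => //; exact: cmeasurable_cst.
  - exact: finite_integrable_cst.
have := ccvg_unique (lim mu1); under eq_fun do rewrite gg.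
move=> /(_ _ (lim mu2)) /mulfI; apply.
apply/eqP => /(congr1 (@complex.Re _)) /= /eqP.
by rewrite expf_eq0 mulf_eq0 pnatr_eq0 /= gt_eqF ?pi_gt0 ?andbF.
Qed.

Lemma ccvg_rc (u : nat -> R) (l : R) : u @ \oo --> l ->
  ccvg (fun n => (u n)%:C) l%:C.
Proof. by move=> ul; apply: ccvg_reim => //=; exact: cvg_cst. Qed.

Lemma l1_ge0 (x : 'rV[R]_m) : 0 <= l1 x. Proof. exact: sumr_ge0. Qed.

Lemma l1D (x y : 'rV[R]_m) : l1 (x + y) <= l1 x + l1 y.
Proof.
by rewrite /l1 -big_split; apply: ler_sum => j _; rewrite mxE ler_normD.
Qed.

Lemma l1Z (c : R) (x : 'rV[R]_m) : l1 (c *: x) = `|c| * l1 x.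
Proof. by rewrite /l1 mulr_sumr; apply: eq_bigr => j _; rewrite mxE normrM. Qed.

Lemma rcvg_continuous (f : 'rV[R]_m -> R) (z u : 'rV[R]_m) :
  continuous (f : 'rV[R]_m -> R^o) -> f (inv_nat R n *: z + u) @[n --> \oo] --> f u.
Proof.
move=> cf; have h : inv_nat R n *: z + u @[n --> \oo] --> 0 *: z + u.
  by apply: cvgD; [apply: cvgZ; [exact: cvg_inv_nat|exact: cvg_cst]|exact: cvg_cst].
rewrite scale0r add0r in h; exact: (cvg_comp _ _ h (cf u)).
Qed.

Lemma rcvg_l1 (z u : 'rV[R]_m) : l1 (inv_nat R n *: z + u) @[n --> \oo] --> l1 u.
Proof.
apply/cvgrPdist_le => e e0.
have : (inv_nat R n * l1 z) @[n --> \oo] --> (0 * l1 z : R).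
  by apply: cvgM; [exact: cvg_inv_nat|exact: cvg_cst].
rewrite mul0r => /cvgrPdist_le/(_ e e0); apply: filterS => n.
have t0 := inv_nat_gt0 R n.
rewrite sub0r normrN ger0_norm ?mulr_ge0 ?l1_ge0 ?(ltW t0)// => he.
apply: le_trans he; rewrite ler_norml; apply/andP; split.
  have := l1D (inv_nat R n *: z) u; rewrite l1Z (gtr0_norm t0) => h; lra.
have := l1D (inv_nat R n *: z + u) (- inv_nat R n *: z).
rewrite l1Z normrN (gtr0_norm t0) scaleNr addrAC subrr add0r => h; lra.
Qed.

Lemma open_support_dist (U : set 'rV[R]_m) : open U ->
  exists d : 'rV[R]_m -> R, [/\ continuous (d : 'rV[R]_m -> R^o),
    forall x, 0 <= d x & forall x, U x <-> 0 < d x].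
Proof.
move=> oU; have [Uc|/set0P Uc] := eqVneq (~` U) set0; last exact: open_continuous_support.
exists (fun=> 1); split => [|x|x]; [exact: cst_continuous|exact: ler01|].
by split => // _; rewrite -[U]setCK Uc; case.
Qed.

(** Open sets determine a finite Borel measure, and the indicator of an open set
    is a limit of integrable continuous functions. *)
Lemma charf_unique mu1 mu2 : (forall u, charf mu1 u = charf mu2 u) ->
  forall A, measurable A -> mu1 A = mu2 A.
Proof.
move=> mu12 A mA; apply: (@measure_unique _ R V (@open 'rV[R]_m) (fun=> setT)) => //.
- exact: openI.
- by move=> _; exact: openT.
- by rewrite bigcup_const//; exists 0%N.
- move=> U oU; have [d [cd d0 dU]] := open_support_dist oU.
  have md : measurable_fun setT (d : V -> R) := measurable_continuousV cd.
  have mU : measurable (U : set V) by exact: sub_sigma_algebra.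
  pose r k (x : 'rV[R]_m) : R := Num.min 1 (k.+1%:R * d x) * expR (- inv_nat R k * l1 x).
  have e1 k (x : 'rV[R]_m) : expR (- inv_nat R k * l1 x) <= 1.
    by rewrite -expR0 ler_expR mulNr oppr_le0 mulr_ge0 ?l1_ge0// ltW// inv_nat_gt0.
  have m0 k (x : 'rV[R]_m) : 0 <= Num.min 1 (k.+1%:R * d x).
    by rewrite le_min ler01 mulr_ge0.
  have m1 k (x : 'rV[R]_m) : Num.min 1 (k.+1%:R * d x) <= 1 by rewrite ge_min lexx.
  have r0 k x : 0 <= r k x by rewrite mulr_ge0 ?expR_ge0.
  have rB k x : normc (r k x)%:C <= 1.
    by rewrite normc_rc ger0_norm// mulr_ile1// expR_ge0.
  have mr k : cmeasurable (fun x : V => (r k x)%:C).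
    apply: cmeasurable_rc; apply: measurable_funM; last exact: measurable_exp_l1.
    by apply: measurable_minr => //; exact: measurable_funM.
  have rE k : Cint mu1 (fun x : V => (r k x)%:C) = Cint mu2 (fun x : V => (r k x)%:C).
    apply: (charf_Cint_eq mu12 _ (rB k)).
      apply: (cintegrable_le (mr k) _ (integrable_exp_l1 m (inv_nat_gt0 R k))) => x.
      by rewrite normc_rc ger0_norm// ler_piMl ?expR_ge0.
    move=> u z; apply: ccvg_rc; apply: cvgM.
      have hd := @rcvg_continuous d z u cd.
      have hg : Num.min 1 (k.+1%:R * y) @[y --> d u] --> Num.min 1 (k.+1%:R * d u).
        apply: (@continuous_min _ _ (fun=> 1) (fun y : R => k.+1%:R * y)).
          exact: cvg_cst.
        by apply: cvgM; [exact: cvg_cst|exact: cvg_id].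
      exact: (cvg_comp _ _ hd hg).
    apply: (cvg_comp (fun n => - inv_nat R k * l1 (inv_nat R n *: z + u)) expR).
      by apply: cvgM; [exact: cvg_cst|exact: rcvg_l1].
    exact: continuous_expR.
  have lim (mu : {finite_measure set (borelV R m) -> \bar R}) :
      ccvg (fun k => Cint mu (fun x : V => (r k x)%:C)) (fine (mu U))%:C.
    have -> : (fine (mu U))%:C = Cint mu (fun x : V => (\1_(U : set V) x)%:C).
      by rewrite Cint_rc /Rintegral integral_indic// setIT.
    apply: (@cdominated_cvg _ _ _ mu _ _ (cst 1)) => //.
    + by apply: cmeasurable_rc; exact: measurable_indic.
    + move=> x; apply: ccvg_rc; rewrite indicE.
      have [/set_mem Ux|/negP Ux] := boolP (x \in (U : set V)).
        rewrite -[X in _ --> X](mulr1 1); apply: cvgM; last exact: cvg_exp_inv_nat.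
        have dx : 0 < d x by apply/dU.
        apply/cvgrPdist_le => e e0.
        have : (inv_nat R n * (d x)^-1) @[n --> \oo] --> (0 * (d x)^-1 : R).
          by apply: cvgM; [exact: cvg_inv_nat|exact: cvg_cst].
        rewrite mul0r => /cvgrPdist_le/(_ e e0); apply: filterS => k.
        rewrite sub0r normrN ger0_norm ?mulr_ge0 ?invr_ge0 ?d0// => he.
        apply: le_trans he; rewrite ger0_norm ?subr_ge0 ?m1// -invfM.
        set s := _ * d x; have s0 : 0 < s by rewrite mulr_gt0.
        have [s1|s1] := leP 1 s; first by rewrite subrr invr_ge0 ltW.
        apply: (@le_trans _ _ 1).
          by rewrite lerBlDr lerDl ltW.
        by rewrite invf_ge1// ltW.
      have dx : d x = 0.
        apply/eqP; rewrite eq_le d0 andbT leNgt; apply/negP => /dU Ux'.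
        by apply: Ux; exact/mem_set.
      rewrite /r dx; under eq_fun do rewrite mulr0 min_r// mul0r.
      exact: cvg_cst.
    + exact: finite_integrable_cst.
  have := ccvg_unique (lim mu1); under eq_fun do rewrite rE.
  move=> /(_ _ (lim mu2)) /(congr1 (@complex.Re _)) /= h.
  by rewrite -[LHS]fineK ?fin_num_measure// h fineK// fin_num_measure.
- by move=> _; rewrite -ge0_fin_numE// fin_num_measure.
Qed.

End uniqueness.

(** * Transference from finite exponential sums to integrals *)

Lemma expr_ord (R : realType) (c : R) m : c ^+ m = \prod_(j < m) c.
Proof. by rewrite prodr_const card_ord. Qed.

Lemma continuous_sum (R : realType) (T : topologicalType) (I : Type) (r : seq I) (F : I -> T -> R^o) :
  (forall i, continuous (F i)) -> continuous (fun v => \sum_(i <- r) F i v).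
Proof.
move=> cF; elim: r => [|i r IH].
  under eq_fun do rewrite big_nil; exact: cst_continuous.
under eq_fun do rewrite big_cons.
by move=> v; apply: cvgD; [exact: cF|exact: IH].
Qed.

Section fejer.
Variable R : realType.
Local Open Scope complex_scope.
Local Notation leb := (@lebesgue_measure R).
Variables (rho : R) (rho0 : 0 < rho) (N : nat).

(** The lattice spacing dual to the period [2 rho]. *)
Definition spacing : R := pi / rho.
Local Notation eps := spacing.

Lemma spacing_gt0 : 0 < eps. Proof. by rewrite divr_gt0// pi_gt0. Qed.

Definition dirichlet (v : R) : R[i] := \sum_(k < N.+1) expi (eps * k%:R * v).

Definition fejer (v : R) : R := N.+1%:R^-1 * normc (dirichlet v) ^+ 2.

Lemma fejer_ge0 v : 0 <= fejer v.
Proof. by rewrite mulr_ge0 ?exprn_ge0 ?cnorm_ge0. Qed.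

Lemma dirichlet_conj v :
  dirichlet v * conjc (dirichlet v) =
  \sum_(k < N.+1) \sum_(k' < N.+1) expi (eps * (k%:R - k'%:R) * v).
Proof.
have -> : conjc (dirichlet v) = \sum_(k < N.+1) conjc (expi (eps * k%:R * v)).
  exact: (big_morph _ (rmorphD _) (rmorph0 _)).
rewrite /dirichlet big_distrl; apply: eq_bigr => k _.
rewrite big_distrr; apply: eq_bigr => k' _ /=.
by rewrite -expiN -expiD; congr expi; ring.
Qed.

Lemma fejerE v : fejer v =
  N.+1%:R^-1 * \sum_(k < N.+1) \sum_(k' < N.+1) cos (eps * (k%:R - k'%:R) * v).
Proof.
rewrite /fejer; congr (_ * _).
have <- : cre (dirichlet v * conjc (dirichlet v)) = normc (dirichlet v) ^+ 2.
  by rewrite mulrC mulc_conj.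
rewrite dirichlet_conj re_sum; apply: eq_bigr => k _; rewrite re_sum.
by apply: eq_bigr.
Qed.

Lemma sin_natpi (n : nat) : sin (pi * n%:R) = 0 :> R.
Proof.
elim: n => [|n IH]; first by rewrite mulr0 sin0.
by rewrite -natr1 mulrDr mulr1 sinD IH sinpi mul0r mulr0 addr0.
Qed.

Lemma integral_cos_period (k k' : nat) (z : R) :
  \int[leb]_(v in `[- rho, rho]) cos (eps * (k%:R - k'%:R) * (v + z)) =
  if k == k' then 2 * rho else 0.
Proof.
have rr : - rho < rho by rewrite gtrN.
have [->|kk] := eqVneq k k'.
  under eq_Rintegral do rewrite subrr mulr0 mul0r cos0.
  rewrite Rintegral_cst// mul1r.
  have E : lebesgue_measure (`[(- rho), rho]%classic : set R) = (rho - - rho)%:E.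
    by rewrite lebesgue_measure_itv/= lte_fin rr.
  by rewrite [LHS](congr1 fine E) /=; ring.
set a := eps * _; have a0 : a != 0.
  by apply: mulf_neq0; [rewrite gt_eqF// spacing_gt0|rewrite subr_eq0 eqr_nat].
pose F v := a^-1 * sin (a * (v + z)).
have dF (v : R) : is_derive v 1 F (cos (a * (v + z))).
  have d1 : is_derive v 1 (fun v : R => a * (v + z)) a.
    by apply: is_derive_eq; rewrite /GRing.scale /=; ring.
  have d2 := is_derive1_comp (is_derive_sin _) d1.
  by apply: is_derive_eq; rewrite /GRing.scale /=; field.
have cF : continuous F.
  by move=> v; apply/differentiable_continuous/derivable1_diffP; case: (dF v).
have cc : continuous (fun v : R => cos (a * (v + z))).
  move=> v; apply: (cvg_comp (fun v => a * (v + z)) cos); last exact: continuous_cos.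
  apply: cvgM; first exact: cvg_cst.
  by apply: cvgD; [exact: cvg_id|exact: cvg_cst].
rewrite /Rintegral (@continuous_FTC2 _ _ F)//.
- rewrite /= /F -mulrBr; apply/eqP; rewrite mulf_eq0 invr_eq0 (negbTE a0)/=.
  have -> : a * (rho + z) = a * z + a * rho by ring.
  have -> : a * (- rho + z) = a * z - a * rho by ring.
  have sa : sin (a * rho) = 0.
    have -> : a * rho = pi * k%:R - pi * k'%:R.
      by rewrite /a /spacing; field; rewrite gt_eqF.
    by rewrite sinB !sin_natpi mul0r mulr0 subrr.
  by rewrite sinB sinD sa !mulr0 subr0 addr0 subrr.
- by apply: continuous_subspaceT.
- split; first by move=> v _; case: (dF v).
  + by apply: cvg_at_right_filter; exact: cF.
  + by apply: cvg_at_left_filter; exact: cF.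
- by move=> v _; rewrite derive1E; exact: derive_val.
Qed.

Lemma continuous_fejer : continuous fejer.
Proof.
have -> : fejer = (fun v : R => N.+1%:R^-1 *
    \sum_(k < N.+1) \sum_(k' < N.+1) cos (eps * (k%:R - k'%:R) * v)).
  by apply/funext => v; exact: fejerE.
move=> v; apply: cvgM; first exact: cvg_cst.
apply: continuous_sum => k {}v; apply: continuous_sum => k' {}v.
apply: (cvg_comp (fun v => eps * (k%:R - k'%:R) * v) cos); last exact: continuous_cos.
by apply: cvgM; [exact: cvg_cst|exact: cvg_id].
Qed.

(** Only the diagonal terms of the double sum have a nonzero mean over a
    period. *)
Lemma integral_fejer (z : R) :
  (\int[leb]_v (\1_(`[(- rho), rho]%classic : set R) v * fejer (v + z))%:E = (2 * rho)%:E)%E.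
Proof.
have cfz : continuous (fun v => fejer (v + z)).
  move=> v; apply: (cvg_comp (fun v => v + z) fejer); last exact: continuous_fejer.
  by apply: cvgD; [exact: cvg_id|exact: cvg_cst].
have cc k k' : continuous (fun v => cos (eps * (k%:R - k'%:R) * (v + z))).
  move=> v; apply: (cvg_comp (fun v => eps * (k%:R - k'%:R) * (v + z)) cos);
    last exact: continuous_cos.
  apply: cvgM; first exact: cvg_cst.
  by apply: cvgD; [exact: cvg_id|exact: cvg_cst].
have int_of_cont (f : R -> R) : continuous f ->
    leb.-integrable `[(- rho), rho] (EFin \o f).
  move=> cf; apply: continuous_compact_integrable; first exact: segment_compact.
  exact: continuous_subspaceT.
transitivity (\int[leb]_(v in `[(- rho)%R, rho]) (fejer (v + z))%:E)%E.
  rewrite [RHS]integral_mkcond; apply: eq_integral => v _.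
  rewrite /patch indicE; case: (_ \in _); rewrite ?mul1r ?mul0r//.
rewrite -[LHS]fineK ?integrable_fin_num//; last exact: int_of_cont.
congr EFin.
have -> : fine (\int[leb]_(v in `[(- rho)%R, rho]) (fejer (v + z))%:E) =
    N.+1%:R^-1 * \sum_(k < N.+1) \sum_(k' < N.+1)
      \int[leb]_(v in `[(- rho), rho]) cos (eps * (k%:R - k'%:R) * (v + z)).
  have sumE (I : Type) (r : seq I) (F : I -> R -> R) : (forall i, continuous (F i)) ->
      \int[leb]_(v in `[(- rho), rho]) (\sum_(i <- r) F i v) =
      \sum_(i <- r) \int[leb]_(v in `[(- rho), rho]) F i v.
    move=> cF; elim: r => [|i r IH].
      by under eq_Rintegral do rewrite big_nil; rewrite big_nil Rintegral_cst// mul0r.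
    under eq_Rintegral do rewrite big_cons.
    rewrite big_cons RintegralD ?IH//; first exact: int_of_cont.
    by apply: int_of_cont; exact: continuous_sum.
  rewrite -[LHS]/(\int[leb]_(v in `[(- rho), rho]) fejer (v + z)).
  under eq_Rintegral do rewrite fejerE.
  rewrite RintegralZl//; last first.
    by apply: int_of_cont; do 2 apply: continuous_sum => ?; exact: cc.
  rewrite sumE; last by move=> k; apply: continuous_sum => k'; exact: cc.
  by congr (_ * _); apply: eq_bigr => k _; rewrite sumE.
have -> : \sum_(k < N.+1) \sum_(k' < N.+1)
    \int[leb]_(v in `[(- rho), rho]) cos (eps * (k%:R - k'%:R) * (v + z)) =
    \sum_(k < N.+1) (2 * rho).
  apply: eq_bigr => k _; rewrite (bigD1 k)//= integral_cos_period eqxx.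
  rewrite big1 ?addr0// => k' kk'; rewrite integral_cos_period.
  by rewrite eq_sym (inj_eq val_inj) (negbTE kk').
by rewrite sumr_const card_ord -[(2 * rho) *+ _]mulr_natl mulKf ?pnatr_eq0.
Qed.

(** Average over the lattice differences of the indicator of a cell; it tends to
    1, and turns an integral into an average of lattice sums. *)
Definition cell (v : R) : R := \1_(`[0, eps[%classic : set R) v.

Definition cell_average (t : R) : R := N.+1%:R^-1 *
  \sum_(k < N.+1) \sum_(k' < N.+1) cell (t - eps * (k%:R - k'%:R)).

Lemma cell_ge0 v : 0 <= cell v. Proof. by rewrite /cell indicE; case: (_ \in _). Qed.
Lemma cell_le1 v : cell v <= 1. Proof. by rewrite /cell indicE; case: (_ \in _). Qed.

Lemma cellP v : cell v = if (0 <= v < eps) then 1 else 0.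
Proof. by rewrite /cell indicE mem_setE in_itv/=; case: ifP. Qed.

(** The translates of a cell by the lattice are disjoint. *)
Lemma cell_sum_le1 t (c : R) : \sum_(k < N.+1) cell (t - eps * (k%:R - c)) <= 1.
Proof.
have e0 := spacing_gt0.
have [/existsP[k hk]|/existsPn h] := boolP [exists k : 'I_N.+1,
    0 <= t - eps * (k%:R - c) < eps]; last first.
  by rewrite big1 ?ler01// => k _; rewrite cellP (negbTE (h k)).
rewrite (bigD1 k)//= cellP hk big1 ?addr0// => k' kk'; rewrite cellP.
case: ifP => // hk'; exfalso.
have h1 : `|(k%:R : R) - k'%:R| < 1.
  rewrite -(ltr_pM2l e0) mulr1 -[X in X * _](gtr0_norm e0) -normrM ltr_norml.
  move: hk hk' => /andP[h1 h2] /andP[h3 h4].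
  rewrite (_ : eps * _ = (t - eps * (k'%:R - c)) - (t - eps * (k%:R - c))); last ring.
  apply/andP; split; lra.
move: kk'; rewrite -val_eqE /= => /negP; apply.
have [lt|lt|e] := ltngtP (k : nat) k'; last by [].
  move: h1; rewrite distrC ger0_norm ?subr_ge0 ?ler_nat ?(ltnW lt)//.
  by rewrite ltrBlDr addrC natr1 ltr_nat ltnS leqNgt lt.
move: h1; rewrite ger0_norm ?subr_ge0 ?ler_nat ?(ltnW lt)//.
by rewrite ltrBlDr addrC natr1 ltr_nat ltnS leqNgt lt.
Qed.

Lemma cell_average_ge0 t : 0 <= cell_average t.
Proof.
rewrite mulr_ge0 ?invr_ge0//; apply: sumr_ge0 => k _.
by apply: sumr_ge0 => k' _; exact: cell_ge0.
Qed.

Lemma cell_average_le1 t : cell_average t <= 1.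
Proof.
rewrite /cell_average mulrC ler_pdivrMr// mul1r exchange_big /=.
apply: (@le_trans _ _ (\sum_(k' < N.+1) 1)).
  by apply: ler_sum => k' _; exact: cell_sum_le1.
by rewrite sumr_const card_ord.
Qed.

(** The lattice point [l] below [t / eps] is a difference [k - k'] in at least
    [N + 1 - |l|] ways. *)
Lemma cell_average_ge t : 1 - N.+1%:R^-1 * (`|Num.floor (t / eps)|%N)%:R <= cell_average t.
Proof.
have e0 := spacing_gt0; set l := Num.floor _.
have cell1 (k k' : nat) : (k%:Z = k'%:Z + l)%R -> cell (t - eps * (k%:R - k'%:R)) = 1.
  move=> kl; rewrite cellP.
  have -> : (k%:R : R) - k'%:R = l%:~R.
    have -> : l = (k%:Z - k'%:Z)%R by rewrite kl addrC addKr.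
    by rewrite rmorphB.
  have h1 : l%:~R <= t / eps by exact: Num.Theory.floor_le.
  have h2 : t / eps < (l + 1)%:~R by exact: Num.Theory.floorD1_gt.
  rewrite ler_pdivlMr// mulrC in h1; rewrite ltr_pdivrMr// rmorphD /= mulrDl mul1r in h2.
  by rewrite subr_ge0 h1 ltrBlDr addrC (mulrC eps) h2.
have count (n : nat) (f : nat -> nat -> R) : (forall k k', 0 <= f k k') ->
    (forall k, f (k + n)%N k = 1) ->
    N.+1%:R - n%:R <= \sum_(k' < N.+1) \sum_(k < N.+1) f k k'.
  move=> f0 f1; rewrite -(big_mkord xpredT (fun k' => \sum_(k < N.+1) f k k')).
  have [nN|nN] := leqP n N.+1; last first.
    apply: (@le_trans _ _ 0); first by rewrite subr_le0 ler_nat ltnW.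
    by apply: sumr_ge0 => ? _; exact: sumr_ge0.
  rewrite -natrB// (@big_cat_nat _ _ _ (N.+1 - n)%N) ?leq_subr//=.
  rewrite -[leLHS]addr0 lerD//; last by apply: sumr_ge0 => ? _; exact: sumr_ge0.
  have -> : (N.+1 - n)%:R = \sum_(0 <= i < N.+1 - n) (1 : R).
    by rewrite sumr_const_nat subn0.
  rewrite !big_nat; apply: ler_sum => k' /andP[_ k'N].
  have kN : (k' + n < N.+1)%N by rewrite addnC -ltn_subRL.
  rewrite (bigD1 (Ordinal kN))//= f1 lerDl.
  by apply: sumr_ge0.
rewrite /cell_average -[X in X - _](@mulVf _ (N.+1%:R : R)) ?pnatr_eq0// -mulrBr.
rewrite ler_pM2l ?invr_gt0//.
case: (intP l) cell1 => [|n|n] cell1.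
- rewrite exchange_big/= subr0; have := @count 0%N _ (fun k k' => cell_ge0 (t - eps * (k%:R - k'%:R))).
  by rewrite subr0; apply => k; apply: cell1; rewrite addn0 addr0.
- rewrite exchange_big/=; apply: (count n.+1 (fun k k' => cell (t - eps * (k%:R - k'%:R)))).
    by move=> *; exact: cell_ge0.
  by move=> k; apply: cell1.
- rewrite abszN; apply: (count n.+1 (fun k k' => cell (t - eps * (k'%:R - k%:R)))).
    by move=> *; exact: cell_ge0.
  by move=> k; apply: cell1; rewrite PoszD addrK.
Qed.

End fejer.

Section transference.
Variable R : realType.
Local Open Scope complex_scope.
Local Notation leb := (@lebesgue_measure R).
Variable m : nat.
Local Notation V := (borelV R m).
Local Notation mu := (lebesgueV R m).

(** Multiplying the coefficients of exponential sums by [psi] increases their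
    uniform norm by the factor [A] at most. Translating an exponential sum only
    changes the phases of its coefficients, so it is enough to test the value at
    the origin. *)
Definition multiplier_bound (A : R) (psi : 'rV[R]_m -> R[i]) : Prop :=
  forall (I : finType) (c : I -> R[i]) (a : I -> 'rV[R]_m) (B : R),
    (forall x, normc (\sum_i c i * expi (dot (a i) x)) <= B) ->
    normc (\sum_i c i * psi (a i)) <= A * B.

Section lattice.
Variables (rho : R) (rho0 : 0 < rho) (N : nat).
Local Notation K := {ffun 'I_m -> 'I_N.+1 * 'I_N.+1}.
Local Notation W := (N.+1%:R^-1 ^+ m : R).

(** The frequencies of a product of Fejer kernels, each repeated as often as it
    occurs there as a difference. *)
Definition freq (k : K) : 'rV[R]_m :=
  \row_j (spacing rho * ((k j).1%:R - (k j).2%:R)).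

Lemma sum_expi_freq (x : 'rV[R]_m) :
  W%:C * \sum_(k : K) expi (dot (freq k) x) = (\prod_j fejer rho N (x ord0 j))%:C.
Proof.
have -> : \sum_(k : K) expi (dot (freq k) x) =
    \prod_j \sum_(p : 'I_N.+1 * 'I_N.+1)
      expi (spacing rho * (p.1%:R - p.2%:R) * x ord0 j).
  rewrite bigA_distr_bigA; apply: eq_bigr => k _.
  by rewrite /dot expi_sum; apply: eq_bigr => j _; rewrite mxE.
rewrite expr_ord [in LHS]rc_prod -big_split [in RHS]rc_prod.
apply: eq_bigr => j _ /=.
rewrite -(pair_bigA _ (fun p q : 'I_N.+1 => expi (spacing rho * (p%:R - q%:R) * x ord0 j))).
by rewrite /= -dirichlet_conj mulrC /fejer rcM mulrC -mulc_conj [conjc _ * _]mulrC.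
Qed.

Definition cellV (v : 'rV[R]_m) : R := \prod_j cell rho (v ord0 j).

Lemma prod_cell_average (u : 'rV[R]_m) :
  \prod_j cell_average rho N (u ord0 j) = W * \sum_(k : K) cellV (u - freq k).
Proof.
rewrite /cell_average big_split/= prodr_const card_ord; congr (_ * _).
rewrite (eq_bigr (fun j => \sum_(p : 'I_N.+1 * 'I_N.+1)
    cell rho (u ord0 j - spacing rho * (p.1%:R - p.2%:R)))); last first.
  by move=> j _; rewrite pair_bigA.
rewrite bigA_distr_bigA; apply: eq_bigr => k _; apply: eq_bigr => j _.
by rewrite !mxE.
Qed.

Lemma integral_cell : (\int[leb]_v (cell rho v)%:E = (spacing rho)%:E)%E.
Proof.
have e0 := spacing_gt0 rho0.
rewrite integral_indic// setIT.
have E : lebesgue_measure (`[0, spacing rho[%classic : set R) = (spacing rho - 0)%:E.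
  by rewrite lebesgue_measure_itv/= lte_fin e0.
by rewrite [LHS]E subr0.
Qed.

Lemma measurable_cell : measurable_fun setT (cell rho).
Proof. exact: measurable_indic. Qed.

Lemma integrable_cellV : mu.-integrable setT (EFin \o cellV) /\
  \int[mu]_x cellV x = spacing rho ^+ m.
Proof.
have i1 : leb.-integrable setT (EFin \o cell rho).
  apply/integrableP; split; first exact: (measurable_EFin measurable_cell).
  rewrite [X in (X < _)%E](_ : _ = (\int[leb]_v (cell rho v)%:E)%E).
    by rewrite integral_cell ltry.
  by apply: eq_integral => v _ /=; rewrite ger0_norm ?cell_ge0.
have [h1 h2] := @integrable_prod_coord R m (fun _ => cell rho) (fun _ => cell_ge0 rho)
  (fun _ => i1).
split; first exact: h1.
rewrite [LHS]h2 prodr_const card_ord; congr (_ ^+ _).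
by rewrite /Rintegral integral_cell.
Qed.

Lemma cellV_ge0 v : 0 <= cellV v.
Proof. by apply: prodr_ge0 => j _; exact: cell_ge0. Qed.

Variables (G s : 'rV[R]_m -> R[i]).
Hypothesis iG : cintegrable mu G.
Hypothesis ms : cmeasurable (s : V -> R[i]).

Definition cube (x : 'rV[R]_m) : R := \prod_j \1_(`[(- rho), rho]%classic : set R) (x ord0 j).
Hypothesis s_cube : forall x, normc (s x) <= cube x.

Lemma integrable_cube_fejer (z : 'rV[R]_m) :
  mu.-integrable setT (EFin \o (fun x : V =>
     \prod_j (\1_(`[(- rho), rho]%classic : set R) (x ord0 j) *
              fejer rho N (x ord0 j + z ord0 j)))) /\
  \int[mu]_x (\prod_j (\1_(`[(- rho), rho]%classic : set R) (x ord0 j) *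
              fejer rho N (x ord0 j + z ord0 j))) = (2 * rho) ^+ m.
Proof.
pose f (j : 'I_m) (v : R) := \1_(`[(- rho), rho]%classic : set R) v * fejer rho N (v + z ord0 j).
have f0 j v : 0 <= f j v.
  by rewrite mulr_ge0 ?fejer_ge0// indicE; case: (_ \in _).
have mf j : measurable_fun setT (f j).
  apply: measurable_funM; first exact: measurable_indic.
  apply: continuous_measurable_fun => v.
  apply: (cvg_comp (fun v => v + z ord0 j) (fejer rho N)); last exact: continuous_fejer.
  by apply: cvgD; [exact: cvg_id|exact: cvg_cst].
have i1 j : leb.-integrable setT (EFin \o f j).
  apply/integrableP; split; first exact: (measurable_EFin (mf j)).
  rewrite [X in (X < _)%E](_ : _ = (\int[leb]_v (f j v)%:E)%E).
    by rewrite integral_fejer// ltry.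
  by apply: eq_integral => v _ /=; rewrite ger0_norm ?f0.
have [h1 h2] := integrable_prod_coord f0 i1.
split; first exact: h1.
rewrite [LHS]h2 expr_ord; apply: eq_bigr => j _.
by rewrite /Rintegral integral_fejer.
Qed.

Definition shat (u : 'rV[R]_m) : R[i] := ift s u.

Lemma integrable_cube : mu.-integrable setT (EFin \o cube).
Proof.
have [] := @integrable_prod_coord R m (fun _ => \1_(`[(- rho), rho]%classic : set R)) => //.
move=> _; apply/integrableP; split.
  by apply: measurable_EFin; exact: measurable_indic.
rewrite [X in (X < _)%E](_ : _ = (\int[leb]_v (\1_(`[(- rho), rho]%classic : set R) v)%:E)%E).
  rewrite integral_indic// setIT.
  have E : lebesgue_measure (`[(- rho), rho]%classic : set R) = (rho - - rho)%:E.
    by rewrite lebesgue_measure_itv/= lte_fin gtrN.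
  by rewrite [X in (X < _)%E]E ltry.
by apply: eq_integral => v _ /=; rewrite ger0_norm// indicE; case: (_ \in _).
Qed.

Lemma is_ : cintegrable mu s.
Proof. exact: (cintegrable_le ms s_cube integrable_cube). Qed.

(** The sum over the lattice is the integral of [s], up to phases, against a
    product of Fejer kernels, which is nonnegative with a known integral over the
    cube. *)
Lemma lattice_sum_shat (th z : 'rV[R]_m) :
  normc (\sum_(k : K) W%:C * shat (freq k + th) * expi (dot (freq k + th) z)) <=
  (2 * rho) ^+ m.
Proof.
have [ic ec] := integrable_cube_fejer z.
have E : \sum_(k : K) W%:C * shat (freq k + th) * expi (dot (freq k + th) z) =
    Cint mu (fun x : V => s x * (expi (dot th (x + z)) *
       (\prod_j fejer rho N ((x + z) ord0 j))%:C)).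
  rewrite /shat /ift.
  transitivity (\sum_(k : K) Cint mu (fun x : V => (W%:C * expi (dot (freq k + th) z)) *
      (s x * expi (dot x (freq k + th))))).
    apply: eq_bigr => k _; rewrite CintZ; first by rewrite mulrAC.
    exact: (cintegrable_char _ is_).
  rewrite -Cint_sum; last first.
    by move=> k; apply: cintegrableZ; exact: (cintegrable_char _ is_).
  apply: eq_Cint => x; rewrite -sum_expi_freq !mulr_sumr; apply: eq_bigr => k _.
  rewrite dotDl expiD (dotC x) dotDl expiD !dotDr !expiD; ring.
have Ez (x : 'rV[R]_m) : \prod_j fejer rho N ((x + z) ord0 j) =
    \prod_j fejer rho N (x ord0 j + z ord0 j).
  by apply: eq_bigr => j _; rewrite mxE.
rewrite E -ec; apply: normc_Cint_le => //.
- apply: cmeasurableM => //; apply: cmeasurableM.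
    apply: cmeasurable_expi; apply: measurable_dot; first exact: measurable_cst.
    by have := @measurable_affineV R m 1 z; under eq_fun do rewrite scale1r.
  apply: cmeasurable_rc; apply: (@eq_measurable_fun _ _ _ _ _
    (fun x : V => \prod_j fejer rho N (x ord0 j + z ord0 j))) => [x _|].
    exact/esym/Ez.
  apply: (@measurable_prod_coord R m (fun j v => fejer rho N (v + z ord0 j))) => j.
  apply: continuous_measurable_fun => v.
  apply: (cvg_comp (fun v => v + z ord0 j) (fejer rho N)); last exact: continuous_fejer.
  by apply: cvgD; [exact: cvg_id|exact: cvg_cst].
- move=> x; rewrite !normcM normc_expi mul1r normc_rc ger0_norm; last first.
    by apply: prodr_ge0 => j _; exact: fejer_ge0.
  rewrite [leRHS]big_split/= [X in _ * X <= _]Ez.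
  by rewrite ler_wpM2r//; apply: prodr_ge0 => j _; exact: fejer_ge0.
Qed.

Definition ghat (u : 'rV[R]_m) : R[i] := Cint mu (fun y : V => G y * expi (- dot u y)).

Lemma iGe (u : 'rV[R]_m) : cintegrable mu (fun y : V => G y * expi (- dot u y)).
Proof.
apply: (cintegrableM_bounded (B := 1)) => //; last by move=> y; rewrite normc_expi.
have := @cmeasurable_char R m (- u).
by under eq_fun do rewrite dotC dotNl.
Qed.

(** The additional factor [ghat] amounts to a convolution with [G]. *)
Lemma lattice_sum_bound (th z : 'rV[R]_m) :
  normc (\sum_(k : K) (W%:C * (ghat (freq k + th) * shat (freq k + th))) *
     expi (dot (freq k + th) z)) <=
  (2 * rho) ^+ m * \int[mu]_y normc (G y).
Proof.
have E : \sum_(k : K) (W%:C * (ghat (freq k + th) * shat (freq k + th))) *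
      expi (dot (freq k + th) z) =
    Cint mu (fun y : V => G y * (\sum_(k : K) W%:C * shat (freq k + th) *
       expi (dot (freq k + th) (z - y)))).
  transitivity (\sum_(k : K) Cint mu (fun y : V =>
      (W%:C * shat (freq k + th) * expi (dot (freq k + th) z)) *
      (G y * expi (- dot (freq k + th) y)))).
    apply: eq_bigr => k _; rewrite CintZ; last exact: iGe.
    rewrite /ghat; ring.
  rewrite -Cint_sum; last by move=> k; apply: cintegrableZ; exact: iGe.
  apply: eq_Cint => y; rewrite mulr_sumr; apply: eq_bigr => k _.
  rewrite (dotDr z) expiD dotNr; ring.
rewrite E -RintegralZl//; last exact: integrable_normc.
apply: normc_Cint_le.
- apply: cmeasurableM; first exact: cintegrable_cmeasurable iG.
  apply: cmeasurable_sum => k; apply: cmeasurableM; first exact: cmeasurable_cst.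
  apply: cmeasurable_expi; apply: measurable_dot; first exact: measurable_cst.
  have := @measurable_affineV R m (-1) z.
  by under eq_fun do rewrite scaleN1r addrC.
- move=> y; rewrite normcM mulrC ler_wpM2r ?cnorm_ge0//.
  exact: lattice_sum_shat.
- have := integrableZl measurableT ((2 * rho) ^+ m) (integrable_normc iG).
  by apply: eq_integrable => // z' _ /=; rewrite EFinM.
Qed.

Variables (A : R) (psi : 'rV[R]_m -> R[i]) (Bpsi : R).
Hypothesis mpsi : cmeasurable (psi : V -> R[i]).
Hypothesis psiB : forall u, normc (psi u) <= Bpsi.
Hypothesis hpsi : multiplier_bound A psi.
Hypothesis igs : cintegrable mu (fun u : V => ghat u * shat u).

Lemma igsM (b : V -> R) : measurable_fun setT b -> (forall x, `|b x| <= 1) ->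
  cintegrable mu (fun u : V => psi u * (ghat u * shat u) * (b u)%:C).
Proof.
move=> mb b1; apply: (cintegrableM_bounded (B := 1)).
- under eq_fun do rewrite mulrC; exact: (cintegrableM_bounded (B := Bpsi)).
- exact: cmeasurable_rc.
- by move=> x; rewrite normc_rc.
Qed.

(** Cutting the integral into cells writes it as an integral, over the offset
    [th] in a single cell, of exponential sums with frequencies [freq k + th]. The
    hypothesis on [psi] applies for each offset. *)
Lemma transference_step :
  normc (Cint mu (fun u : V => psi u * (ghat u * shat u) *
    (\prod_j cell_average rho N (u ord0 j))%:C)) <=
  A * (2 * pi) ^+ m * \int[mu]_y normc (G y).
Proof.
have [ic ec] := integrable_cellV.
have mcell : measurable_fun setT (cellV : V -> R) := integrable_measurable ic.
have cell1 v : `|cellV v| <= 1.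
  rewrite ger0_norm ?cellV_ge0// -(expr1n R m) expr_ord.
  by apply: ler_prod => j _; rewrite cell_ge0 cell_le1.
have mshift (b : 'rV[R]_m) : measurable_fun setT (fun u : V => u + b : V).
  by have := @measurable_affineV R m 1 b; under eq_fun do rewrite scale1r.
pose F (k : K) (u : 'rV[R]_m) := psi u * (ghat u * shat u) * (cellV (u - freq k))%:C.
have iF k : cintegrable mu (F k).
  by apply: igsM => //; exact: (measurableT_comp mcell (mshift _)).
have E : Cint mu (fun u : V => psi u * (ghat u * shat u) *
      (\prod_j cell_average rho N (u ord0 j))%:C) =
    Cint mu (fun th : V => (cellV th)%:C * \sum_(k : K)
      (W%:C * (ghat (freq k + th) * shat (freq k + th))) * psi (freq k + th)).
  transitivity (\sum_(k : K) Cint mu (fun u : V => W%:C * F k u)).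
    rewrite -Cint_sum; last by move=> k; exact: cintegrableZ.
    apply: eq_Cint => u; rewrite prod_cell_average rcM rc_sum !mulr_sumr.
    by apply: eq_bigr => k _; rewrite /F mulrCA.
  transitivity (\sum_(k : K) Cint mu (fun u : V => W%:C * F k (u + freq k))).
    apply: eq_bigr => k _; have [i1 e1] := Cint_shift (freq k) (iF k).
    by rewrite (CintZ _ (iF k)) -e1 (CintZ _ i1).
  rewrite -Cint_sum; last first.
    by move=> k; apply: cintegrableZ; have [] := Cint_shift (freq k) (iF k).
  apply: eq_Cint => th; rewrite mulr_sumr; apply: eq_bigr => k _.
  rewrite /F addrK (addrC th); ring.
have rhoE : (2 * pi) ^+ m = (2 * rho) ^+ m * spacing rho ^+ m.
  rewrite -exprMn; congr (_ ^+ _); rewrite /spacing; field; rewrite gt_eqF//.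
rewrite E rhoE -ec.
rewrite [leRHS](_ : _ = \int[mu]_x
    (A * ((2 * rho) ^+ m * \int[mu]_y normc (G y)) * cellV x)); last first.
  by rewrite RintegralZl//; ring.
apply: normc_Cint_le.
- apply: cmeasurableM; first exact: cmeasurable_rc.
  apply: cmeasurable_sum => k.
  have mg := cintegrable_cmeasurable igs.
  have mS : measurable_fun setT (fun u : V => freq k + u : V).
    by under eq_fun do rewrite addrC; exact: mshift.
  apply: cmeasurableM; last exact: (cmeasurable_comp mS mpsi).
  apply: cmeasurableM; first exact: cmeasurable_cst.
  exact: (cmeasurable_comp mS mg).
- move=> th; rewrite normcM normc_rc ger0_norm ?cellV_ge0// mulrC ler_wpM2r ?cellV_ge0//.
  by apply: hpsi => x; exact: lattice_sum_bound.
- have := integrableZl measurableT (A * ((2 * rho) ^+ m * \int[mu]_y normc (G y))) ic.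
  by apply: eq_integrable => // z' _ /=; rewrite EFinM.
Qed.

End lattice.

Lemma cvg_prodR (I : Type) (r : seq I) (F : I -> nat -> R) (l : I -> R) :
  (forall i, F i @ \oo --> l i) ->
  (\prod_(i <- r) F i n) @[n --> \oo] --> \prod_(i <- r) l i.
Proof.
move=> Fl; elim: r => [|i r IH].
  by under eq_fun do rewrite big_nil; rewrite big_nil; exact: cvg_cst.
by under eq_fun do rewrite big_cons; rewrite big_cons; apply: cvgM.
Qed.

Lemma cvg_cell_average (rho : R) (t : R) : 0 < rho ->
  cell_average rho n t @[n --> \oo] --> (1 : R).
Proof.
move=> rho0; set l := (`|Num.floor (t / spacing rho)|%N)%:R : R.
have h : (1 - inv_nat R n * l) @[n --> \oo] --> (1 - 0 * l : R).
  apply: cvgB; first exact: cvg_cst.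
  by apply: cvgM; [exact: cvg_inv_nat|exact: cvg_cst].
rewrite mul0r subr0 in h; apply: (squeeze_cvgr _ h (cvg_cst (1 : R))).
by apply: nearW => n; rewrite cell_average_ge// cell_average_le1.
Qed.

(** The average over offsets of the lattice sums is the integral itself, so the
    bound for exponential sums passes to integrals of measurable [psi]. The
    Fejer weights keep the lattice sums of [G] bounded by its
    integral because they are nonnegative. *)
Lemma transference (rho : R) (G s psi : 'rV[R]_m -> R[i]) (A Bpsi : R) : 0 < rho ->
  cintegrable mu G -> cmeasurable (s : V -> R[i]) ->
  (forall x, normc (s x) <= cube rho x) ->
  cmeasurable (psi : V -> R[i]) -> (forall u, normc (psi u) <= Bpsi) ->
  multiplier_bound A psi ->
  cintegrable mu (fun u : V => ghat G u * shat s u) ->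
  normc (Cint mu (fun u : V => psi u * (ghat G u * shat s u))) <=
    A * (2 * pi) ^+ m * \int[mu]_y normc (G y).
Proof.
move=> rho0 iG ms sc mpsi psiB hpsi igs.
have lim : ccvg (fun N => Cint mu (fun u : V => psi u * (ghat G u * shat s u) *
    (\prod_j cell_average rho N (u ord0 j))%:C))
    (Cint mu (fun u : V => psi u * (ghat G u * shat s u))).
  have mq N : measurable_fun setT (fun u : V => \prod_j cell_average rho N (u ord0 j)).
    apply: (@measurable_prod_coord R m (fun _ => cell_average rho N)) => j.
    apply: measurable_funM => //; apply: measurable_sum => k; apply: measurable_sum => k'.
    have h : measurable_fun setT (fun t : R => t - spacing rho * (k%:R - k'%:R)).
      exact: measurable_funB.
    exact: (measurableT_comp (measurable_cell rho) h).
  have q1 N (u : V) : `|\prod_j cell_average rho N (u ord0 j)| <= 1.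
    rewrite ger0_norm; last by apply: prodr_ge0 => j _; exact: cell_average_ge0.
    apply: (@le_trans _ _ (\prod_(j < m) (1 : R))); last by rewrite big1.
    by apply: ler_prod => j _; rewrite cell_average_ge0 cell_average_le1.
  have mgs := cintegrable_cmeasurable igs.
  apply: (@cdominated_cvg _ _ _ mu _ _ (fun u : V => Bpsi * normc (ghat G u * shat s u))).
  - move=> N; apply: cmeasurableM; last exact: cmeasurable_rc.
    exact: cmeasurableM.
  - exact: cmeasurableM.
  - move=> u; rewrite -[X in ccvg _ X]mulr1; apply: ccvgZ; apply: ccvg_rc.
    have := @cvg_prodR _ (index_enum 'I_m) (fun j N => cell_average rho N (u ord0 j)) (fun=> 1).
    by rewrite big1//; apply => j; exact: cvg_cell_average.
  - move=> N u; rewrite 2!normcM normc_rc.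
    apply: (@le_trans _ _ (normc (psi u) * normc (ghat G u * shat s u) * 1)).
      by apply: ler_wpM2l => //; rewrite mulr_ge0 ?cnorm_ge0.
    by rewrite mulr1 ler_wpM2r ?cnorm_ge0.
  - have := integrableZl measurableT Bpsi (integrable_normc igs).
    by apply: eq_integrable => // z' _ /=; rewrite EFinM.
apply: (ccvg_normc_le lim) => N.
exact: (transference_step rho0 N iG ms sc mpsi psiB hpsi igs).
Qed.

End transference.

(** * Multipliers and the L^1 norm *)

Section multiplier_L1.
Variable R : realType.
Local Open Scope complex_scope.
Variable m : nat.
Local Notation V := (borelV R m).
Local Notation mu := (lebesgueV R m).

Lemma cube_ge0 (rho : R) (x : 'rV[R]_m) : 0 <= cube rho x.
Proof. by apply: prodr_ge0 => j _; rewrite indicE; case: (_ \in _). Qed.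

Lemma le_cube (r s : R) (x : 'rV[R]_m) : r <= s -> cube r x <= cube s x.
Proof.
move=> rs; apply: ler_prod => j _; rewrite !indicE !mem_setE !in_itv/=.
case: (boolP (- r <= _ <= r)) => [/andP[h1 h2]|_]; last by rewrite lexx ler0n.
by rewrite (_ : (- s <= _ <= s) = true) ?ler01 ?lexx//; apply/andP; split; lra.
Qed.

Lemma cube_eq1 (r : R) (x : 'rV[R]_m) : l1 x <= r -> cube r x = 1.
Proof.
move=> xr; rewrite /cube big1// => j _; rewrite indicE mem_setE in_itv/= -ler_norml.
rewrite (le_trans _ xr)// /l1 (bigD1 j)//= lerDl; exact: sumr_ge0.
Qed.

Lemma measurable_cube (r : R) : measurable_fun setT (cube r : V -> R).
Proof.
apply: (@measurable_prod_coord R m (fun _ => \1_(`[(- r), r]%classic : set R))) => j.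
exact: measurable_indic.
Qed.

(** Testing against unimodular functions with bounded support computes the
    norm of an integrable function. *)
Lemma multiplier_cube (A Bpsi B rho : R) (psi a : 'rV[R]_m -> R[i]) : 0 < rho ->
  cmeasurable (psi : V -> R[i]) -> (forall u, normc (psi u) <= Bpsi) ->
  multiplier_bound A psi ->
  cintegrable mu a -> (forall u, normc (a u) <= B) -> rcont a ->
  cintegrable mu (ift a) ->
  \int[mu]_x (cube rho x * normc (ift (fun u => a u * psi u) x)) <=
    A * \int[mu]_x normc (ift a x).
Proof.
move=> rho0 mpsi psiB hpsi ia aB ca iG; set K := ift _.
have ma := cintegrable_cmeasurable ia.
have iap : cintegrable mu (fun u : V => a u * psi u).
  exact: (cintegrableM_bounded (B := Bpsi)).
have mK : cmeasurable (K : V -> R[i]) := cmeasurable_ift iap.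
(* The conjugate phase of [K]; the real power [-1] takes the value 0 at 0, so
   that [s] vanishes with [K]. *)
pose s (x : 'rV[R]_m) : R[i] := (cube rho x)%:C * (conjc (K x) * (normc (K x) `^ (-1))%:C).
have sE x : s x * K x = (cube rho x * normc (K x))%:C.
  rewrite /s -mulrA mulrAC mulc_conj -rcM powR_inv1 ?cnorm_ge0//.
  have [->|K0] := eqVneq (normc (K x)) 0; first by rewrite -rcM expr0n /= mul0r.
  by rewrite expr2 mulfK// -rcM.
have ms : cmeasurable (s : V -> R[i]).
  apply: cmeasurableM; first exact: (cmeasurable_rc (measurable_cube rho)).
  apply: cmeasurableM; first exact: cmeasurable_conj.
  apply: cmeasurable_rc; exact: (measurableT_comp (measurable_powR _) (measurable_normc mK)).
have sc x : normc (s x) <= cube rho x.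
  rewrite /s !normcM normc_conj !normc_rc ger0_norm ?cube_ge0// ger0_norm ?powR_ge0//.
  rewrite powR_inv1 ?cnorm_ge0// ler_piMr ?cube_ge0//.
  have [->|K0] := eqVneq (normc (K x)) 0; first by rewrite mul0r ler01.
  by rewrite mulfV.
have is_ := is_ rho0 ms sc.
have gE u : ghat (ift a) u = ((2 * pi) ^+ m)%:C * a u.
  exact: (fourier_inversion u ia aB ca iG).
have ms' : cmeasurable (shat s : V -> R[i]) := cmeasurable_ift is_.
have sB u : normc (shat s u) <= \int[mu]_x cube rho x.
  apply: normc_Cint_le; [|by move=> x; rewrite normcM normc_expi mulr1 sc|
    exact: integrable_cube].
  by apply: cmeasurableM => //; exact: cmeasurable_char.
have igs : cintegrable mu (fun u : V => ghat (ift a) u * shat s u).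
  apply: (cintegrableM_bounded (B := \int[mu]_x cube rho x)) => //.
  rewrite (_ : ghat (ift a) = (fun u => ((2 * pi) ^+ m)%:C * a u)).
    exact: cintegrableZ.
  by apply/funext => u; exact: gE.
have := transference rho0 iG ms sc mpsi psiB hpsi igs.
pose F (z : V * V) := (a z.1 * psi z.1) * (s z.2 * expi (dot z.2 z.1)).
have iss : cintegrable mu (fun u : V => (a u * psi u) * shat s u).
  exact: (cintegrableM_bounded (B := \int[mu]_x cube rho x)).
have -> : Cint mu (fun u : V => psi u * (ghat (ift a) u * shat s u)) =
    ((2 * pi) ^+ m)%:C * Cint mu (fun u : V => (a u * psi u) * shat s u).
  by rewrite -(CintZ _ iss); apply: eq_Cint => u; rewrite gE; ring.
have mF : cmeasurable F.
  apply: cmeasurableM.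
    exact: (cmeasurable_comp measurable_fst (cintegrable_cmeasurable iap)).
  apply: cmeasurableM; first exact: (cmeasurable_comp measurable_snd ms).
  by apply: cmeasurable_expi; exact: (measurable_dot measurable_snd measurable_fst).
have [|e _ _] := cFubini mF _ (integrable_normc iap) (integrable_cube m rho0).
  move=> u x; rewrite /F normcM [X in _ * X <= _]normcM normc_expi mulr1.
  by rewrite ler_wpM2l ?cnorm_ge0.
have -> : Cint mu (fun u : V => (a u * psi u) * shat s u) =
    (\int[mu]_x (cube rho x * normc (K x)))%:C.
  rewrite -Cint_rc; transitivity (Cint mu (fun u => Cint mu (fun x => F (u, x)))).
    by apply: eq_Cint => u; rewrite /shat -(CintZ _ (cintegrable_char u is_)).
  rewrite e; apply: eq_Cint => x; rewrite -sE /K.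
  rewrite -(CintZ _ (cintegrable_char x iap)); apply: eq_Cint => u.
  by rewrite /F /= (dotC u); ring.
set J := \int[mu]_x (_ * normc _); set I := \int[mu]_y normc _.
have : 0 < (2 * pi) ^+ m :> R by exact: (exprn_gt0 _ (mulr_gt0 (ltr0Sn R 1) (pi_gt0 R))).
move: (_ ^+ m) => c c0; rewrite normcM (normc_rc c) (normc_rc J) (gtr0_norm c0).
rewrite mulrAC [A * I * c]mulrC (ler_pM2l c0).
by apply: le_trans; rewrite ler_norm.
Qed.

(** Monotone convergence over growing cubes: the integrability of the left-hand
    side is part of the conclusion. *)
Lemma multiplier_L1 (A Bpsi B : R) (psi a : 'rV[R]_m -> R[i]) :
  cmeasurable (psi : V -> R[i]) -> (forall u, normc (psi u) <= Bpsi) ->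
  multiplier_bound A psi ->
  cintegrable mu a -> (forall u, normc (a u) <= B) -> rcont a ->
  cintegrable mu (ift a) ->
  (\int[mu]_x (normc (ift (fun u => a u * psi u) x))%:E <=
    (A * \int[mu]_x normc (ift a x))%:E)%E.
Proof.
move=> mpsi psiB hpsi ia aB ca iG; set K := ift _.
have ma := cintegrable_cmeasurable ia.
have iap : cintegrable mu (fun u : V => a u * psi u).
  exact: (cintegrableM_bounded (B := Bpsi)).
have mK : cmeasurable (K : V -> R[i]) := cmeasurable_ift iap.
have mg n : measurable_fun setT (fun x : V => (cube n.+1%:R x * normc (K x))%:E).
  apply: measurable_EFin; apply: measurable_funM; first exact: measurable_cube.
  exact: measurable_normc.
have g0 n (x : V) : (0 <= (cube n.+1%:R x * normc (K x))%:E)%E.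
  by rewrite lee_fin mulr_ge0 ?cube_ge0 ?cnorm_ge0.
have nd (x : V) : {homo (fun n => (cube n.+1%:R x * normc (K x))%:E) : n p / (n <= p)%N >-> (n <= p)%E}.
  by move=> n p np; rewrite lee_fin ler_wpM2r ?cnorm_ge0// le_cube// ler_nat ltnS.
rewrite (_ : (\int[mu]_x (normc (K x))%:E)%E =
  limn (fun n => \int[mu]_x (cube n.+1%:R x * normc (K x))%:E)%E); last first.
  rewrite -monotone_convergence//.
  apply: eq_integral => x _; apply/esym/cvg_lim => //.
  apply: cvg_near_cst; near=> n; rewrite cube_eq1 ?mul1r//.
  near: n; apply: filterS (nbhs_infty_ger (l1 x)) => k /le_trans; apply.
  by rewrite ler_nat.
apply: lime_le.
  apply: ereal_nondecreasing_is_cvgn => n p np.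
  by apply: ge0_le_integral => // x _; exact: nd.
apply: nearW => n.
have BK (x : V) : normc (K x) <= \int[mu]_u normc (a u * psi u).
  apply: normc_Cint_le; [|by move=> u; rewrite normcM normc_expi mulr1|
    exact: integrable_normc].
  apply: cmeasurableM; first exact: cintegrable_cmeasurable iap.
  exact: cmeasurable_char.
have n0 : 0 < n.+1%:R :> R by [].
have iK : mu.-integrable setT (EFin \o (fun x : V => cube n.+1%:R x * normc (K x))).
  apply: (@integrable_le _ _ _ _ _ (fun x : V =>
      (\int[mu]_u normc (a u * psi u)) * cube n.+1%:R x)).
  - by apply: measurable_funM; [exact: measurable_cube|exact: measurable_normc].
  - move=> x; rewrite ger0_norm ?mulr_ge0 ?cube_ge0 ?cnorm_ge0// mulrC.
    by rewrite ler_wpM2r ?cube_ge0.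
  - have := integrableZl measurableT (\int[mu]_u normc (a u * psi u))
      (integrable_cube m n0).
    by apply: eq_integrable => // x _ /=; rewrite EFinM.
rewrite -[leLHS]fineK ?integrable_fin_num// lee_fin.
exact: (multiplier_cube n0 mpsi psiB hpsi ia aB ca iG).
Unshelve. all: by end_near. Qed.

End multiplier_L1.

(** * Decay of the Fourier transform *)

Section directional.
Variable R : realType.
Local Open Scope complex_scope.
Variable m : nat.
Local Notation V := (borelV R m).
Local Notation mu := (lebesgueV R m).
Local Notation e_ j := (delta_mx ord0 j : 'rV[R]_m).
Implicit Types (a b : 'rV[R]_m -> R[i]) (j : 'I_m) (x : 'rV[R]_m).

Definition dderiv j a a' : Prop := forall (u : 'rV[R]_m) (t : R),
  is_derive t 1 (fun s => cre (a (u + s *: e_ j))) (cre (a' (u + t *: e_ j))) /\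
  is_derive t 1 (fun s => cim (a (u + s *: e_ j))) (cim (a' (u + t *: e_ j))).

(** Only derivatives in one direction are recorded: decay of the Fourier
    transform in the largest coordinate is all that is used, and this spares
    mixed partial derivatives. *)
Fixpoint dbounded (k : nat) (j : 'I_m) (Bd : 'rV[R]_m -> R) a : Prop :=
  cmeasurable (a : V -> R[i]) /\ (forall u, normc (a u) <= Bd u) /\
  match k with
  | 0%N => True
  | k'.+1 => exists a', dderiv j a a' /\ dbounded k' j Bd a'
  end.

Lemma dbounded_bound k j Bd a : dbounded k j Bd a ->
  cmeasurable (a : V -> R[i]) /\ (forall u, normc (a u) <= Bd u).
Proof. by case: k => [|k] [h1 [h2 _]]. Qed.

Definition wexp (u : 'rV[R]_m) : R := expR (- 1 * l1 u).

Lemma wexp_ge0 u : 0 <= wexp u. Proof. exact: expR_ge0. Qed.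

Lemma wexp_shift u t j : `|t| <= 1 -> wexp (u + t *: e_ j) <= expR 1 * wexp u.
Proof.
move=> t1; rewrite /wexp -expRD ler_expR !mulN1r.
have h1 := l1D (u + t *: e_ j) (- t *: e_ j).
rewrite scaleNr addrK -scaleNr l1Z normrN in h1.
have le1 : l1 (e_ j) <= 1.
  rewrite /l1 (bigD1 j)//= mxE !eqxx normr1 big1 ?addr0// => i ij.
  by rewrite mxE (negbTE ij) andbF normr0.
have h2 : `|t| * l1 (e_ j) <= 1 by rewrite -(mulr1 1) ler_pM// l1_ge0.
by rewrite lerNl opprD opprK; move: h1 h2; lra.
Qed.

Lemma cvg_derive_seq (f : R -> R) (df : R) : is_derive (0 : R) 1 f df ->
  ((inv_nat R n)^-1 * (f (inv_nat R n) - f 0)) @[n --> \oo] --> df.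
Proof.
case=> fd fE; rewrite -fE.
have h : h^-1 *: ((f \o shift 0) (h *: 1) - f 0) @[h --> 0^'] --> 'D_1 f 0 by exact: fd.
have ht : inv_nat R n @[n --> \oo] --> (0 : R)^'.
  move=> U U0; have := @cvg_inv_nat R _ U0.
  apply: (@filterS _ \oo _ (fun n => inv_nat R n != 0 -> U (inv_nat R n))) => n; apply.
  by rewrite gt_eqF ?inv_nat_gt0.
have := cvg_comp _ _ ht h; apply: cvg_trans; apply: near_eq_cvg; apply: nearW => n.
by rewrite /= addr0 /GRing.scale /= mulr1.
Qed.

Lemma dderiv_quotient_cvg j a a' u : dderiv j a a' ->
  ccvg (fun n => ((inv_nat R n)^-1)%:C * (a (u + inv_nat R n *: e_ j) - a u)) (a' u).
Proof.
move=> aa; have [d1 d2] := aa u 0.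
apply: ccvg_reim.
  have := cvg_derive_seq d1; rewrite !scale0r !addr0.
  by under [X in _ -> X @ _ --> _]eq_fun do rewrite reZ reD reN.
have := cvg_derive_seq d2; rewrite !scale0r !addr0.
by under [X in _ -> X @ _ --> _]eq_fun do rewrite imZ imD imN.
Qed.

Lemma derive_le_bound (f df : R -> R) (t C : R) : 0 < t ->
  (forall s : R, is_derive s 1 f (df s)) ->
  (forall s, 0 <= s <= t -> `|df s| <= C) -> `|f t - f 0| <= t * C.
Proof.
move=> t0 fd dC.
have cf : {within `[0, t], continuous f}.
  apply: continuous_subspaceT => s.
  by apply/differentiable_continuous/derivable1_diffP; case: (fd s).
have [c /[!in_itv]/= /andP[c0 ct] ->] := MVT t0 (fun s _ => fd s) cf.
rewrite subr0 normrM (gtr0_norm t0) mulrC ler_wpM2l ?(ltW t0)//.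
by apply: dC; rewrite (ltW c0) (ltW ct).
Qed.

Lemma dderiv_quotient_bound j a a' (B : R) u t : 0 < t <= 1 -> dderiv j a a' ->
  (forall u, normc (a' u) <= B * wexp u) ->
  normc ((t^-1)%:C * (a (u + t *: e_ j) - a u)) <= 2 * expR 1 * B * wexp u.
Proof.
move=> /andP[t0 t1] aa a'B.
have B0 : 0 <= B.
  by have := le_trans (cnorm_ge0 _) (a'B 0); rewrite pmulr_lge0// expR_gt0.
have bd s : 0 <= s <= t -> normc (a' (u + s *: e_ j)) <= expR 1 * B * wexp u.
  move=> /andP[s0 st]; rewrite (le_trans (a'B _))//.
  rewrite [leRHS](_ : _ = B * (expR 1 * wexp u)); last by ring.
  by rewrite ler_wpM2l// wexp_shift// ger0_norm// (le_trans st).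
have h1 : `|cre (a (u + t *: e_ j)) - cre (a u)| <= t * (expR 1 * B * wexp u).
  have := @derive_le_bound (fun s => cre (a (u + s *: e_ j)))
    (fun s => cre (a' (u + s *: e_ j))) t (expR 1 * B * wexp u) t0.
  rewrite scale0r addr0; apply => s; first by case: (aa u s).
  by move=> st; rewrite (le_trans (re_le_normc _))// bd.
have h2 : `|cim (a (u + t *: e_ j)) - cim (a u)| <= t * (expR 1 * B * wexp u).
  have := @derive_le_bound (fun s => cim (a (u + s *: e_ j)))
    (fun s => cim (a' (u + s *: e_ j))) t (expR 1 * B * wexp u) t0.
  rewrite scale0r addr0; apply => s; first by case: (aa u s).
  by move=> st; rewrite (le_trans (im_le_normc _))// bd.
rewrite normcM normc_rc gtr0_norm ?invr_gt0// mulrC ler_pdivrMr//.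
rewrite (le_trans (normc_le_reim _))// reD reN imD imN.
by move: h1 h2; set z := expR 1 * B * wexp u => h1 h2;
  rewrite (_ : 2 * expR 1 * B * wexp u * t = t * z + t * z) ?lerD// /z; ring.
Qed.

Lemma integrable_wexp (B : R) : mu.-integrable setT (EFin \o (fun u : V => B * wexp u)).
Proof.
have := integrableZl measurableT B (integrable_exp_l1 m ltr01).
by apply: eq_integrable => // z' _ /=; rewrite EFinM.
Qed.

Lemma cintegrable_wexp a (B : R) : cmeasurable (a : V -> R[i]) ->
  (forall u, normc (a u) <= B * wexp u) -> cintegrable mu a.
Proof. by move=> ma aB; apply: (cintegrable_le ma aB); exact: integrable_wexp. Qed.

(** Integration by parts, through the invariance of the integral under
    translations along [e_j]. *)
Lemma ift_dderiv j a a' (B : R) x : dderiv j a a' ->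
  cmeasurable (a : V -> R[i]) -> cmeasurable (a' : V -> R[i]) ->
  (forall u, normc (a u) <= B * wexp u) -> (forall u, normc (a' u) <= B * wexp u) ->
  ift a' x = (0 -i* x ord0 j) * ift a x.
Proof.
move=> aa ma ma' aB a'B.
have ia := cintegrable_wexp ma aB.
have mshift (b : 'rV[R]_m) : measurable_fun setT (fun u : V => u + b : V).
  by have := @measurable_affineV R m 1 b; under eq_fun do rewrite scale1r.
pose q n (u : V) := ((inv_nat R n)^-1)%:C * (a (u + inv_nat R n *: e_ j) - a u).
have lim : ccvg (fun n => Cint mu (fun u : V => q n u * expi (dot u x))) (ift a' x).
  apply: (@cdominated_cvg _ _ _ mu _ _ (fun u : V => 2 * expR 1 * B * wexp u)).
  - move=> n; apply: cmeasurableM; last exact: cmeasurable_char.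
    apply: cmeasurableM; first exact: cmeasurable_cst.
    apply: cmeasurableD; first exact: (cmeasurable_comp (mshift _) ma).
    have := cmeasurableM (cmeasurable_cst V (-1)) ma.
    by under eq_fun do rewrite mulN1r.
  - by apply: cmeasurableM => //; exact: cmeasurable_char.
  - move=> u; under eq_fun do rewrite mulrC; rewrite mulrC.
    by apply: ccvgZ; exact: dderiv_quotient_cvg.
  - move=> n u; rewrite normcM normc_expi mulr1.
    by apply: dderiv_quotient_bound aa a'B => //; rewrite inv_nat_gt0 inv_nat_le1.
  - exact: integrable_wexp.
apply: (ccvg_unique lim).
have E n : Cint mu (fun u : V => q n u * expi (dot u x)) =
    (((inv_nat R n)^-1)%:C * (expi (inv_nat R n * - x ord0 j) - 1)) * ift a x.
  set t := inv_nat R n.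
  pose f (u : V) := a u * expi (dot (u - t *: e_ j) x).
  have fE u : f u = expi (t * - x ord0 j) * (a u * expi (dot u x)).
    rewrite /f dotDl dotNl dotZl (dotC (e_ j)) dot_delta expiD mulrN; ring.
  have iF : cintegrable mu f.
    rewrite (_ : f = (fun u => expi (t * - x ord0 j) * (a u * expi (dot u x)))).
      by apply: cintegrableZ; exact: cintegrable_char.
    by apply/funext.
  have [i1 e1] := Cint_shift (t *: e_ j) iF.
  have -> : Cint mu (fun u : V => q n u * expi (dot u x)) =
      (t^-1)%:C * (Cint mu (fun u => f (u + t *: e_ j)) - ift a x).
    rewrite -(CintN (cintegrable_char x ia)) -CintD//; last first.
      by apply: cintegrableN; exact: cintegrable_char.
    rewrite -CintZ; last first.
      by apply: cintegrableD => //; apply: cintegrableN; exact: cintegrable_char.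
    by apply: eq_Cint => u; rewrite /q /f addrK -/t; ring.
  rewrite e1 (eq_Cint _ fE) (CintZ _ (cintegrable_char x ia)) -/(ift a x); ring.
under eq_fun do rewrite E.
under eq_fun do rewrite mulrC; rewrite mulrC; apply: ccvgZ.
have dcx : is_derive (0 : R) 1 (fun t => cos (t * - x ord0 j)) 0.
  have d1 : is_derive (0 : R) 1 (fun t : R => t * - x ord0 j) (- x ord0 j).
    by apply: is_derive_eq; rewrite /GRing.scale /=; ring.
  have d2 := is_derive1_comp (is_derive_cos _) d1.
  by apply: is_derive_eq; rewrite mul0r sin0 /GRing.scale /=; ring.
have dsx : is_derive (0 : R) 1 (fun t => sin (t * - x ord0 j)) (- x ord0 j).
  have d1 : is_derive (0 : R) 1 (fun t : R => t * - x ord0 j) (- x ord0 j).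
    by apply: is_derive_eq; rewrite /GRing.scale /=; ring.
  have d2 := is_derive1_comp (is_derive_sin _) d1.
  by apply: is_derive_eq; rewrite mul0r cos0 /GRing.scale /=; ring.
apply: ccvg_reim.
  have := cvg_derive_seq dcx; rewrite mul0r cos0.
  by under [X in _ -> X @ _ --> _]eq_fun do rewrite reZ reD reN.
have := cvg_derive_seq dsx; rewrite mul0r sin0.
by under [X in _ -> X @ _ --> _]eq_fun do rewrite imZ imD imN.
Qed.

Definition Iwexp : R := \int[mu]_u wexp u.

Lemma Iwexp_ge0 : 0 <= Iwexp.
Proof. by apply: Rintegral_ge0 => u _; exact: wexp_ge0. Qed.

Lemma ift_bound a (B : R) x : cmeasurable (a : V -> R[i]) ->
  (forall u, normc (a u) <= B * wexp u) -> normc (ift a x) <= B * Iwexp.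
Proof.
move=> ma aB; rewrite /Iwexp -RintegralZl//; last first.
  have := integrable_wexp 1; apply: eq_integrable => // u _ /=.
  by rewrite mul1r.
apply: normc_Cint_le; last exact: integrable_wexp.
- by apply: cmeasurableM => //; exact: cmeasurable_char.
- by move=> u; rewrite normcM normc_expi mulr1.
Qed.

Lemma ift_decay k j a (B : R) x : dbounded k j (fun u => B * wexp u) a ->
  `|x ord0 j| ^+ k * normc (ift a x) <= B * Iwexp.
Proof.
elim: k a => [|k IH] a; first by move=> [ma [aB _]]; rewrite expr0 mul1r; exact: ift_bound.
move=> [ma [aB [a' [aa ha']]]]; have [ma' a'B] := dbounded_bound ha'.
have := IH _ ha'; rewrite (ift_dderiv x aa ma ma' aB a'B) normcM.
have -> : normc (0 -i* x ord0 j) = `|x ord0 j|.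
  by rewrite normcE /= expr0n add0r sqrrN sqrtr_sqr.
by rewrite mulrA -exprSr.
Qed.

(** Decay in the direction of the largest coordinate of [x] gives decay in
    all coordinates at once, so only pure derivatives are needed. *)
Lemma ift_cauchy a (B : R) x : cmeasurable (a : V -> R[i]) ->
  (forall u, normc (a u) <= B * wexp u) ->
  (forall j, dbounded (2 * m) j (fun u => B * wexp u) a) ->
  normc (ift a x) <= 2 ^+ m.+1 * (B * Iwexp) * cauchyw x.
Proof.
move=> ma aB da; have h0 := ift_bound x ma aB.
set N := normc (ift a x) in h0 *.
have N0 : 0 <= N by exact: cnorm_ge0.
have P0 : 0 < \prod_j (1 + x ord0 j ^+ 2).
  by apply: prodr_gt0 => j _; rewrite ltr_pwDl// sqr_ge0.
have -> : cauchyw x = (\prod_j (1 + x ord0 j ^+ 2))^-1.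
  by rewrite /cauchyw prodfV.
rewrite ler_pdivlMr//.
suff [s [s0 Ps hs]] : exists s : R, [/\ 0 <= s, \prod_j (1 + x ord0 j ^+ 2) <= (1 + s) ^+ m &
    s ^+ m * N <= B * Iwexp].
  have h2 : (1 + s) ^+ m <= 2 ^+ m * (1 + s ^+ m).
    have [s1|s1] := leP s 1.
      apply: (@le_trans _ _ (2 ^+ m * 1)); last first.
        by rewrite ler_wpM2l ?exprn_ge0// lerDl exprn_ge0.
      by rewrite mulr1; apply: lerXn2r; rewrite ?nnegrE//; lra.
    apply: (@le_trans _ _ (2 ^+ m * s ^+ m)); last first.
      by rewrite ler_wpM2l ?exprn_ge0// lerDr.
    by rewrite -exprMn; apply: lerXn2r; rewrite ?nnegrE//; lra.
  apply: (@le_trans _ _ (N * (2 ^+ m * (1 + s ^+ m)))).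
    by rewrite ler_wpM2l// (le_trans Ps).
  rewrite exprSr (_ : N * _ = 2 ^+ m * (N + s ^+ m * N)); last by ring.
  rewrite -!mulrA ler_wpM2l ?exprn_ge0//; lra.
case: (pickP (predT : pred 'I_m)) => [j0 _|none]; last first.
  exists 0; split => //; first by rewrite addr0 expr1n big1// => j; have := none j.
  by rewrite (le_trans _ h0)// ler_piMl// expr0n lern1 leq_b1.
pose j := [arg max_(i > j0) `|x ord0 i|]%O.
have jmax i : `|x ord0 i| <= `|x ord0 j|.
  by rewrite /j; case: Order.TotalTheory.arg_maxP => //= k _; apply.
exists (x ord0 j ^+ 2); split; first exact: sqr_ge0.
  rewrite expr_ord; apply: ler_prod => i _; rewrite addr_ge0 ?sqr_ge0//= lerD2l.
  by rewrite -[leLHS]real_normK ?num_real// -[leRHS]real_normK ?num_real// lerXn2r ?nnegrE.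
have -> : (x ord0 j ^+ 2) ^+ m = `|x ord0 j| ^+ (2 * m).
  by rewrite exprM real_normK ?num_real.
exact: ift_decay.
Qed.

Lemma ift_integrable a (B : R) : cmeasurable (a : V -> R[i]) ->
  (forall u, normc (a u) <= B * wexp u) ->
  (forall j, dbounded (2 * m) j (fun u => B * wexp u) a) ->
  cintegrable mu (ift a) /\
  \int[mu]_x normc (ift a x) <= 2 ^+ m.+1 * Iwexp * pi ^+ m * B.
Proof.
move=> ma aB da; have ia := cintegrable_wexp ma aB.
have mi := cmeasurable_ift ia.
have [ic ec] := integrable_cauchyw R m.
have ik : mu.-integrable setT (EFin \o (fun x : V => 2 ^+ m.+1 * (B * Iwexp) * cauchyw x)).
  have := integrableZl measurableT (2 ^+ m.+1 * (B * Iwexp)) ic.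
  by apply: eq_integrable => // z' _ /=; rewrite EFinM.
have ii : cintegrable mu (ift a).
  by apply: (cintegrable_le mi _ ik) => x; exact: ift_cauchy.
split => //.
apply: (@le_trans _ _ (\int[mu]_x (2 ^+ m.+1 * (B * Iwexp) * cauchyw x))).
  apply: le_Rintegral => //; first exact: integrable_normc.
  by move=> x _; exact: ift_cauchy.
by rewrite RintegralZl// ec le_eqVlt; apply/orP; left; apply/eqP; ring.
Qed.

End directional.

(** * Calculus of symbols *)

Section cderive.
Variable R : realType.
Local Open Scope complex_scope.
Implicit Types (f g : R -> R[i]) (t : R).

Definition is_cderive t f (df : R[i]) : Prop :=
  is_derive t 1 (fun s => cre (f s)) (cre df) /\
  is_derive t 1 (fun s => cim (f s)) (cim df).

Lemma is_cderive_eq t f df df' : is_cderive t f df -> df = df' -> is_cderive t f df'.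
Proof. by move=> h <-. Qed.

Lemma is_cderive_cst t (c : R[i]) : is_cderive t (fun=> c) 0.
Proof. by split; exact: is_derive_cst. Qed.

Lemma is_cderiveD t f g df dg : is_cderive t f df -> is_cderive t g dg ->
  is_cderive t (fun s => f s + g s) (df + dg).
Proof.
move=> [f1 f2] [g1 g2]; split.
  under eq_fun do rewrite reD; rewrite reD; exact: is_deriveD.
under eq_fun do rewrite imD; rewrite imD; exact: is_deriveD.
Qed.

Lemma is_cderiveM t f g df dg : is_cderive t f df -> is_cderive t g dg ->
  is_cderive t (fun s => f s * g s) (df * g t + f t * dg).
Proof.
move=> [f1 f2] [g1 g2]; split.
  under eq_fun do rewrite reM.
  by apply: is_derive_eq; rewrite /GRing.scale /= !cE; ring.
under eq_fun do rewrite imM.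
by apply: is_derive_eq; rewrite /GRing.scale /= !cE; ring.
Qed.

Lemma is_cderiveZ t (c : R[i]) f df : is_cderive t f df ->
  is_cderive t (fun s => c * f s) (c * df).
Proof.
move=> fd; apply: is_cderive_eq (is_cderiveM (is_cderive_cst t c) fd) _.
by rewrite mul0r add0r.
Qed.

Lemma is_cderive_id t : is_cderive t (fun s => s%:C) 1.
Proof. by split => /=; [exact: is_derive_id|exact: is_derive_cst]. Qed.

Lemma is_cderive_cexp t f df : is_cderive t f df ->
  is_cderive t (fun s => cexp (f s)) (df * cexp (f t)).
Proof.
move=> [f1 f2].
have e1 := is_derive1_comp (is_derive_expR _) f1.
have c1 := is_derive1_comp (is_derive_cos _) f2.
have s1 := is_derive1_comp (is_derive_sin _) f2.
split.
  under eq_fun do rewrite re_cexp.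
  by apply: is_derive_eq; rewrite /GRing.scale /= reM re_cexp im_cexp; ring.
under eq_fun do rewrite im_cexp.
by apply: is_derive_eq; rewrite /GRing.scale /= imM re_cexp im_cexp; ring.
Qed.

Lemma is_cderive_sum (I : Type) (r : seq I) (F : I -> R -> R[i]) (dF : I -> R[i]) t :
  (forall i, is_cderive t (F i) (dF i)) ->
  is_cderive t (fun s => \sum_(i <- r) F i s) (\sum_(i <- r) dF i).
Proof.
move=> Fd; elim: r => [|i r IH].
  by under eq_fun do rewrite big_nil; rewrite big_nil; exact: is_cderive_cst.
by under eq_fun do rewrite big_cons; rewrite big_cons; exact: is_cderiveD.
Qed.

End cderive.

(** * Taylor remainders of the exponential *)

Section exp_remainder.
Variable R : realType.
Local Open Scope complex_scope.

Definition exp_trunc (k : nat) (z : R[i]) : R[i] :=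
  \sum_(i < k) ((i`!%:R : R)^-1)%:C * z ^+ i.

Definition exp_rem (k : nat) (z : R[i]) : R[i] := cexp z - exp_trunc k z.

Lemma exp_rem0 z : exp_rem 0 z = cexp z.
Proof. by rewrite /exp_rem /exp_trunc big_ord0 subr0. Qed.

Lemma exp_truncS k z : exp_trunc k.+1 z = exp_trunc k z + ((k`!%:R : R)^-1)%:C * z ^+ k.
Proof. by rewrite /exp_trunc big_ord_recr. Qed.

Lemma exp_rem_at0 k : exp_rem k.+1 0 = 0.
Proof.
rewrite /exp_rem /exp_trunc cexp0 big_ord_recl/= expr0 mulr1 fact0 invr1.
by rewrite big1 ?addr0 ?subrr// => i _; rewrite exprS mul0r mulr0.
Qed.

Lemma is_cderive_exp_trunc k f df (t : R) : is_cderive t f df ->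
  is_cderive t (fun s => exp_trunc k (f s)) (df * exp_trunc k.-1 (f t)).
Proof.
move=> fd; have fX (i : nat) : is_cderive t (fun s => f s ^+ i) (i%:R * f t ^+ i.-1 * df).
  elim: i => [|i IH].
    under eq_fun do rewrite expr0.
    by apply: is_cderive_eq (is_cderive_cst _ _) _; rewrite !mul0r.
  under eq_fun do rewrite exprS.
  apply: is_cderive_eq (is_cderiveM fd IH) _.
  case: i {IH} => [|i] /=; first by ring.
  by rewrite -[i.+2%:R]natr1 exprS; ring.
apply: is_cderive_eq.
  apply: (is_cderive_sum (index_enum 'I_k)) => i.
  exact: (is_cderiveZ _ (fX i)).
case: k => [|k]; first by rewrite /exp_trunc !big_ord0 mulr0.
rewrite /= big_ord_recl/= !mul0r mulr0 add0r /exp_trunc mulr_sumr.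
apply: eq_bigr => i _; rewrite /bump /= add1n.
have E : ((i.+1`!%:R : R)^-1)%:C * i.+1%:R = ((i`!%:R : R)^-1)%:C.
  have -> : (i.+1%:R : R[i]) = (i.+1%:R : R)%:C by rewrite rmorph_nat.
  rewrite -rcM factS natrM invfM mulrAC mulVf ?mul1r// pnatr_eq0//.
by rewrite -E; ring.
Qed.

Lemma is_cderive_exp_rem k f df (t : R) : is_cderive t f df ->
  is_cderive t (fun s => exp_rem k (f s)) (df * exp_rem k.-1 (f t)).
Proof.
move=> fd; have h := is_cderiveD (is_cderive_cexp fd)
  (is_cderiveZ (-1) (is_cderive_exp_trunc k fd)).
rewrite (_ : (fun s => exp_rem k (f s)) =
    (fun s => cexp (f s) + -1 * exp_trunc k (f s))); last first.
  by apply/funext => s; rewrite /exp_rem mulN1r.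
by apply: (is_cderive_eq h); rewrite /exp_rem; ring.
Qed.

Lemma derive_nonneg_le (F dF : R -> R) (t : R) : 0 <= t ->
  (forall s : R, is_derive s 1 F (dF s)) -> (forall s, 0 <= s <= t -> 0 <= dF s) ->
  F 0 <= F t.
Proof.
rewrite le_eqVlt => /predU1P[<-//|t0] Fd dF0.
have cf : {within `[0, t], continuous F}.
  apply: continuous_subspaceT => s.
  by apply/differentiable_continuous/derivable1_diffP; case: (Fd s).
have [c /[!in_itv]/= /andP[c0 ct] E] := MVT t0 (fun s _ => Fd s) cf.
by rewrite -subr_ge0 E mulr_ge0 ?subr0 ?(ltW t0)// dF0// !ltW.
Qed.

Lemma is_derive_pow (f : R -> R) (df s : R) n : is_derive s 1 f df ->
  is_derive s 1 (fun s => f s ^+ n.+1) (n.+1%:R * f s ^+ n * df).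
Proof.
move=> fd; elim: n => [|n IH].
  under eq_fun do rewrite expr1; by rewrite expr0 !mul1r.
under eq_fun do rewrite exprS.
by apply: is_derive_eq; rewrite /GRing.scale /= -[n.+2%:R]natr1 !exprS; ring.
Qed.

Lemma exp_monomial_le (k : nat) (x : R) : 0 <= x -> (k`!%:R : R)^-1 * x ^+ k <= expR x.
Proof.
elim: k x => [|k IH] x x0.
  by rewrite expr0 mulr1 fact0 invr1 -expR0 ler_expR.
pose F s := expR s - (k.+1`!%:R : R)^-1 * s ^+ k.+1.
have Fd (s : R) : is_derive s 1 F (expR s - (k`!%:R : R)^-1 * s ^+ k).
  have x1 := is_derive_pow k (is_derive_id s (1 : R)).
  rewrite /F; apply: is_derive_eq; rewrite /GRing.scale /= ?mulr1 factS natrM.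
  by field; rewrite nat1r !pnatr_eq0 -lt0n fact_gt0.
have := @derive_nonneg_le F _ x x0 Fd; rewrite /F expR0 expr0n/= mulr0 subr0 => h.
rewrite -subr_ge0; apply: (le_trans ler01); apply: h => s /andP[s0 _].
by rewrite subr_ge0 IH.
Qed.

(** Integrating the bound for one remainder along the segment from 0 gives the
    bound for the next. *)
Lemma exp_rem_bound k (z : R[i]) (t : R) : 0 <= t ->
  normc (exp_rem k (t%:C * z)) <=
    (k`!%:R : R)^-1 * (t * normc z) ^+ k * expR (t * normc z).
Proof.
elim: k t => [|k IH] t t0.
  rewrite exp_rem0 normc_cexp expr0 fact0 invr1 !mul1r ler_expR reZ.
  by rewrite ler_wpM2l// (le_trans (ler_norm _))// re_le_normc.
set v := exp_rem k.+1 (t%:C * z).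
have [v0|v0] := eqVneq (normc v) 0.
  by rewrite v0 !mulr_ge0 ?invr_ge0 ?exprn_ge0 ?mulr_ge0 ?cnorm_ge0 ?expR_ge0.
pose N := normc z; have N0 : 0 <= N := cnorm_ge0 z.
(* The conjugate phase of the remainder at the end point: it turns the modulus
   there into a real part, to which monotonicity applies. *)
pose w := ((normc v)^-1)%:C * conjc v.
have w1 : normc w = 1.
  by rewrite normcM normc_conj normc_rc ger0_norm ?invr_ge0 ?cnorm_ge0// mulVf.
pose G s := (k.+1`!%:R : R)^-1 * (s * N) ^+ k.+1 * expR (s * N).
pose F s := G s - cre (w * exp_rem k.+1 (s%:C * z)).
have zd (s : R) : is_cderive s (fun s => s%:C * z) z.
  under eq_fun do rewrite mulrC; apply: is_cderive_eq (is_cderiveZ z (is_cderive_id s)) _.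
  by rewrite mulr1.
have Nd (s : R) : is_derive s 1 (fun s : R => s * N) N.
  by apply: is_derive_eq; rewrite /GRing.scale /=; ring.
have Gd (s : R) : is_derive s 1 G (N * ((k`!%:R : R)^-1 * (s * N) ^+ k * expR (s * N)) + N * G s).
  have e1 := is_derive1_comp (is_derive_expR _) (Nd s).
  have x1 := is_derive_pow k (Nd s).
  rewrite /G; apply: is_derive_eq; rewrite /GRing.scale /= exprS factS natrM.
  by field; rewrite nat1r !pnatr_eq0 -lt0n fact_gt0.
have Fd (s : R) : is_derive s 1 F (N * ((k`!%:R : R)^-1 * (s * N) ^+ k * expR (s * N)) + N * G s
    - cre (w * (z * exp_rem k (s%:C * z)))).
  have [r1 _] := is_cderiveZ w (is_cderive_exp_rem k.+1 (zd s)).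
  exact: is_deriveB.
have := @derive_nonneg_le F _ t t0 Fd.
have -> : F 0 = 0.
  have z0 : (0 : R)%:C * z = 0 by rewrite (_ : (0 : R)%:C = 0) ?mul0r.
  by rewrite /F /G z0 exp_rem_at0 mulr0 exprS !mul0r mulr0 mul0r /= subr0.
rewrite /F subr_ge0.
have -> : cre (w * exp_rem k.+1 (t%:C * z)) = normc v.
  by rewrite -/v /w -mulrA mulc_conj -rcM /= expr2 mulrA mulVf// mul1r.
apply => s /andP[s0 st].
have G0 : 0 <= N * G s.
  by rewrite /G !mulr_ge0 ?invr_ge0 ?exprn_ge0 ?mulr_ge0 ?expR_ge0.
rewrite subr_ge0 (le_trans (ler_norm _))// (le_trans (re_le_normc _))//.
rewrite normcM w1 mul1r normcM -/N; apply: ler_wpDr => //.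
by rewrite ler_wpM2l// IH.
Qed.

Lemma exp_rem_bound1 k (y : R) (z : R[i]) : `|y| <= 1 ->
  normc (exp_rem k (y%:C * z)) <= `|y| ^+ k * expR (2 * normc z).
Proof.
move=> y1.
have [z' [zz' <-]] : exists z', normc z' = normc z /\ `|y|%:C * z' = y%:C * z.
  have [y0|y0] := ger0P y; first by exists z.
  by exists (- z); rewrite normcN rmorphN mulrNN.
have y0 : 0 <= `|y| by [].
rewrite -zz'; apply: (le_trans (exp_rem_bound k z' y0)).
rewrite exprMn mulrCA -mulrA ler_wpM2l ?exprn_ge0//.
rewrite (_ : 2 * normc z' = normc z' + normc z'); last by ring.
rewrite expRD ler_pM ?expR_ge0 ?mulr_ge0 ?invr_ge0 ?exprn_ge0 ?cnorm_ge0//.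
  by rewrite exp_monomial_le ?cnorm_ge0.
by rewrite ler_expR ler_piMl ?cnorm_ge0.
Qed.

End exp_remainder.

Section symbol_calculus.
Variable R : realType.
Local Open Scope complex_scope.
Variable m : nat.
Local Notation V := (borelV R m).
Local Notation e_ j := (delta_mx ord0 j : 'rV[R]_m).
Implicit Types (a b q : 'rV[R]_m -> R[i]) (j : 'I_m) (E B : 'rV[R]_m -> R).

Lemma dderivD j a a' b b' : dderiv j a a' -> dderiv j b b' ->
  dderiv j (fun u => a u + b u) (fun u => a' u + b' u).
Proof. by move=> da db u t; exact: (is_cderiveD (da u t) (db u t)). Qed.

Lemma dderivM j a a' b b' : dderiv j a a' -> dderiv j b b' ->
  dderiv j (fun u => a u * b u) (fun u => a' u * b u + a u * b' u).
Proof. by move=> da db u t; exact: (is_cderiveM (da u t) (db u t)). Qed.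

Lemma dderivZ j (c : R[i]) a a' : dderiv j a a' ->
  dderiv j (fun u => c * a u) (fun u => c * a' u).
Proof. by move=> da u t; exact: (is_cderiveZ c (da u t)). Qed.

Lemma dderiv_cst j (c : R[i]) : dderiv j (fun=> c) (fun=> 0).
Proof. by move=> u t; exact: is_cderive_cst. Qed.

Lemma dbounded_le k j E B a : dbounded k j E a -> (forall u, E u <= B u) ->
  dbounded k j B a.
Proof.
elim: k a => [|k IH] a [ma [aE h]] EB; split => //; split => //.
- by move=> u; rewrite (le_trans (aE u)).
- by move=> u; rewrite (le_trans (aE u)).
- by case: h => a' [da ha']; exists a'; split => //; exact: IH.
Qed.

Lemma dbounded_pred k j E a : dbounded k.+1 j E a -> dbounded k j E a.
Proof.
elim: k a => [|k IH] a [ma [aE [a' [da ha']]]]; split => //; split => //.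
by exists a'; split => //; exact: IH.
Qed.

Lemma dboundedD k j E B a b : dbounded k j E a -> dbounded k j B b ->
  dbounded k j (fun u => E u + B u) (fun u => a u + b u).
Proof.
elim: k a b => [|k IH] a b [ma [aE ha]] [mb [bB hb]]; split => //; try exact: cmeasurableD.
- by split => // u; rewrite (le_trans (le_normcD _ _))// lerD.
- split; first by move=> u; rewrite (le_trans (le_normcD _ _))// lerD.
  case: ha hb => a' [da ha'] [b' [db hb']]; exists (fun u => a' u + b' u).
  by split; [exact: dderivD|exact: IH].
Qed.

Lemma dboundedZ k j E (c : R[i]) a : dbounded k j E a ->
  dbounded k j (fun u => normc c * E u) (fun u => c * a u).
Proof.
elim: k a => [|k IH] a [ma [aE ha]]; split; try exact: (cmeasurableM (cmeasurable_cst _ c) ma).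
- by split => // u; rewrite normcM ler_wpM2l ?cnorm_ge0.
- split; first by move=> u; rewrite normcM ler_wpM2l ?cnorm_ge0.
  by case: ha => a' [da ha']; exists (fun u => c * a' u); split; [exact: dderivZ|exact: IH].
Qed.

Lemma dboundedM k j E B a b : dbounded k j E a -> dbounded k j B b ->
  dbounded k j (fun u => 2 ^+ k * (E u * B u)) (fun u => a u * b u).
Proof.
elim: k E B a b => [|k IH] E B a b ha hb.
  case: ha hb => [ma [aE _]] [mb [bB _]]; split; first exact: cmeasurableM.
  by split => // u; rewrite expr0 mul1r normcM ler_pM ?cnorm_ge0.
have [ha1 hb1] := (dbounded_pred ha, dbounded_pred hb).
case: ha hb => [ma [aE [a' [da ha']]]] [mb [bB [b' [db hb']]]].
have E0 u : 0 <= E u by exact: le_trans (cnorm_ge0 _) (aE u).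
have B0 u : 0 <= B u by exact: le_trans (cnorm_ge0 _) (bB u).
split; first exact: cmeasurableM.
split.
  move=> u; rewrite normcM; apply: (@le_trans _ _ (E u * B u)).
    by rewrite ler_pM ?cnorm_ge0.
  by rewrite ler_peMl ?mulr_ge0// exprn_ege1// ler1n.
exists (fun u => a' u * b u + a u * b' u); split; first exact: dderivM.
apply: (dbounded_le (dboundedD (IH _ _ _ _ ha' hb1) (IH _ _ _ _ ha1 hb'))).
by move=> u; rewrite exprS le_eqVlt; apply/orP; left; apply/eqP; ring.
Qed.

Lemma dbounded_cst k j (c : R[i]) : dbounded k j (fun=> normc c) (fun=> c).
Proof.
elim: k c => [|k IH] c; split; try exact: cmeasurable_cst; split => //.
exists (fun=> 0); split; first exact: dderiv_cst.
apply: (dbounded_le (IH 0)) => u; rewrite normc0; exact: cnorm_ge0.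
Qed.

(** Each derivative of [p * exp q] is again of this form, with [p] replaced by
    [p' + p * q']. *)
Lemma dbounded_cexp k j E B q q' (Q : 'rV[R]_m -> R) p : cmeasurable (q : V -> R[i]) ->
  dderiv j q q' -> dbounded k j Q q' -> (forall u, 1 <= Q u) ->
  (forall u, normc (cexp (q u)) <= E u) -> dbounded k j B p ->
  dbounded k j (fun u => 2 ^+ (k * k) * (E u * (B u * Q u ^+ k))) (fun u => p u * cexp (q u)).
Proof.
move=> mq dq + Q1 qE; elim: k B p => [|k IH] B p hq hp.
  case: hp => [mp [pB _]]; split; first exact: (cmeasurableM mp (cmeasurable_cexp mq)).
  split => // u; rewrite !expr0 mul1r mulr1 normcM mulrC ler_pM ?cnorm_ge0//.
have hq1 := dbounded_pred hq; have hp1 := dbounded_pred hp.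
case: hp => [mp [pB [p' [dp hp']]]].
have E0 u : 0 <= E u by exact: le_trans (cnorm_ge0 _) (qE u).
have B0 u : 0 <= B u by exact: le_trans (cnorm_ge0 _) (pB u).
have Q0 u : 0 <= Q u by exact: le_trans ler01 (Q1 u).
split; first exact: (cmeasurableM mp (cmeasurable_cexp mq)).
split.
  move=> u; rewrite normcM mulrC; apply: (@le_trans _ _ (E u * B u)).
    by rewrite ler_pM ?cnorm_ge0.
  apply: (@le_trans _ _ (E u * (B u * Q u ^+ k.+1))).
    by rewrite ler_wpM2l// ler_peMr// exprn_ege1.
  by rewrite ler_peMl ?mulr_ge0 ?exprn_ge0// exprn_ege1// ler1n.
exists (fun u => (p' u + p u * q' u) * cexp (q u)); split.
  move=> u t; have := is_cderiveM (dp u t) (is_cderive_cexp (dq u t)).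
  by move=> /is_cderive_eq; apply; ring.
have h := dboundedD hp' (dboundedM hp1 hq1).
apply: (dbounded_le (IH _ _ hq1 h)) => u.
rewrite (_ : (k.+1 * k.+1 = k * k + (k + k.+1))%N); last by rewrite mulSn mulnS; ring.
rewrite exprD -[leRHS]mulrA ler_wpM2l ?exprn_ge0// [leRHS]mulrCA ler_wpM2l//.
rewrite [Q u ^+ k.+1]exprS !mulrA ler_wpM2r ?exprn_ge0// -!mulrA.
have k1 : 1 <= 2 ^+ k :> R by rewrite exprn_ege1// ler1n.
apply: (@le_trans _ _ (2 ^+ k * (B u * Q u) + 2 ^+ k * (B u * Q u))).
  rewrite lerD2r; apply: (@le_trans _ _ (1 * (B u * 1))); first by rewrite mul1r mulr1.
  by apply: ler_pM => //; rewrite ?mulr1// ler_peMr.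
rewrite (_ : _ + _ = 2 ^+ k.+1 * (B u * Q u)); last by rewrite exprS; ring.
rewrite exprD -!mulrA; apply: ler_peMl => //.
by rewrite !mulr_ge0 ?exprn_ge0.
Qed.

(** The exponents that displacements of a complex point produce. *)
Definition lin (c : 'I_m -> R[i]) (u : 'rV[R]_m) : R[i] := \sum_i c i * (u ord0 i)%:C.

Lemma lin_le c u : (forall i, normc (c i) <= 1) -> normc (lin c u) <= l1 u.
Proof.
move=> c1; rewrite /lin (le_trans (normc_sum _ _ _))//; apply: ler_sum => i _.
by rewrite normcM normc_rc ler_piMl.
Qed.

Lemma linD c u v : lin c (u + v) = lin c u + lin c v.
Proof.
rewrite /lin -big_split; apply: eq_bigr => i _ /=.
by rewrite mxE rmorphD mulrDr.
Qed.

Lemma linZ c t u : lin c (t *: u) = t%:C * lin c u.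
Proof.
rewrite /lin mulr_sumr; apply: eq_bigr => i _ /=.
by rewrite mxE rmorphM mulrCA.
Qed.

Lemma lin_delta c j : lin c (e_ j) = c j.
Proof.
rewrite /lin (bigD1 j)//= mxE !eqxx mulr1 big1 ?addr0// => i ij.
by rewrite mxE (negbTE ij) andbF mulr0.
Qed.

Lemma cmeasurable_lin c : cmeasurable (lin c : V -> R[i]).
Proof.
apply: cmeasurable_sum => i; apply: cmeasurableM; first exact: cmeasurable_cst.
exact: (cmeasurable_rc (measurable_coord i)).
Qed.

Lemma is_cderive_lin c (z : R[i]) u j t :
  is_cderive t (fun s => z * lin c (u + s *: e_ j)) (z * c j).
Proof.
apply: is_cderiveZ.
have h := is_cderiveD (is_cderive_cst t (lin c u)) (is_cderiveZ (c j) (is_cderive_id t)).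
rewrite (_ : (fun s => _) = (fun s => lin c u + c j * s%:C)).
  by apply: (is_cderive_eq h); rewrite add0r mulr1.
by apply/funext => s; rewrite linD linZ lin_delta mulrC.
Qed.

Lemma dderiv_lin c j : dderiv j (lin c) (fun=> c j).
Proof.
move=> u t; have := is_cderive_lin c 1 u j t; rewrite mul1r.
by under eq_fun do rewrite mul1r.
Qed.

Lemma cmeasurable_exp_rem d (T : measurableType d) k (f : T -> R[i]) : cmeasurable f ->
  cmeasurable (fun x => exp_rem k (f x)).
Proof.
move=> mf; rewrite /exp_rem /exp_trunc.
under eq_fun do rewrite -mulN1r; apply: cmeasurableD; first exact: cmeasurable_cexp.
apply: cmeasurableM; first exact: cmeasurable_cst.
apply: cmeasurable_sum => i; apply: cmeasurableM; first exact: cmeasurable_cst.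
elim: (nat_of_ord i) => [|n IH].
  by under eq_fun do rewrite expr0; exact: cmeasurable_cst.
by under eq_fun do rewrite exprS; exact: cmeasurableM.
Qed.

(** A derivative lowers the order of the remainder by one and brings out a factor
    [y], so that all derivatives keep the same power of [y]. *)
Lemma dbounded_exp_rem K j c (k : nat) (y : R) : (forall i, normc (c i) <= 1) -> `|y| <= 1 ->
  dbounded K j (fun u => `|y| ^+ k * expR (2 * l1 u)) (fun u => exp_rem k (y%:C * lin c u)).
Proof.
move=> c1 y1.
have mr k' : cmeasurable (fun u : V => exp_rem k' (y%:C * lin c u)).
  apply: cmeasurable_exp_rem; apply: cmeasurableM; first exact: cmeasurable_cst.
  exact: cmeasurable_lin.
have br k' u : normc (exp_rem k' (y%:C * lin c u)) <= `|y| ^+ k' * expR (2 * l1 u).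
  rewrite (le_trans (exp_rem_bound1 _ _ y1))// ler_wpM2l ?exprn_ge0// ler_expR.
  by rewrite ler_wpM2l// lin_le.
elim: K k => [|K IH] k; split => //; split => //.
exists (fun u => (y%:C * c j) * exp_rem k.-1 (y%:C * lin c u)); split.
  by move=> u t; exact: (is_cderive_exp_rem k (is_cderive_lin c _ u j t)).
apply: (dbounded_le (dboundedZ (y%:C * c j) (IH k.-1))) => u.
rewrite mulrA ler_wpM2r ?expR_ge0// normcM normc_rc.
apply: (@le_trans _ _ (`|y| * `|y| ^+ k.-1)).
  by rewrite ler_wpM2r ?exprn_ge0// ler_piMr.
by case: k => [|k] /=; rewrite ?expr0 ?mulr1// exprS.
Qed.

Lemma ccvgM (u v : nat -> R[i]) (l c : R[i]) : ccvg u l -> ccvg v c ->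
  ccvg (fun n => u n * v n) (l * c).
Proof.
move=> ul vc; apply: ccvg_reim; rewrite ?reM ?imM.
  under eq_fun do rewrite reM.
  by apply: cvgB; apply: cvgM; (exact: ccvg_re || exact: ccvg_im).
under eq_fun do rewrite imM.
by apply: cvgD; apply: cvgM; (exact: ccvg_re || exact: ccvg_im).
Qed.

Lemma ccvg_cexp (u : nat -> R[i]) (l : R[i]) : ccvg u l ->
  ccvg (fun n => cexp (u n)) (cexp l).
Proof.
move=> ul.
have er := cvg_comp _ _ (ccvg_re ul) (@continuous_expR R (cre l)).
have ec := cvg_comp _ _ (ccvg_im ul) (@continuous_cos R (cim l)).
have es := cvg_comp _ _ (ccvg_im ul) (@continuous_sin R (cim l)).
apply: ccvg_reim.
  by rewrite re_cexp; under eq_fun do rewrite re_cexp; exact: cvgM.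
by rewrite im_cexp; under eq_fun do rewrite im_cexp; exact: cvgM.
Qed.

Lemma rcont_cst (c : R[i]) : rcont (fun _ : 'rV[R]_m => c).
Proof. by move=> u z; exact: ccvg_cst. Qed.

Lemma rcontD a b : rcont a -> rcont b -> rcont (fun u => a u + b u).
Proof. by move=> ca cb u z; exact: ccvgD. Qed.

Lemma rcontM a b : rcont a -> rcont b -> rcont (fun u => a u * b u).
Proof. by move=> ca cb u z; exact: ccvgM. Qed.

Lemma rcont_cexp a : rcont a -> rcont (fun u => cexp (a u)).
Proof. by move=> ca u z; exact: ccvg_cexp. Qed.

Lemma rcont_sum (I : Type) (r : seq I) (F : I -> 'rV[R]_m -> R[i]) :
  (forall i, rcont (F i)) -> rcont (fun u => \sum_(i <- r) F i u).
Proof. by move=> cF u z; apply: ccvg_sum => i; exact: cF. Qed.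

Lemma rcont_lin c : rcont (lin c).
Proof.
move=> u z.
have h : ccvg (fun n => (inv_nat R n)%:C * lin c z + lin c u) (0%:C * lin c z + lin c u).
  apply: ccvgD; last exact: ccvg_cst.
  apply: ccvgM; last exact: ccvg_cst.
  by apply: ccvg_rc; exact: cvg_inv_nat.
rewrite (_ : (fun n => lin c _) = (fun n => (inv_nat R n)%:C * lin c z + lin c u)).
  by rewrite (_ : 0%:C = 0) // mul0r add0r in h.
by apply/funext => n; rewrite linD linZ.
Qed.

Lemma rcont_exp_rem k a : rcont a -> rcont (fun u => exp_rem k (a u)).
Proof.
move=> ca; rewrite /exp_rem /exp_trunc; under eq_fun do rewrite -mulN1r.
apply: rcontD; first exact: rcont_cexp.
apply: rcontM; first exact: rcont_cst.
apply: rcont_sum => i; apply: rcontM; first exact: rcont_cst.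
elim: (nat_of_ord i) => [|n IH].
  by under eq_fun do rewrite expr0; exact: rcont_cst.
by under eq_fun do rewrite exprS; exact: rcontM.
Qed.

End symbol_calculus.

(** * Symbols with exponential weights *)

Section symbol_class.
Variable R : realType.
Local Open Scope complex_scope.
Variable m : nat.
Local Notation V := (borelV R m).
Local Notation mu := (lebesgueV R m).
Local Notation e_ j := (delta_mx ord0 j : 'rV[R]_m).
Implicit Types (a b : 'rV[R]_m -> R[i]) (j : 'I_m) (kap D : R).

(** Growth of order [exp (kap * l1)], together with the [2 m] pure derivatives
    that control the L^1 norm of the Fourier transform. *)
Definition sym D kap a : Prop :=
  [/\ cmeasurable (a : V -> R[i]), rcont a,
      forall u, normc (a u) <= D * expR (kap * l1 u) &
      forall j, dbounded (2 * m) j (fun u => D * expR (kap * l1 u)) a].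

Lemma sym_le D D' kap kap' a : sym D kap a -> D <= D' -> kap <= kap' -> sym D' kap' a.
Proof.
move=> [ma ca aB da] DD kk.
have D0 : 0 <= D.
  by have := le_trans (cnorm_ge0 _) (aB 0); rewrite pmulr_lge0// expR_gt0.
have le (u : 'rV[R]_m) : D * expR (kap * l1 u) <= D' * expR (kap' * l1 u).
  by rewrite ler_pM ?expR_ge0// ler_expR ler_wpM2r// l1_ge0.
split => //; first by move=> u; rewrite (le_trans (aB u)).
by move=> j; exact: dbounded_le (da j) le.
Qed.

Lemma sym_ge0 D kap a : sym D kap a -> 0 <= D.
Proof.
move=> [_ _ aB _].
by have := le_trans (cnorm_ge0 _) (aB 0); rewrite pmulr_lge0// expR_gt0.
Qed.

Lemma symD D D' kap a b : sym D kap a -> sym D' kap b ->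
  sym (D + D') kap (fun u => a u + b u).
Proof.
move=> [ma ca aB da] [mb cb bB db]; split.
- exact: cmeasurableD.
- exact: rcontD.
- by move=> u; rewrite mulrDl (le_trans (le_normcD _ _))// lerD.
- move=> j; apply: (dbounded_le (dboundedD (da j) (db j))) => u.
  by rewrite -mulrDl.
Qed.

Lemma symZ D kap (c : R[i]) a : sym D kap a -> sym (normc c * D) kap (fun u => c * a u).
Proof.
move=> [ma ca aB da]; split.
- exact: (cmeasurableM (cmeasurable_cst _ c) ma).
- exact: (rcontM (rcont_cst c) ca).
- by move=> u; rewrite normcM -mulrA ler_wpM2l ?cnorm_ge0.
- move=> j; apply: (dbounded_le (dboundedZ c (da j))) => u.
  by rewrite mulrA.
Qed.

Lemma symN D kap a : sym D kap a -> sym D kap (fun u => - a u).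
Proof.
move=> /(symZ (-1)); under eq_fun do rewrite mulN1r.
by rewrite normcN (_ : (1 : R[i]) = 1%:C) // normc_rc normr1 mul1r.
Qed.

Lemma symB D D' kap a b : sym D kap a -> sym D' kap b ->
  sym (D + D') kap (fun u => a u - b u).
Proof. by move=> sa /symN; exact: symD. Qed.

Lemma symM D D' kap kap' a b : sym D kap a -> sym D' kap' b ->
  sym (2 ^+ (2 * m) * (D * D')) (kap + kap') (fun u => a u * b u).
Proof.
move=> sa sb; have D0 := sym_ge0 sa; have D0' := sym_ge0 sb.
move: sa sb => [ma ca aB da] [mb cb bB db].
have E (u : 'rV[R]_m) : 2 ^+ (2 * m) * (D * expR (kap * l1 u) * (D' * expR (kap' * l1 u))) =
    2 ^+ (2 * m) * (D * D') * expR ((kap + kap') * l1 u).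
  by rewrite mulrDl expRD; ring.
split.
- exact: cmeasurableM.
- exact: rcontM.
- move=> u; rewrite -E normcM; apply: (@le_trans _ _ (D * expR (kap * l1 u) * (D' * expR (kap' * l1 u)))).
    by rewrite ler_pM ?cnorm_ge0.
  by rewrite ler_peMl ?mulr_ge0 ?expR_ge0// exprn_ege1// ler1n.
- move=> j; apply: (dbounded_le (dboundedM (da j) (db j))) => u.
  by rewrite E.
Qed.

Lemma sym_cst (c : R[i]) : sym (normc c) 0 (fun=> c).
Proof.
split; [exact: cmeasurable_cst|exact: rcont_cst| |].
  by move=> u; rewrite mul0r expR0 mulr1.
by move=> j; apply: (dbounded_le (dbounded_cst _ j c)) => u; rewrite mul0r expR0 mulr1.
Qed.

Lemma sym_exp_rem c (k : nat) (y : R) : (forall i, normc (c i) <= 1) -> `|y| <= 1 ->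
  sym (`|y| ^+ k) 2 (fun u : 'rV[R]_m => exp_rem k (y%:C * lin c u)).
Proof.
move=> c1 y1; split.
- apply: cmeasurable_exp_rem; apply: cmeasurableM; first exact: cmeasurable_cst.
  exact: cmeasurable_lin.
- by apply: rcont_exp_rem; apply: rcontM; [exact: rcont_cst|exact: rcont_lin].
- move=> u; rewrite (le_trans (exp_rem_bound1 _ _ y1))// ler_wpM2l ?exprn_ge0// ler_expR.
  by rewrite ler_wpM2l// lin_le.
- by move=> j; exact: dbounded_exp_rem.
Qed.

Lemma sym_lin c : (forall i, normc (c i) <= 1) -> sym 2 2 (lin c : 'rV[R]_m -> R[i]).
Proof.
move=> c1; have one : `|1 : R| <= 1 by rewrite normr1.
have := symB (sym_exp_rem 1 c1 one) (sym_exp_rem 2 c1 one).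
rewrite normr1 !expr1n (_ : 1 + 1 = 2 :> R)// => h.
rewrite (_ : lin c = fun u => exp_rem 1 (1%:C * lin c u) - exp_rem 2 (1%:C * lin c u))//.
apply/funext => u; rewrite /exp_rem (exp_truncS 1) rmorph1 !mul1r.
by rewrite (_ : 1`! = 1%N)// invr1 rmorph1 expr1; ring.
Qed.

End symbol_class.

(** * The Gaussian symbol *)

Section gaussian_symbol.
Variable R : realType.
Local Open Scope complex_scope.
Variable m : nat.
Local Notation V := (borelV R m).
Local Notation e_ j := (delta_mx ord0 j : 'rV[R]_m).
Implicit Types (f : 'rV[R]_m -> R[i]) (j : 'I_m) (u : 'rV[R]_m).

Lemma enorm_sqr u : enorm u ^+ 2 = \sum_i u ord0 i ^+ 2.
Proof.
rewrite /enorm sqr_sqrtr; first by apply: eq_bigr => i _; rewrite expr2.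
by apply: sumr_ge0 => i _; rewrite -expr2 sqr_ge0.
Qed.

Lemma enorm_sqr_le u : enorm u ^+ 2 + 1 <= 3 * expR (l1 u).
Proof.
have h : enorm u ^+ 2 <= l1 u ^+ 2.
  rewrite enorm_sqr expr2 /l1 big_distrl /=; apply: ler_sum => i _.
  rewrite -real_normK ?num_real// expr2 ler_wpM2l//.
  by rewrite (bigD1 i)//= lerDl sumr_ge0.
have := exp_monomial_le 2 (l1_ge0 u); rewrite (_ : 2`! = 2%N)// => h2.
have h3 : 1 <= expR (l1 u) by rewrite -expR0 ler_expR l1_ge0.
lra.
Qed.

Lemma is_derive_line (f : 'rV[R]_m -> R) u v (t : R) :
  derivable (f : _ -> R^o) (u + t *: v) v ->
  is_derive t 1 (fun s => f (u + s *: v)) ('D_v (f : _ -> R^o) (u + t *: v)).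
Proof.
move=> df.
have E : (fun h : R => h^-1 *: (((fun s => f (u + s *: v)) \o shift t) (h *: (1 : R)) -
    f (u + t *: v))) = (fun h : R => h^-1 *: (((f : _ -> R^o) \o shift (u + t *: v)) (h *: v) -
    (f : _ -> R^o) (u + t *: v))).
  apply/funext => h /=; congr (_ *: (f _ - _)).
  by rewrite [h *: 1]mulr1 scalerDl addrCA.
by split; rewrite /derivable /derive E.
Qed.

Lemma dderiv_cpartial j f : (forall x, cderivable j f x) -> dderiv j f (cpartial j f).
Proof. by move=> df u t; have [d1 d2] := df (u + t *: e_ j); split; exact: is_derive_line. Qed.

Lemma iter_cpartial_multi j l f :
  partial_multi [ffun i => if i == j then l else 0%N] f = iter l (cpartial j) f.
Proof.
rewrite /partial_multi.
have : uniq (enum 'I_m) by exact: enum_uniq.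
have : j \in enum 'I_m by rewrite mem_enum.
elim: (enum 'I_m) => // i r IH /=; rewrite ffunE inE; case: eqVneq => [->|ij] /=.
  move=> _ /andP[jr _]; congr iter.
  elim: r jr {IH} => //= k r IH; rewrite inE negb_or => /andP[jk jr].
  by rewrite ffunE eq_sym (negbTE jk) /= IH.
by move=> jr /andP[_ ur]; exact: IH.
Qed.

Lemma cmeasurable_ccontinuous f : ccontinuous f -> cmeasurable (f : V -> R[i]).
Proof. by move=> [c1 c2]; split; exact: measurable_continuousV. Qed.

Lemma rcont_ccontinuous f : ccontinuous f -> rcont f.
Proof.
move=> [c1 c2] u z; apply: ccvg_reim.
  have := @rcvg_continuous R m _ z u c1; exact.
have := @rcvg_continuous R m _ z u c2; exact.
Qed.

Section bounds.
Variables (phi2 : 'rV[R]_m -> R[i]).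
Hypothesis sm : smooth phi2.
Hypothesis bd : forall al, exists A : R, 0 < A /\
  forall u, normc (partial_multi al phi2 u) <= A * (enorm u ^+ 2 + 1).

Lemma smooth_iter j l : ccontinuous (iter l (cpartial j) phi2) /\
  dderiv j (iter l (cpartial j) phi2) (iter l.+1 (cpartial j) phi2).
Proof.
have := sm (nseq l j); rewrite (_ : foldr _ _ _ = iter l (cpartial j) phi2).
  by move=> [c d]; split => //; apply: dderiv_cpartial => x; exact: d.
by elim: l => //= l ->.
Qed.

Lemma dbounded_iter k j l : exists2 A : R, 0 <= A &
  dbounded k j (fun u => A * expR (l1 u)) (iter l (cpartial j) phi2).
Proof.
elim: k l => [|k IH] l.
  have [A [A0 AB]] := bd [ffun i => if i == j then l else 0%N].
  exists (A * 3); first by rewrite mulr_ge0// ltW.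
  have [c d] := smooth_iter j l; split; first exact: cmeasurable_ccontinuous.
  split => // u; rewrite -iter_cpartial_multi (le_trans (AB u))// -mulrA ler_wpM2l ?(ltW A0)//.
  exact: enorm_sqr_le.
have [A A0 AB] := IH l; have [A' A0' AB'] := IH l.+1.
exists (A + A'); first exact: addr_ge0.
have [c d] := smooth_iter j l.
have [m1 b1] := dbounded_bound AB; split => //; split.
  by move=> u; rewrite (le_trans (b1 u))// ler_wpM2r ?expR_ge0// lerDl.
exists (iter l.+1 (cpartial j) phi2); split => //.
by apply: (dbounded_le AB') => u; rewrite ler_wpM2r ?expR_ge0// lerDr.
Qed.

Lemma dbounded_derivs k : exists2 A : R, 0 <= A &
  forall j, dbounded k j (fun u => A * expR (l1 u)) (cpartial j phi2).
Proof.
pose A j := sval (cid2 (dbounded_iter k j 1)).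
have A0 j : 0 <= A j by rewrite /A; case: cid2.
have AB j : dbounded k j (fun u => A j * expR (l1 u)) (cpartial j phi2).
  by rewrite /A; case: cid2.
exists (\sum_j A j); first exact: sumr_ge0.
move=> j; apply: (dbounded_le (AB j)) => u; rewrite ler_wpM2r ?expR_ge0//.
by rewrite (bigD1 j)//= lerDl sumr_ge0.
Qed.

Lemma re_phi2_le gamma : gamma < 0 ->
  (exists M : R, forall u, M <= enorm u -> cre (phi2 u) <= gamma * enorm u ^+ 2) ->
  exists C : R, forall u, cre (phi2 u) <= gamma * enorm u ^+ 2 + C.
Proof.
move=> g0 [M hM].
have [A [A0]] := bd [ffun=> 0%N].
rewrite (_ : partial_multi _ _ = phi2); last first.
  by rewrite /partial_multi; elim: (enum _) => //= i r ->; rewrite ffunE.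
move=> AB; exists (A * (M ^+ 2 + 1) - gamma * M ^+ 2) => u.
have M20 := sqr_ge0 M.
have [Mu|uM] := leP M (enorm u).
  rewrite (le_trans (hM u Mu))// lerDl; nra.
have u0 : 0 <= enorm u by exact: sqrtr_ge0.
have uM2 : enorm u ^+ 2 <= M ^+ 2 by nra.
rewrite (le_trans (ler_norm _))// (le_trans (re_le_normc _))// (le_trans (AB u))//; nra.
Qed.

End bounds.

(** The quadratic form [p x^2 - x y + r y^2] is positive definite when
    [1 < 4 p r], hence absorbs the linear terms. *)
Lemma quadratic_absorb (p r c : R) : 0 < p -> 0 < r -> 1 < 4 * (p * r) ->
  exists2 C : R, 0 <= C & forall u y : R,
    - (p * u ^+ 2) - u * y + c * `|u| + c * `|y| <= C + r * y ^+ 2.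
Proof.
move=> p0 r0 pr.
pose p' := (p + (4 * r)^-1) / 2; pose r' := (4 * p')^-1.
have i0 : 0 < (4 * r)^-1 by rewrite invr_gt0; lra.
have ip : (4 * r)^-1 < p by rewrite invf_plt ?posrE; [rewrite -div1r ltr_pdivrMr//; lra|lra|lra].
have p'0 : 0 < p' by rewrite /p'; lra.
have pp' : p' < p by rewrite /p'; lra.
have r'0 : 0 < r' by rewrite invr_gt0; lra.
have r'r : r' < r.
  rewrite /r' invf_plt ?posrE; [|lra|lra].
  have -> : r^-1 = 4 * (4 * r)^-1 by field; lra.
  rewrite /p'; lra.
have pr' : 4 * p' * r' = 1 by rewrite /r' mulfV//; lra.
have lin (e x : R) : 0 < e -> c * x <= e * x ^+ 2 + c ^+ 2 / (4 * e).
  move=> e0; rewrite -subr_ge0.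
  have -> : e * x ^+ 2 + c ^+ 2 / (4 * e) - c * x = e * (x - c / (2 * e)) ^+ 2.
    by field; lra.
  by rewrite mulr_ge0 ?sqr_ge0 ?ltW.
exists (c ^+ 2 / (4 * (p - p')) + c ^+ 2 / (4 * (r - r'))).
  by rewrite addr_ge0// divr_ge0 ?sqr_ge0//; lra.
move=> u y.
have h1 : c * `|u| <= _ := @lin (p - p') `|u| ltac:(lra).
have h2 : c * `|y| <= _ := @lin (r - r') `|y| ltac:(lra).
rewrite real_normK ?num_real// in h1; rewrite real_normK ?num_real// in h2.
have h3 : - (u * y) <= p' * u ^+ 2 + r' * y ^+ 2.
  rewrite -subr_ge0 opprK.
  have -> : p' * u ^+ 2 + r' * y ^+ 2 + u * y = p' * (u + 2 * r' * y) ^+ 2 +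
     (1 - 4 * p' * r') * (r' * y ^+ 2 + u * y) by ring.
  by rewrite pr' subrr mul0r addr0 mulr_ge0 ?sqr_ge0 ?ltW.
lra.
Qed.

Definition ecoef (Y : 'rV[R]_m) : 'I_m -> R[i] := fun i => (- Y ord0 i)%:C.

(** The factor [exp (- u . Y)] comes from [exp (i u . (X + i Y))]. *)
Definition gsym (h : R) (phi2 : 'rV[R]_m -> R[i]) (Y u : 'rV[R]_m) : R[i] :=
  cexp (h%:C * phi2 u + lin (ecoef Y) u).

Lemma re_lin_ecoef Y u : cre (lin (ecoef Y) u) = - dot u Y.
Proof.
rewrite /lin re_sum /dot -sumrN; apply: eq_bigr => i _.
by rewrite /ecoef -rcM /= mulNr mulrC.
Qed.

(** The derivatives of the exponent grow like [exp (l1 Y + l1 u)] at most, and the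
    modulus of the exponential is Gaussian in [u]. Absorbing all linear terms
    with [quadratic_absorb] leaves the exponent [|Y|^2 / (delta h)]. *)
Lemma sym_gsym (h gamma delta kap : R) phi2 : 0 < h -> gamma < 0 -> 0 < delta ->
  delta < 4 * - gamma -> smooth phi2 ->
  (forall al, exists A : R, 0 < A /\
    forall u, normc (partial_multi al phi2 u) <= A * (enorm u ^+ 2 + 1)) ->
  (exists M : R, forall u, M <= enorm u -> cre (phi2 u) <= gamma * enorm u ^+ 2) ->
  exists2 C : R, 0 <= C & forall Y,
    sym (C * expR ((delta * h)^-1 * enorm Y ^+ 2)) kap (gsym h phi2 Y).
Proof.
move=> h0 g0 d0 dg sm bd gr.
have [A A0 AB] := dbounded_derivs sm bd (2 * m).
have [C1 hC1] := re_phi2_le bd g0 gr.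
pose k := (2 * m)%N; pose Q0 := h * A + 1.
have Q01 : 1 <= Q0 by rewrite /Q0 lerDr mulr_ge0// ltW.
have [C2 C20 hC2] := @quadratic_absorb (h * - gamma) (delta * h)^-1 (k%:R + `|kap|)
  ltac:(by rewrite mulr_gt0// oppr_gt0) ltac:(by rewrite invr_gt0 mulr_gt0)
  ltac:(by rewrite (_ : 4 * _ = 4 * - gamma / delta); [rewrite ltr_pdivlMr// mul1r|field; lra]).
pose C := 2 ^+ (k * k) * Q0 ^+ k * (expR (h * C1) * expR (m%:R * C2)).
have C0 : 0 <= C by rewrite !mulr_ge0 ?exprn_ge0 ?expR_ge0// (le_trans ler01).
exists C => // Y.
have cph : ccontinuous phi2 by have [] := sm [::].
pose q u := h%:C * phi2 u + lin (ecoef Y) u.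
have mq : cmeasurable (q : V -> R[i]).
  apply: cmeasurableD; last exact: cmeasurable_lin.
  by apply: (cmeasurableM (cmeasurable_cst _ _)); exact: cmeasurable_ccontinuous.
pose E u := expR (h * (gamma * enorm u ^+ 2 + C1) - dot u Y).
have qE u : normc (cexp (q u)) <= E u.
  rewrite normc_cexp ler_expR reD reZ re_lin_ecoef lerD2r ler_wpM2l ?(ltW h0)//.
pose Q u := Q0 * expR (l1 Y + l1 u).
have Q1 u : 1 <= Q u.
  by rewrite -[leLHS]mulr1 ler_pM// -expR0 ler_expR addr_ge0 ?l1_ge0.
have key u : 2 ^+ (k * k) * (E u * (normc (1 : R[i]) * Q u ^+ k)) <=
    C * expR ((delta * h)^-1 * enorm Y ^+ 2) * expR (kap * l1 u).
  rewrite (_ : (1 : R[i]) = 1%:C) // normc_rc normr1 mul1r /Q /C exprMn.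
  rewrite -expRM_natl /E.
  rewrite [leLHS](_ : _ = 2 ^+ (k * k) * Q0 ^+ k * (expR (h * C1) *
     expR (h * gamma * enorm u ^+ 2 - dot u Y + k%:R * (l1 Y + l1 u)))); last first.
    rewrite (_ : h * (gamma * enorm u ^+ 2 + C1) - dot u Y =
      h * C1 + (h * gamma * enorm u ^+ 2 - dot u Y)); last by ring.
    by rewrite !expRD; ring.
  rewrite [leRHS](_ : _ = 2 ^+ (k * k) * Q0 ^+ k * (expR (h * C1) *
     expR (m%:R * C2 + (delta * h)^-1 * enorm Y ^+ 2 + kap * l1 u))); last first.
    by rewrite !expRD; ring.
  have Q00 : 0 <= Q0 := le_trans ler01 Q01.
  apply: ler_wpM2l; first by rewrite mulr_ge0 ?exprn_ge0.
  apply: ler_wpM2l; first exact: expR_ge0.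
  rewrite ler_expR.
  have -> : m%:R * C2 = \sum_(i < m) C2 by rewrite sumr_const card_ord mulr_natl.
  rewrite !enorm_sqr /dot /l1 !mulr_sumr -sumrN -!big_split /= !mulr_sumr -!big_split /=.
  apply: ler_sum => i _.
  have := hC2 (u ord0 i) (Y ord0 i).
  set x := u ord0 i; set y := Y ord0 i.
  have kx : - (`|kap| * `|x|) <= kap * `|x|.
    by rewrite -mulNr ler_wpM2r// lerNl -normrN ler_norm.
  have ky : 0 <= `|kap| * `|y| by rewrite mulr_ge0.
  nra.
have dq j : dderiv j q (fun u => h%:C * cpartial j phi2 u + ecoef Y j).
  apply: dderivD; last exact: dderiv_lin.
  by apply: dderivZ; have [] := smooth_iter sm j 0.
have bq j : dbounded k j Q (fun u => h%:C * cpartial j phi2 u + ecoef Y j).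
  apply: (dbounded_le (dboundedD (dboundedZ h%:C (AB j)) (dbounded_cst _ j (ecoef Y j)))) => u.
  rewrite /ecoef !normc_rc normrN (ger0_norm (ltW h0)) /Q /Q0 mulrDl mul1r mulrA.
  have e1 : expR (l1 u) <= expR (l1 Y + l1 u) by rewrite ler_expR lerDr l1_ge0.
  have e2 : `|Y ord0 j| <= expR (l1 Y + l1 u).
    have h1 : `|Y ord0 j| <= l1 Y by rewrite /l1 (bigD1 j)//= lerDl sumr_ge0.
    have h2 := expR_ge1Dx (l1 Y + l1 u); have h3 := l1_ge0 u; lra.
  by rewrite lerD// ler_wpM2l// mulr_ge0// ltW.
have bg j : dbounded k j (fun u => 2 ^+ (k * k) * (E u * (normc (1 : R[i]) * Q u ^+ k))) (gsym h phi2 Y).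
  have := dbounded_cexp mq (dq j) (bq j) Q1 qE (dbounded_cst k j 1).
  by under [X in dbounded _ _ _ X -> _]eq_fun do rewrite mul1r.
split.
- exact: cmeasurable_cexp mq.
- apply: rcont_cexp; apply: rcontD; last exact: rcont_lin.
  by apply: rcontM; [exact: rcont_cst|exact: rcont_ccontinuous].
- move=> u; apply: (le_trans _ (key u)); apply: (le_trans (qE u)).
  have e0 : 0 <= E u by exact: expR_ge0.
  rewrite (_ : (1 : R[i]) = 1%:C) // normc_rc normr1 mul1r mulrCA ler_peMr//.
  by rewrite mulr_ege1// exprn_ege1// ler1n.
- by move=> j; apply: (dbounded_le (bg j)) => u; exact: key.
Qed.

End gaussian_symbol.

(** * Linear functionals on symbols *)

Section symbol_functional.
Variable R : realType.
Local Open Scope complex_scope.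
Variable m : nat.
Implicit Types (a b : 'rV[R]_m -> R[i]) (D : R).

(** The kernel at a point, and its convolution with a bounded function at a
    point, depend on the symbol in this way; the regularity results use nothing
    else about them. *)
Definition symfun (C : R) (L : ('rV[R]_m -> R[i]) -> R[i]) : Prop :=
  [/\ forall a b D D', sym D (-1) a -> sym D' (-1) b ->
        L (fun u => a u + b u) = L a + L b,
      forall (c : R[i]) a D, sym D (-1) a -> L (fun u => c * a u) = c * L a &
      forall a D, sym D (-1) a -> normc (L a) <= C * D].

Lemma sym0 (kap : R) : sym 0 kap (fun _ : 'rV[R]_m => 0 : R[i]).
Proof.
split; [exact: cmeasurable_cst|exact: rcont_cst| |].
  by move=> u; rewrite mul0r normc0.
by move=> j; apply: (dbounded_le (dbounded_cst _ j 0)) => u; rewrite mul0r normc0.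
Qed.

Section functional.
Variables (C : R) (L : ('rV[R]_m -> R[i]) -> R[i]).
Hypothesis sL : symfun C L.

Lemma symfunB a b D D' : sym D (-1) a -> sym D' (-1) b ->
  L (fun u => a u - b u) = L a - L b.
Proof.
case: sL => LD LZ _ sa sb; rewrite -mulN1r -(LZ _ _ _ sb) -(LD _ _ _ _ sa (symZ _ sb)).
by congr (L _); apply/funext => u; rewrite mulN1r.
Qed.

Lemma symfun0 : L (fun=> 0) = 0.
Proof.
case: sL => _ LZ _; rewrite -[RHS](mul0r (L (fun=> 0))) -(LZ _ _ _ (sym0 (-1))).
by congr (L _); apply/funext => u; rewrite mul0r.
Qed.

Lemma symfun_sum (I : Type) (r : seq I) (f : I -> 'rV[R]_m -> R[i]) (D : I -> R) :
  (forall i, sym (D i) (-1) (f i)) ->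
  L (fun u => \sum_(i <- r) f i u) = \sum_(i <- r) L (f i) /\
  sym (\sum_(i <- r) D i) (-1) (fun u => \sum_(i <- r) f i u).
Proof.
move=> sf; elim: r => [|i r [IH1 IH2]].
  rewrite !big_nil; under eq_fun do rewrite big_nil.
  by split; [exact: symfun0|exact: sym0].
rewrite !big_cons; under eq_fun do rewrite big_cons.
split; last exact: symD.
by case: sL => LD _ _; rewrite (LD _ _ _ _ (sf i) IH2) IH1.
Qed.

(** The functional is applied to the second order Taylor remainder of the
    exponential, which is a symbol of size [t^2]. *)
Lemma symfun_line a D c (t : R) : sym D (-3) a -> (forall i, normc (c i) <= 1) -> `|t| <= 1 ->
  normc (L (fun u => a u * cexp (t%:C * lin c u)) - L a - t%:C * L (fun u => a u * lin c u))
    <= C * (2 ^+ (2 * m) * D) * t ^+ 2.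
Proof.
move=> sa c1 t1; have [LD LZ Lb] := sL.
have sa1 : sym D (-1) a by apply: (sym_le sa) => //; lra.
have sr := symM sa (sym_exp_rem 2 c1 t1).
have sl := symM sa (sym_lin c1).
rewrite (_ : -3 + 2 = -1) in sr sl; try by ring.
have -> : (fun u => a u * cexp (t%:C * lin c u)) = (fun u => a u +
    (t%:C * (a u * lin c u) + a u * exp_rem 2 (t%:C * lin c u))).
  apply/funext => u; rewrite /exp_rem (exp_truncS 1) (exp_truncS 0) /exp_trunc big_ord0.
  rewrite (_ : 1`! = 1%N)// fact0 invr1 rmorph1 expr0 expr1; ring.
rewrite (LD _ _ _ _ sa1 (symD (symZ _ sl) sr)) (LD _ _ _ _ (symZ _ sl) sr) (LZ _ _ _ sl).
set x := L a; set y := t%:C * _; set z := L _.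
rewrite (_ : x + (y + z) - x - y = z); last by ring.
rewrite (le_trans (Lb _ _ sr))// real_normK ?num_real//.
by rewrite le_eqVlt; apply/orP; left; apply/eqP; ring.
Qed.

End functional.

Lemma sym_prod (I : Type) (r : seq I) (f : I -> 'rV[R]_m -> R[i]) (D : I -> R) (kap : R) :
  (forall i, sym (D i) kap (f i)) ->
  sym (\prod_(i <- r) (2 ^+ (2 * m) * D i)) ((size r)%:R * kap)
    (fun u => \prod_(i <- r) f i u).
Proof.
move=> sf; elim: r => [|i r IH].
  rewrite big_nil mul0r; under eq_fun do rewrite big_nil.
  have := @sym_cst R m 1; by rewrite (_ : (1 : R[i]) = 1%:C)// normc_rc normr1.
rewrite big_cons; under [X in sym _ _ X]eq_fun do rewrite big_cons.
rewrite (_ : (size (i :: r))%:R * kap = kap + (size r)%:R * kap); last first.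
  by rewrite [size _]/= -[(size r).+1%:R]nat1r mulrDl mul1r.
by rewrite -mulrA; exact: symM.
Qed.

(** Telescoping: the difference is small as soon as each factor differs little,
    whatever the number of factors. *)
Lemma sym_prod_diff (I : Type) (r : seq I) : exists2 G : R, 0 <= G &
  forall (E T : I -> 'rV[R]_m -> R[i]) (eps : R),
  (forall i, sym 1 2 (E i)) -> (forall i, sym 2 2 (T i)) ->
  (forall i, sym eps 2 (fun u => E i u - T i u)) ->
  sym (G * eps) ((size r)%:R * 2)
    (fun u => \prod_(i <- r) E i u - \prod_(i <- r) T i u).
Proof.
elim: r => [|i r [G G0 IH]].
  exists 0 => // E T eps _ _ _; rewrite !mul0r.
  by under eq_fun do rewrite !big_nil subrr; exact: sym0.
exists (2 ^+ (2 * m) * G + 2 ^+ (2 * m) * \prod_(j <- r) (2 ^+ (2 * m) * 2)).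
  by rewrite addr_ge0// mulr_ge0 ?exprn_ge0// prodr_ge0// => j _; rewrite mulr_ge0 ?exprn_ge0.
move=> E T eps sE sT sET.
have h1 := symM (sE i) (IH E T eps sE sT sET).
have h2 := symM (sET i) (sym_prod r sT).
rewrite (_ : (size (i :: r))%:R * 2 = 2 + (size r)%:R * 2 :> R); last first.
  by rewrite [size _]/= -[(size r).+1%:R]nat1r mulrDl mul1r.
rewrite (_ : (_ + _) * eps = 2 ^+ (2 * m) * (1 * (G * eps)) +
  2 ^+ (2 * m) * (eps * \prod_(j <- r) (2 ^+ (2 * m) * 2))); last by ring.
rewrite (_ : (fun u => _) = (fun u => E i u * (\prod_(j <- r) E j u - \prod_(j <- r) T j u) +
  (E i u - T i u) * \prod_(j <- r) T j u)); first exact: symD.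
by apply/funext => u; rewrite !big_cons; ring.
Qed.

Section analytic.
Variables (C : R) (L : ('rV[R]_m -> R[i]) -> R[i]).
Hypothesis sL : symfun C L.
Variables (N : nat) (c : 'I_N -> 'I_m -> R[i]).
Hypothesis c1 : forall i j, normc (c i j) <= 1.

Let term (y : 'I_N -> R) (i : 'I_N) (k : nat) (u : 'rV[R]_m) : R[i] :=
  ((k`!%:R : R)^-1)%:C * ((y i)%:C * lin (c i) u) ^+ k.

Let sym_term y i k : `|y i| <= 1 -> sym (2 * `|y i| ^+ k) 2 (term y i k).
Proof.
move=> y1; have := symB (sym_exp_rem k (c1 i) y1) (sym_exp_rem k.+1 (c1 i) y1).
rewrite (_ : (fun u => _) = term y i k); last first.
  by apply/funext => u; rewrite /exp_rem exp_truncS /term; ring.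
move=> /sym_le; apply => //; rewrite mulr2n mulrDl mul1r lerD2l.
by rewrite exprS ler_piMl// exprn_ge0.
Qed.

Let coef (a : 'rV[R]_m -> R[i]) (al : {ffun 'I_N -> nat}) : R[i] :=
  L (fun u => a u * \prod_i term (fun=> 1) i (al i) u).

Let K2 : R := 2 ^+ (2 * m).
Let K20 : 0 <= K2. Proof. exact: exprn_ge0. Qed.

Let sym_product a D y (al : 'I_N -> nat) : sym D (- (1 + N%:R * 2)) a ->
  (forall i, `|y i| <= 1) ->
  sym (K2 * (D * \prod_i (K2 * (2 * `|y i| ^+ al i)))) (-1)
    (fun u => a u * \prod_i term y i (al i) u).
Proof.
move=> sa y1; have := symM sa (sym_prod (index_enum 'I_N) (fun i => sym_term (al i) (y1 i))).
rewrite (_ : size (index_enum 'I_N) = N); last by rewrite -sum1_size sum1_card card_ord.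
by rewrite (_ : - (1 + _) + _ = -1); last by ring.
Qed.

Let coef_monomial a D (y : 'rV[R]_N) (al : {ffun 'I_N -> nat}) :
  sym D (- (1 + N%:R * 2)) a ->
  coef a al * (monomial al y)%:C = L (fun u => a u * \prod_i term (fun i => y ord0 i) i (al i) u).
Proof.
move=> sa; have one (i : 'I_N) : `|1 : R| <= 1 by rewrite normr1.
have [_ LZ _] := sL.
rewrite mulrC /coef -(LZ _ _ _ (sym_product al sa one)); congr (L _); apply/funext => u.
rewrite mulrCA /monomial rc_prod -big_split /=; congr (_ * _); apply: eq_bigr => i _.
by rewrite /term rmorph1 mul1r rmorphXn /= exprMn mulrCA.
Qed.

Lemma geometric_sum_le (x : R) k : 0 <= x <= 1 / 2 -> \sum_(i < k) x ^+ i <= 2.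
Proof.
move=> /andP[x0 x1]; suff : \sum_(i < k) x ^+ i + 2 * (1 / 2) ^+ k <= 2.
  have h : 0 <= (1 / 2 : R) ^+ k by apply: exprn_ge0; lra.
  by move=> h2; lra.
elim: k => [|k IH]; first by rewrite big_ord0 expr0; lra.
rewrite big_ord_recr /= exprS.
have : x ^+ k <= (1 / 2) ^+ k by rewrite lerXn2r ?nnegrE//; lra.
lra.
Qed.

(** The partial sums over cubes of multi-indices factor as products of
    truncated exponentials. *)
Lemma symfun_analytic a D : sym D (- (1 + N%:R * 2)) a ->
  exists cf : {ffun 'I_N -> nat} -> R[i], forall y : 'rV[R]_N, `|y| < 1 / 2 ->
    (exists M : R, forall k, cube_sum k (fun al => normc (cf al) * `|monomial al y|) <= M) /\
    (fun k => normc (L (fun u => a u * cexp (\sum_i (y ord0 i)%:C * lin (c i) u)) -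
       cube_sum k (fun al => cf al * (monomial al y)%:C))) @ \oo --> (0 : R).
Proof.
move=> sa; have [LD LZ Lb] := sL; exists (coef a) => y y2.
have y12 i : `|y ord0 i| <= 1 / 2.
  by apply: ltW; apply: le_lt_trans y2; rewrite [leRHS]/Num.norm /= mx_normrE;
    exact: (le_bigmax _ _ (ord0, i)).
have y1 i : `|y ord0 i| <= 1 by rewrite (le_trans (y12 i))//; lra.
have D0 := sym_ge0 sa.
have C0 : 0 <= C * (K2 * D).
  have one (i : 'I_N) : `|0 : R| <= 1 by rewrite normr0.
  have := Lb _ _ (sym_product (fun=> 0%N) sa one).
  under eq_bigr do rewrite expr0 mulr1.
  rewrite big_const_ord iter_mulr_1 => /(le_trans (cnorm_ge0 _)).
  rewrite !mulrA pmulr_lge0// exprn_gt0// mulr_gt0// exprn_gt0//.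
split.
  exists (C * (K2 * D) * (K2 * 4) ^+ N) => k.
  apply: (@le_trans _ _ (C * (K2 * D) * \prod_(i < N) \sum_(j < k) (K2 * (2 * `|y ord0 i| ^+ j)))).
    rewrite bigA_distr_bigA /= mulr_sumr; apply: ler_sum => al _.
    rewrite -normc_rc -normcM (coef_monomial _ _ sa).
    rewrite (le_trans (Lb _ _ (sym_product _ sa y1)))// -!mulrA.
    by under [X in _ * (_ * (_ * X)) <= _]eq_bigr do rewrite ffunE.
  rewrite ler_wpM2l// -[in leRHS](card_ord N) -prodr_const; apply: ler_prod => i _.
  rewrite sumr_ge0 => [|j _]; last by rewrite !mulr_ge0// exprn_ge0.
  rewrite -!mulr_sumr ler_wpM2l// (_ : 4 = 2 * 2 :> R); last by ring.
  by rewrite ler_wpM2l// geometric_sum_le// normr_ge0 y12.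
have E k : cube_sum k (fun al => coef a al * (monomial al y)%:C) =
    L (fun u => a u * \prod_i exp_trunc k ((y ord0 i)%:C * lin (c i) u)).
  rewrite /cube_sum; under eq_bigr do rewrite (coef_monomial _ _ sa).
  have [<- _] := symfun_sum sL (index_enum {ffun 'I_N -> 'I_k})
     (fun al => sym_product [ffun i => al i : nat] sa y1).
  congr (L _); apply/funext => u; rewrite -mulr_sumr; congr (_ * _).
  rewrite /exp_trunc bigA_distr_bigA; apply: eq_bigr => al _.
  by apply: eq_bigr => i _; rewrite /term ffunE.
have [G G0 hG] := sym_prod_diff (index_enum 'I_N).
pose EE i u := cexp ((y ord0 i)%:C * lin (c i) u).
pose TT k i u := exp_trunc k ((y ord0 i)%:C * lin (c i) u).
have sE i : sym 1 2 (EE i).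
  have := sym_exp_rem 0 (c1 i) (y1 i); rewrite expr0.
  by under [X in sym _ _ X -> _]eq_fun do rewrite exp_rem0.
have sET k i : sym ((1 / 2) ^+ k) 2 (fun u => EE i u - TT k i u).
  apply: (sym_le (sym_exp_rem k (c1 i) (y1 i))) => //.
  by have := y12 i => yi; rewrite lerXn2r ?nnegrE//; lra.
have sT k i : sym 2 2 (TT k i).
  have := symB (sE i) (sET k i).
  rewrite (_ : (fun u => _) = TT k i); last by apply/funext => u; ring.
  have h : (1 / 2 : R) ^+ k <= 1 by rewrite exprn_ile1//; lra.
  by move=> /sym_le; apply => //; lra.
have szN : size (index_enum 'I_N) = N by rewrite -sum1_size sum1_card card_ord.
have sd k := symM sa (hG EE (TT k) _ sE (sT k) (sET k)).
have sP := symM sa (sym_prod (index_enum 'I_N) sE).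
have sQ k := symM sa (sym_prod (index_enum 'I_N) (sT k)).
rewrite szN (_ : - (1 + _) + _ = -1) in sP; last by ring.
apply: (@squeeze_cvgr _ _ _ _ (fun=> 0) (fun k => C * (K2 * (D * G)) * (1 / 2) ^+ k)).
- apply: nearW => k; rewrite cnorm_ge0 /= E.
  rewrite (_ : (fun u => a u * cexp _) = (fun u => a u * \prod_i EE i u)); last first.
    by apply/funext => u; rewrite cexp_sum.
  have sQk := sQ k; rewrite szN (_ : - (1 + _) + _ = -1) in sQk; last by ring.
  rewrite -(symfunB sL sP sQk).
  have sdk := sd k; rewrite szN (_ : - (1 + _) + _ = -1) in sdk; last by ring.
  rewrite (_ : (fun u => _) = (fun u => a u * (\prod_i EE i u - \prod_i TT k i u))).
    by rewrite (le_trans (Lb _ _ sdk))// -!mulrA.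
  by apply/funext => u; rewrite mulrBr.
- exact: cvg_cst.
- rewrite -[X in _ --> X](mulr0 (C * (K2 * (D * G)))); apply: cvgM; first exact: cvg_cst.
  by apply: cvg_expr; rewrite ger0_norm; lra.
Qed.

End analytic.

End symbol_functional.

(** * Essentially bounded functions *)

Section Linfty.
Variable R : realType.
Local Open Scope complex_scope.
Variable m : nat.
Local Notation V := (borelV R m).
Local Notation mu := (lebesgueV R m).
Implicit Types (F G : 'rV[R]_m -> R[i]).

Lemma lebesgueV_gt0 : (0 < mu setT)%E.
Proof.
rewrite lt0e measure_ge0 andbT; apply/eqP => h.
have : {ae mu, forall x, (fun _ : V => False) x}.
  by exists setT; split => //; exact: measurableT.
by move=> /(ae_open openT) [|x [_ []]] //; exists 0.
Qed.

(** The measure of the whole space is positive, so the norm is the essential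
    supremum, including in dimension 0. *)
Lemma Linfty_normP F (B : R) :
  (Linfty_norm F <= B%:E)%E <-> {ae mu, forall x : V, normc (F x) <= B}.
Proof.
rewrite /Linfty_norm unlock /= lebesgueV_gt0; split => [/ess_supP|h].
  by apply: filterS => x /=; rewrite lee_fin ger0_norm ?cnorm_ge0.
apply/ess_supP; move: h; apply: filterS => x /=.
by rewrite lee_fin ger0_norm ?cnorm_ge0.
Qed.

Lemma Linfty_bounded F : Linfty F ->
  exists2 B : R, 0 <= B & {ae mu, forall x : V, normc (F x) <= B}.
Proof.
move=> [_ Foo]; have [r hr] : exists r : R, (Linfty_norm F <= r%:E)%E.
  case E : (Linfty_norm F) Foo => [r| |] // _; first by exists r.
  by exists 0; rewrite leNye.
exists (Num.max 0 r); first by rewrite le_max lexx.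
move/Linfty_normP : hr; apply: filterS => x /le_trans; apply.
by rewrite le_max lexx orbT.
Qed.

Lemma bounded_Linfty F (B : R) : cmeasurable (F : V -> R[i]) ->
  (forall x, normc (F x) <= B) -> Linfty F /\ (Linfty_norm F <= B%:E)%E.
Proof.
move=> mF FB; have h : (Linfty_norm F <= B%:E)%E.
  by apply/Linfty_normP; exact: nearW.
by split => //; split => //; rewrite (le_lt_trans h) ?ltry.
Qed.

Lemma eq_ae_Linfty_norm F G (B : R) : eq_ae F G ->
  (Linfty_norm F <= B%:E)%E -> (Linfty_norm G <= B%:E)%E.
Proof.
move=> FG /Linfty_normP h; apply/Linfty_normP.
by move: FG h; apply: filterS2 => x <-.
Qed.

End Linfty.

(** * Symbols of translation commuting operators *)

Section operator_multiplier.
Variable R : realType.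
Local Open Scope complex_scope.
Variable m : nat.
Local Notation V := (borelV R m).
Local Notation mu := (lebesgueV R m).

Definition trig (I : Type) (r : seq I) (c : I -> R[i]) (a : I -> 'rV[R]_m) : 'rV[R]_m -> R[i] :=
  fun x => \sum_(i <- r) c i * expi (dot (a i) x).

Lemma cmeasurable_character (a : 'rV[R]_m) : cmeasurable (character a : V -> R[i]).
Proof.
have := @cmeasurable_char R m a; rewrite /character.
by under eq_fun do rewrite dotC.
Qed.

Lemma Linfty_character (a : 'rV[R]_m) : Linfty (character a).
Proof.
apply: (proj1 (bounded_Linfty (B := 1) (cmeasurable_character a) _)) => x.
by rewrite /character normc_expi.
Qed.

Lemma cmeasurable_trig I (r : seq I) c a : cmeasurable (trig r c a : V -> R[i]).
Proof.
apply: cmeasurable_sum => i; apply: cmeasurableM; first exact: cmeasurable_cst.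
exact: cmeasurable_character.
Qed.

Lemma Linfty_trig I (r : seq I) c a : Linfty (trig r c a).
Proof.
apply: (proj1 (bounded_Linfty (B := \sum_(i <- r) normc (c i)) (cmeasurable_trig _ _ _) _)) => x.
rewrite (le_trans (normc_sum _ _ _))//; apply: ler_sum => i _.
by rewrite normcM normc_expi mulr1.
Qed.

Lemma continuous_dot (a : 'rV[R]_m) : continuous ((fun x => dot a x) : 'rV[R]_m -> R^o).
Proof.
apply: (@continuous_sum R _ _ _ (fun i (x : 'rV[R]_m) => a ord0 i * x ord0 i)) => i x.
exact: (cvgM (@cst_continuous 'rV[R]_m R^o (a ord0 i) x) (@coord_continuous R 1 m ord0 i x)).
Qed.

Lemma continuous_normc_trig I (r : seq I) c a :
  continuous ((fun x => normc (trig r c a x)) : 'rV[R]_m -> R^o).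
Proof.
have cc (b : 'rV[R]_m) : continuous ((fun x => cos (dot b x)) : 'rV[R]_m -> R^o).
  move=> x; apply: (@continuous_comp _ R^o R^o (fun x => dot b x) cos).
    exact: continuous_dot.
  exact: continuous_cos.
have cs (b : 'rV[R]_m) : continuous ((fun x => sin (dot b x)) : 'rV[R]_m -> R^o).
  move=> x; apply: (@continuous_comp _ R^o R^o (fun x => dot b x) sin).
    exact: continuous_dot.
  exact: continuous_sin.
have cr : continuous ((fun x => cre (trig r c a x)) : 'rV[R]_m -> R^o).
  rewrite /trig (_ : (fun x => _) = (fun x => \sum_(i <- r)
     (cre (c i) * cos (dot (a i) x) - cim (c i) * sin (dot (a i) x)))); last first.
    by apply/funext => x; rewrite re_sum; apply: eq_bigr => i _; rewrite reM.
  apply: (@continuous_sum R _ _ _ (fun i (x : 'rV[R]_m) =>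
     cre (c i) * cos (dot (a i) x) - cim (c i) * sin (dot (a i) x))) => i x.
  exact: (cvgB (cvgM (@cst_continuous 'rV[R]_m R^o _ x) (cc (a i) x))
               (cvgM (@cst_continuous 'rV[R]_m R^o _ x) (cs (a i) x))).
have ci : continuous ((fun x => cim (trig r c a x)) : 'rV[R]_m -> R^o).
  rewrite /trig (_ : (fun x => _) = (fun x => \sum_(i <- r)
     (cre (c i) * sin (dot (a i) x) + cim (c i) * cos (dot (a i) x)))); last first.
    by apply/funext => x; rewrite im_sum; apply: eq_bigr => i _; rewrite imM.
  apply: (@continuous_sum R _ _ _ (fun i (x : 'rV[R]_m) =>
     cre (c i) * sin (dot (a i) x) + cim (c i) * cos (dot (a i) x))) => i x.
  exact: (cvgD (cvgM (@cst_continuous 'rV[R]_m R^o _ x) (cs (a i) x))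
               (cvgM (@cst_continuous 'rV[R]_m R^o _ x) (cc (a i) x))).
rewrite (_ : (fun x => _) = (fun x => Num.sqrt (cre (trig r c a x) ^+ 2 + cim (trig r c a x) ^+ 2))).
  move=> x; apply: (@continuous_comp _ R^o R^o
    (fun x => cre (trig r c a x) ^+ 2 + cim (trig r c a x) ^+ 2) Num.sqrt); last exact: sqrt_continuous.
  exact: (cvgD (cvgM (cr x) (cr x)) (cvgM (ci x) (ci x))).
by apply/funext => x; rewrite normcE.
Qed.

Section operator.
Variables (T : ('rV[R]_m -> R[i]) -> ('rV[R]_m -> R[i])) (phi1 : 'rV[R]_m -> R[i]).
Hypotheses (bT : bounded_operator T) (sT : has_symbol T phi1).

Lemma operator_trig I (r : seq I) c a :
  eq_ae (T (trig r c a)) (trig r (fun i => c i * phi1 (a i)) a).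
Proof.
have [_ eqT linT _] := bT; have [_ cT] := sT.
elim: r => [|i r IH].
  have L0 := Linfty_trig [::] c a.
  have := linT (-1) _ _ L0 L0; rewrite /eq_ae.
  rewrite (_ : (fun x => -1 * _ + _) = trig [::] c a); last first.
    by apply/funext => x; rewrite mulN1r addNr /trig big_nil.
  by apply: filterS => x h _; rewrite h// mulN1r addNr /trig big_nil.
have Lc := Linfty_character (a i); have Lr := Linfty_trig r c a.
have := linT (c i) _ _ Lc Lr; rewrite /eq_ae.
rewrite (_ : (fun x => c i * _ + _) = trig (i :: r) c a); last first.
  by apply/funext => x; rewrite /trig big_cons.
move: (cT (a i)) IH; rewrite /eq_ae.
apply: filterS3 => x h1 h2 h3 _.
by rewrite h3// h1// h2// /trig big_cons /character mulrA.
Qed.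

(** The images of trigonometric polynomials are trigonometric polynomials up to
    null sets; by continuity, essential bounds are bounds everywhere. *)
Lemma operator_bound : exists2 M : R, 0 <= M &
  forall I (r : seq I) c a (B : R), (forall x, normc (trig r c a x) <= B) ->
    forall x, normc (trig r (fun i => c i * phi1 (a i)) a x) <= M * B.
Proof.
have [_ _ _ [M hM]] := bT; exists `|M| => // I r c a B hB.
have B0 : 0 <= B := le_trans (cnorm_ge0 _) (hB 0).
apply: ae_le_continuous; first exact: continuous_normc_trig.
apply/Linfty_normP; apply: (eq_ae_Linfty_norm (operator_trig r c a)).
have [LP nP] := bounded_Linfty (cmeasurable_trig r c a) hB.
apply: (le_trans (hM _ LP)).
have n0 : (0 <= Linfty_norm (trig r c a))%E by exact: Lnorm_ge0.
apply: (@le_trans _ _ (`|M|%:E * Linfty_norm (trig r c a))%E).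
  by rewrite lee_wpmul2r// lee_fin ler_norm.
by rewrite EFinM lee_wpmul2l// lee_fin.
Qed.

Lemma exp_partial_sum_le (x : R) k : 0 <= x -> \sum_(i < k) (i`!%:R : R)^-1 * x ^+ i <= expR x.
Proof.
move=> x0; have -> : \sum_(i < k) (i`!%:R : R)^-1 * x ^+ i = series (exp_coeff x) k.
  by rewrite /series /= big_mkord; apply: eq_bigr => i _; rewrite /exp_coeff /= mulrC.
have nd : nondecreasing_seq (series (exp_coeff x)).
  by apply: (@nondecreasing_series R (exp_coeff x) predT 0) => i _ _; exact: exp_coeff_ge0.
exact: (nondecreasing_cvgn_le nd (@is_cvg_series_exp_coeff R x) k).
Qed.

Lemma ccvg_exp_trunc (z : R[i]) : ccvg (fun k => exp_trunc k z) (cexp z).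
Proof.
apply: (ccvg_squeeze (e := fun k => exp_coeff (normc z) k * expR (normc z))).
  move=> k; rewrite -normcN opprB -/(exp_rem k z).
  have := exp_rem_bound k z ler01.
  by rewrite rmorph1 !mul1r /exp_coeff /= [_^-1 * _]mulrC.
rewrite -[X in _ --> X](mul0r (expR (normc z))); apply: cvgM; last exact: cvg_cst.
exact: cvg_exp_coeff.
Qed.

(** On trigonometric polynomials the operator [exp (h T)] is given by the
    exponential series of the powers of the symbol, and each power is bounded by
    iterating [T]. *)
Lemma multiplier_bound_cexp (h : R) : 0 <= h -> exists A : R,
  multiplier_bound A (fun u => cexp (h%:C * phi1 u)).
Proof.
move=> h0; have [M M0 hM] := operator_bound; exists (expR (h * M)).
move=> I c a B hB.
have B0 : 0 <= B := le_trans (cnorm_ge0 _) (hB 0).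
have pw (j : nat) x : normc (trig (index_enum I) (fun i => c i * phi1 (a i) ^+ j) a x) <= M ^+ j * B.
  elim: j x => [|j IH] x.
    rewrite expr0 mul1r; under [X in normc X <= _]eq_bigr do rewrite expr0 mulr1.
    exact: hB.
  have := hM _ _ _ _ _ IH x; rewrite mulrA -exprS; congr (normc _ <= _).
  by rewrite /trig; apply: eq_bigr => i _; rewrite exprSr !mulrA.
have pw0 (j : nat) : normc (\sum_i c i * phi1 (a i) ^+ j) <= M ^+ j * B.
  have := pw j 0; congr (normc _ <= _); rewrite /trig; apply: eq_bigr => i _.
  by rewrite dot0r expi0 mulr1.
apply: (ccvg_normc_le (u := fun k => \sum_i c i * exp_trunc k (h%:C * phi1 (a i)))).
  by apply: ccvg_sum => i; apply: ccvgZ; exact: ccvg_exp_trunc.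
move=> k.
have -> : \sum_i c i * exp_trunc k (h%:C * phi1 (a i)) =
    \sum_(j < k) ((j`!%:R : R)^-1 * h ^+ j)%:C * \sum_i c i * phi1 (a i) ^+ j.
  rewrite /exp_trunc; under eq_bigr do rewrite mulr_sumr.
  rewrite exchange_big /=; apply: eq_bigr => j _; rewrite mulr_sumr.
  by apply: eq_bigr => i _; rewrite rcM rmorphXn exprMn; ring.
rewrite (le_trans (normc_sum _ _ _))//.
apply: (@le_trans _ _ (\sum_(j < k) (j`!%:R : R)^-1 * (h * M) ^+ j * B)).
  apply: ler_sum => j _; have p0 : 0 <= (j`!%:R : R)^-1 * h ^+ j.
    by rewrite mulr_ge0 ?invr_ge0 ?exprn_ge0.
  rewrite normcM normc_rc ger0_norm// exprMn -!mulrA ler_wpM2l ?invr_ge0//.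
  by rewrite ler_wpM2l ?exprn_ge0.
by rewrite -mulr_suml ler_wpM2r// exp_partial_sum_le// mulr_ge0.
Qed.

End operator.

Lemma multiplier_bound_le (A : R) (psi : 'rV[R]_m -> R[i]) : multiplier_bound A psi ->
  0 <= A /\ forall u, normc (psi u) <= A.
Proof.
move=> h; split.
  have := h 'I_0 (fun=> 0) (fun=> 0) 1; rewrite big_ord0 normc0 mulr1; apply => x.
  by rewrite big_ord0 normc0.
move=> u; have := h 'I_1 (fun=> 1) (fun=> u) 1.
rewrite big_ord1 mul1r mulr1; apply => x.
by rewrite big_ord1 mul1r normc_expi.
Qed.

End operator_multiplier.

(** * Convolution kernels *)

Section kernels.
Variable R : realType.
Local Open Scope complex_scope.
Variable m : nat.
Local Notation V := (borelV R m).
Local Notation mu := (lebesgueV R m).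
Variables (A : R) (psi : 'rV[R]_m -> R[i]).
Hypotheses (mpsi : cmeasurable (psi : V -> R[i])) (bpsi : multiplier_bound A psi).

Let A0 : 0 <= A. Proof. by have [] := multiplier_bound_le bpsi. Qed.
Let psiA u : normc (psi u) <= A. Proof. by have [_ +] := multiplier_bound_le bpsi; exact. Qed.

Definition kern (a : 'rV[R]_m -> R[i]) : 'rV[R]_m -> R[i] := ift (fun u => a u * psi u).

Definition kern_cst : R := A * (2 ^+ m.+1 * Iwexp R m * pi ^+ m).

Lemma cintegrable_sym D a : sym D (-1) a -> cintegrable mu (a : V -> R[i]).
Proof. by move=> [ma _ aB _]; exact: (cintegrable_wexp ma aB). Qed.

Lemma cintegrable_sym_psi D a : sym D (-1) a -> cintegrable mu (fun u : V => a u * psi u).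
Proof.
move=> sa; apply: (cintegrableM_bounded (B := A)) => //; exact: cintegrable_sym sa.
Qed.

Lemma symfun_kern X : symfun (A * Iwexp R m) (fun a => kern a X).
Proof.
split.
- move=> a b D D' sa sb; rewrite /kern /ift.
  have ia := cintegrable_char X (cintegrable_sym_psi sa).
  have ib := cintegrable_char X (cintegrable_sym_psi sb).
  by rewrite -(CintD ia ib); apply: eq_Cint => u; ring.
- move=> c a D sa; rewrite /kern /ift.
  have ia := cintegrable_char X (cintegrable_sym_psi sa).
  by rewrite -(CintZ c ia); apply: eq_Cint => u; ring.
- move=> a D sa; have [ma _ aB _] := sa; have D0 := sym_ge0 sa.
  rewrite [leRHS](_ : _ = (D * A) * Iwexp R m); last by ring.
  apply: ift_bound; first exact: cmeasurableM.
  move=> u; rewrite normcM mulrAC ler_pM ?cnorm_ge0//; exact: aB.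
Qed.

(** This is where the hypothesis on the symbol enters: the kernel is integrable
    uniformly in [a], although [psi] is only measurable. *)
Lemma kern_L1 D a : sym D (-1) a ->
  (\int[mu]_x (normc (kern a x))%:E <= (kern_cst * D)%:E)%E.
Proof.
move=> sa; have [ma ca aB da] := sa; have ia := cintegrable_sym sa.
have [ii bi] := ift_integrable ma aB da.
have D0 := sym_ge0 sa.
have aD u : normc (a u) <= D.
  rewrite (le_trans (aB u))// ler_piMr// -[leRHS]expR0 ler_expR mulN1r oppr_le0.
  exact: l1_ge0.
apply: (le_trans (multiplier_L1 mpsi psiA bpsi ia aD ca ii)).
by rewrite lee_fin /kern_cst -mulrA ler_wpM2l.
Qed.

Lemma cintegrable_kern D a : sym D (-1) a -> cintegrable mu (kern a : V -> R[i]).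
Proof.
move=> sa; apply: cintegrable_norm_lty; first exact: cmeasurable_ift (cintegrable_sym_psi sa).
exact: (le_lt_trans (kern_L1 sa) (ltry _)).
Qed.

Lemma kern_L1_Rintegral D a : sym D (-1) a -> \int[mu]_x normc (kern a x) <= kern_cst * D.
Proof.
move=> sa; have ik := integrable_normc (cintegrable_kern sa).
rewrite -lee_fin /Rintegral fineK; first exact: kern_L1 sa.
exact: integrable_fin_num.
Qed.

Lemma kern_shift a X x : kern a (X + x) = kern (fun u => a u * expi (dot u x)) X.
Proof. by rewrite /kern /ift; apply: eq_Cint => u; rewrite dotDr expiD; ring. Qed.

Section convolution_functional.
Variables (F : 'rV[R]_m -> R[i]) (S : R).
Hypotheses (mF : cmeasurable (F : V -> R[i])) (FS : forall x, normc (F x) <= S).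

Definition convk (X : 'rV[R]_m) (a : 'rV[R]_m -> R[i]) : R[i] :=
  Cint mu (fun t : V => kern a (X - t : 'rV[R]_m) * F t).

Lemma cintegrable_convk X D a : sym D (-1) a ->
  cintegrable mu (fun t : V => kern a (X - t : 'rV[R]_m) * F t).
Proof.
move=> sa; have [i1 _] := Cint_reflect X (cintegrable_kern sa).
by apply: (cintegrableM_bounded (B := S)).
Qed.

Lemma symfun_convk X : symfun (kern_cst * S) (convk X).
Proof.
have S0 : 0 <= S := le_trans (cnorm_ge0 _) (FS 0).
split.
- move=> a b D D' sa sb; rewrite /convk.
  rewrite -(CintD (cintegrable_convk X sa) (cintegrable_convk X sb)).
  apply: eq_Cint => t; have [kD _ _] := symfun_kern (X - t : 'rV[R]_m).
  by rewrite (kD _ _ _ _ sa sb) mulrDl.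
- move=> c a D sa; rewrite /convk -(CintZ c (cintegrable_convk X sa)).
  apply: eq_Cint => t; have [_ kZ _] := symfun_kern (X - t : 'rV[R]_m).
  by rewrite (kZ _ _ _ sa) mulrA.
- move=> a D sa; rewrite /convk.
  pose g : V -> R[i] := fun t => (normc (kern a t))%:C.
  have ig : cintegrable mu g by apply: cintegrable_rc; exact: integrable_normc (cintegrable_kern sa).
  have [i2 e2] := Cint_reflect X ig.
  have ir : mu.-integrable setT (EFin \o (fun t : V => normc (kern a (X - t : 'rV[R]_m)))).
    by case: i2.
  have := @normc_Cint_le _ _ _ mu _ (fun t : V => S * normc (kern a (X - t : 'rV[R]_m)))
    (cintegrable_cmeasurable (cintegrable_convk X sa)) _ _.
  move=> /(_ _ _)/le_trans; apply.
  + by move=> t; rewrite normcM mulrC ler_wpM2r ?cnorm_ge0.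
  + have := integrableZl measurableT S ir.
    by apply: eq_integrable => // t _ /=; rewrite EFinM.
  + rewrite (RintegralZl S measurableT ir).
    have -> : \int[mu]_t normc (kern a (X - t : 'rV[R]_m)) = \int[mu]_t normc (kern a t).
      have := congr1 (@complex.Re _) e2.
      move=> e3.
      have h1 := re_Cint mu (fun t : V => g (X - t : 'rV[R]_m)).
      have h2 := re_Cint mu g.
      have h3 := etrans (etrans (esym h1) e3) h2.
      exact: h3.
    rewrite -mulrA mulrCA.
    exact: (ler_wpM2l S0 (kern_L1_Rintegral sa)).
Qed.

Lemma convk_shift X x a : convk (X + x) a = convk X (fun u => a u * expi (dot u x)).
Proof.
apply: eq_Cint => t; congr (_ * _).
by rewrite -(kern_shift a (X - t : 'rV[R]_m) x); congr (kern a _); rewrite addrAC.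
Qed.

End convolution_functional.

End kernels.

(** * Measures with a density *)

Section density_measure.
Context d (T : measurableType d) (R : realType).
Local Open Scope complex_scope.
Variables (mu : {sigma_finite_measure set T -> \bar R}) (g : T -> R).
Hypotheses (ig : mu.-integrable setT (EFin \o g)) (g0 : forall x, 0 <= g x).
Variable p : {finite_measure set T -> \bar R}.

Let induced_ge0 (E : set T) : (0 <= induced_charge ig E)%E.
Proof. by apply: integral_ge0 => x _; rewrite lee_fin. Qed.

Definition density_measure : set T -> \bar R := measure_of_charge _ induced_ge0.

HB.instance Definition _ := Measure.on density_measure.

Lemma density_measureE A : density_measure A = (\int[mu]_(x in A) (g x)%:E)%E.
Proof. by []. Qed.

Let density_fin : fin_num_fun density_measure.
Proof.
move=> A mA; rewrite density_measureE.
by apply: integrable_fin_num => //; exact: integrableS ig.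
Qed.

HB.instance Definition _ := @Measure_isFinite.Build _ _ _ density_measure density_fin.

(** An identity between signed measures becomes one between finite positive
    measures of this form once negative parts are moved to the other side. *)
Definition add_density : set T -> \bar R := measure_add p density_measure.

HB.instance Definition _ := Measure.on add_density.

Lemma add_densityE A : add_density A = (p A + \int[mu]_(x in A) (g x)%:E)%E.
Proof. by rewrite /add_density measure_addE. Qed.

Let add_density_fin : fin_num_fun add_density.
Proof.
move=> A mA; rewrite add_densityE fin_numD fin_num_measure//=; exact: density_fin.
Qed.

HB.instance Definition _ := @Measure_isFinite.Build _ _ _ add_density add_density_fin.

Lemma integral_density (f : T -> \bar R) : density_measure.-integrable setT f ->
  (\int[density_measure]_x f x = \int[mu]_x (f x * (g x)%:E))%E.
Proof.
move=> jf; have mf : measurable_fun setT f := measurable_int _ jf.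
have dom : density_measure `<< mu.
  apply/null_content_dominatesP => A mA A0; rewrite density_measureE.
  by apply: null_set_integral => //; apply: measurable_funTS; exact: measurable_int ig.
rewrite -(Radon_Nikodym_change_of_variables dom measurableT jf).
apply: ae_eq_integral => //.
- by apply: emeasurable_funM => //; apply: measurable_int; exact: Radon_Nikodym_integrable.
- by apply: emeasurable_funM => //; exact: measurable_int ig.
have : ae_eq mu setT (Radon_Nikodym (charge_of_finite_measure density_measure) mu) (EFin \o g).
  apply: integral_ae_eq => //.
  - exact: Radon_Nikodym_integrable.
  - exact: measurable_int ig.
  - by move=> E _ mE; rewrite -Radon_Nikodym_integral.
by apply: filterS => x h _; rewrite h.
Qed.

Lemma Cint_add_density (f : T -> R[i]) (B : R) : cmeasurable f -> (forall x, normc (f x) <= B) ->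
  Cint add_density f = Cint p f + Cint mu (fun x => f x * (g x)%:C).
Proof.
move=> mf fB.
have fin (q : {finite_measure set T -> \bar R}) : cintegrable q f.
  by apply: (cintegrable_le mf fB); exact: finite_measure_integrable_cst.
have part (k : T -> R) : measurable_fun setT k -> (forall x, `|k x| <= B) ->
    \int[add_density]_x k x = \int[p]_x k x + \int[mu]_x (k x * g x).
  move=> mk kB.
  have ik (q : {finite_measure set T -> \bar R}) : q.-integrable setT (EFin \o k).
    by apply: (integrable_le mk kB); exact: finite_measure_integrable_cst.
  have ikp := ik p; have ikd := ik density_measure.
  have iM : mu.-integrable setT (EFin \o (fun x => k x * g x)).
    apply: (@integrable_le _ _ _ _ _ (fun x => B * g x)).
    - by apply: measurable_funM => //; exact: integrable_measurable ig.
    - by move=> x; rewrite normrM (ger0_norm (g0 x)) ler_wpM2r.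
    - have := integrableZl measurableT B ig.
      by apply: eq_integrable => // x _ /=; rewrite EFinM.
  rewrite /Rintegral -fineD; [|exact: integrable_fin_num ikp|exact: integrable_fin_num iM].
  congr fine; rewrite (integral_measure_add measurableT ikp ikd); congr (_ + _)%E.
  by rewrite (integral_density ikd).
case: (mf) => m1 m2; apply: ceqP.
  rewrite reD (re_Cint add_density f) (re_Cint p f) (re_Cint mu (fun x => f x * (g x)%:C)).
  rewrite part//; first by congr (_ + _); congr Rintegral; apply/funext => x; rewrite reM /=; ring.
  by move=> x; rewrite (le_trans (re_le_normc _)).
rewrite imD (im_Cint add_density f) (im_Cint p f) (im_Cint mu (fun x => f x * (g x)%:C)).
rewrite part//; first by congr (_ + _); congr Rintegral; apply/funext => x; rewrite imM /=; ring.
by move=> x; rewrite (le_trans (im_le_normc _)).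
Qed.

End density_measure.

(** * Signed measures with a given Fourier transform *)

Section signed.
Variable R : realType.
Local Open Scope complex_scope.
Variable m : nat.
Local Notation V := (borelV R m).
Local Notation mu := (lebesgueV R m).
Variables (p q : {finite_measure set (borelV R m) -> \bar R}) (k : 'rV[R]_m -> R).
Hypothesis ik : mu.-integrable setT (EFin \o (k : V -> R)).

Let kp (x : V) : R := Num.max (k x) 0.
Let kn (x : V) : R := Num.max (- k x) 0.

Let mk : measurable_fun setT (k : V -> R). Proof. exact: integrable_measurable ik. Qed.
Let kp0 x : 0 <= kp x. Proof. by rewrite le_max lexx orbT. Qed.
Let kn0 x : 0 <= kn x. Proof. by rewrite le_max lexx orbT. Qed.

Let ikp : mu.-integrable setT (EFin \o kp).
Proof.
apply: (@integrable_le _ _ _ _ _ (fun x : V => `|k x|)).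
- exact: measurable_maxr.
- move=> x; rewrite ger0_norm// /kp ge_max normr_ge0 ler_norm//.
- exact: integrable_norm ik.
Qed.

Let ikn : mu.-integrable setT (EFin \o kn).
Proof.
apply: (@integrable_le _ _ _ _ _ (fun x : V => `|k x|)).
- by apply: measurable_maxr => //; exact: measurableT_comp.
- by move=> x; rewrite ger0_norm// /kn ge_max normr_ge0 -normrN ler_norm.
- exact: integrable_norm ik.
Qed.

Let kE x : k x = kp x - kn x.
Proof.
rewrite /kp /kn; case/orP: (le_total 0 (k x)) => k0.
  have k0' : - k x <= 0 by rewrite oppr_le0.
  by rewrite (max_r k0') (max_l k0) subr0.
have k0' : 0 <= - k x by rewrite oppr_ge0.
by rewrite (max_l k0') (max_r k0) sub0r opprK.
Qed.

Let Q1 : {finite_measure set V -> \bar R} := add_density ikn kn0 p.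
Let Q2 : {finite_measure set V -> \bar R} := add_density ikp kp0 q.

Hypothesis pq : forall u, charf p u - charf q u =
  Cint mu (fun y : V => expi (dot u y) * (k y)%:C).

Let mchar (u : 'rV[R]_m) : cmeasurable (fun y : V => expi (dot u y)).
Proof. by have := @cmeasurable_char R m u; under eq_fun do rewrite dotC. Qed.

Let Cint_k (f : V -> R[i]) (B : R) : cmeasurable f -> (forall x, normc (f x) <= B) ->
  Cint mu (fun x => f x * (k x)%:C) =
  Cint mu (fun x => f x * (kp x)%:C) - Cint mu (fun x => f x * (kn x)%:C).
Proof.
move=> mf fB.
have ip : cintegrable mu (fun x => f x * (kp x)%:C).
  under eq_fun do rewrite mulrC.
  by apply: (cintegrableM_bounded (B := B)) => //; exact: cintegrable_rc.
have im : cintegrable mu (fun x => f x * (kn x)%:C).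
  under eq_fun do rewrite mulrC.
  by apply: (cintegrableM_bounded (B := B)) => //; exact: cintegrable_rc.
rewrite -(CintN im) -(CintD ip (cintegrableN im)); apply: eq_Cint => x.
by rewrite kE rmorphB mulrBr.
Qed.

(** [p + k^-] and [q + k^+] are positive measures with the same Fourier
    transform. *)
Let Q12 A : measurable A -> Q1 A = Q2 A.
Proof.
apply: charf_unique => u; have b1 (y : V) : normc (expi (dot u y)) <= 1 by rewrite normc_expi.
rewrite /charf (Cint_add_density ikn kn0 p (mchar u) b1) (Cint_add_density ikp kp0 q (mchar u) b1).
have := pq u; rewrite (Cint_k (mchar u) b1) -/(charf p u) -/(charf q u).
move=> /eqP; rewrite subr_eq => /eqP ->; ring.
Qed.

Lemma signed_density_set A : measurable A ->
  p A = (q A + \int[mu]_(x in A) (k x)%:E)%E.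
Proof.
move=> mA; have h : add_density ikn kn0 p A = add_density ikp kp0 q A := Q12 mA.
rewrite !add_densityE in h.
have fp : (\int[mu]_(x in A) (kp x)%:E)%E \is a fin_num.
  by apply: integrable_fin_num => //; exact: integrableS ikp.
have fn : (\int[mu]_(x in A) (kn x)%:E)%E \is a fin_num.
  by apply: integrable_fin_num => //; exact: integrableS ikn.
have -> : (\int[mu]_(x in A) (k x)%:E = \int[mu]_(x in A) (kp x)%:E - \int[mu]_(x in A) (kn x)%:E)%E.
  rewrite -integralB//; [|exact: integrableS ikp|exact: integrableS ikn].
  by apply: eq_integral => x _; rewrite kE EFinB.
by rewrite addeA -h addeK.
Qed.

Lemma signed_density_Cint (f : V -> R[i]) (B : R) : cmeasurable f ->
  (forall x, normc (f x) <= B) ->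
  Cint p f - Cint q f = Cint mu (fun x => f x * (k x)%:C).
Proof.
move=> mf fB; rewrite (Cint_k mf fB).
have h : Cint Q1 f = Cint Q2 f.
  apply: ceqP; rewrite ?(re_Cint Q1 f) ?(re_Cint Q2 f) ?(im_Cint Q1 f) ?(im_Cint Q2 f) /Rintegral;
    congr fine; apply: eq_measure_integral => A mA _; exact: Q12.
rewrite (Cint_add_density ikn kn0 p mf fB) (Cint_add_density ikp kp0 q mf fB) in h.
by move/eqP: h; rewrite -subr_eq => /eqP <-; ring.
Qed.

End signed.

(** * Complex measures *)

Section Cint_more.
Context d (T : measurableType d) (R : realType).
Local Open Scope complex_scope.
Variable mu : {measure set T -> \bar R}.

Lemma Cint_conj (f : T -> R[i]) : cintegrable mu f ->
  Cint mu (fun x => conjc (f x)) = conjc (Cint mu f).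
Proof.
move=> fi; apply: ceqP.
  rewrite (re_Cint mu (fun x => conjc (f x))) -[RHS]/(cre (Cint mu f)) (re_Cint mu f).
  by congr Rintegral; apply/funext => x; case: (f x).
have := im_Cint mu (fun x => conjc (f x)) => ->.
have -> : cim (conjc (Cint mu f)) = - cim (Cint mu f) by case: (Cint mu f).
rewrite -imN -(CintN fi) (im_Cint mu (fun x => - f x)).
by congr Rintegral; apply/funext => x; case: (f x).
Qed.

Lemma ae_eq_Cint (f g : T -> R[i]) : cmeasurable f -> cmeasurable g ->
  {ae mu, forall x, f x = g x} -> Cint mu f = Cint mu g.
Proof.
move=> [f1 f2] [g1 g2] fg; apply: ceqP.
  rewrite (re_Cint mu f) (re_Cint mu g); congr fine; apply: ae_eq_integral => //.
  - exact/measurable_EFin.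
  - exact/measurable_EFin.
  - by move: fg; apply: filterS => x -> _.
rewrite (im_Cint mu f) (im_Cint mu g); congr fine; apply: ae_eq_integral => //.
- exact/measurable_EFin.
- exact/measurable_EFin.
- by move: fg; apply: filterS => x -> _.
Qed.

End Cint_more.

Section complex_measure.
Variable R : realType.
Local Open Scope complex_scope.
Variable m : nat.
Local Notation V := (borelV R m).
Local Notation mu := (lebesgueV R m).
Local Notation ic := (0 +i* 1 : R[i]).

Lemma charge_integral_jordan (nu : {charge set V -> \bar R}) :
  exists p q : {finite_measure set V -> \bar R},
  [/\ forall A, measurable A -> nu A = (p A - q A)%E,
      nu `<< mu -> p `<< mu /\ q `<< mu &
      forall f, charge_integral nu f = \int[p]_x f x - \int[q]_x f x].
Proof.
pose PN := svalP (cid (svalP (cid (Hahn_decomposition nu)))).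
exists (jordan_pos PN), (jordan_neg PN); split => //.
  by move=> A mA; rewrite (jordan_decomp PN mA) /cadd /= cscaleN1.
by move=> h; split; [exact: jordan_pos_dominates|exact: jordan_neg_dominates].
Qed.

(** The Jordan decompositions of the two parts reduce integration against a complex
    measure to four positive measures, hence to [Cint]. *)
Lemma cmeas_integral_jordan (nu : cmeasure R V) :
  exists p1 q1 p2 q2 : {finite_measure set V -> \bar R},
  [/\ forall A, measurable A -> re_meas nu A = (p1 A - q1 A)%E,
      forall A, measurable A -> im_meas nu A = (p2 A - q2 A)%E,
      abs_continuous nu -> (p1 `<< mu /\ q1 `<< mu) /\ (p2 `<< mu /\ q2 `<< mu) &
      forall f, cmeas_integral nu f =
        (Cint p1 f - Cint q1 f) + ic * (Cint p2 f - Cint q2 f)].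
Proof.
have [p1 [q1 [h1 a1 e1]]] := charge_integral_jordan (re_meas nu).
have [p2 [q2 [h2 a2 e2]]] := charge_integral_jordan (im_meas nu).
exists p1, q1, p2, q2; split => //.
  by move=> [d1 d2]; split; [exact: a1|exact: a2].
move=> f; rewrite /cmeas_integral /= !e1 !e2.
rewrite -(re_Cint p1 f) -(re_Cint q1 f) -(re_Cint p2 f) -(re_Cint q2 f).
rewrite -(im_Cint p1 f) -(im_Cint q1 f) -(im_Cint p2 f) -(im_Cint q2 f).
by apply: ceqP => /=; rewrite !cE /=; ring.
Qed.

Lemma cintegrable_bounded_finite (p : {finite_measure set V -> \bar R}) (f : V -> R[i]) (B : R) :
  cmeasurable f -> (forall x, normc (f x) <= B) -> cintegrable p f.
Proof. by move=> mf fB; exact: (cintegrable_le mf fB (finite_integrable_cst p B)). Qed.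

Lemma cmeasurable_char' (u : 'rV[R]_m) : cmeasurable (fun y : V => expi (dot u y)).
Proof. by have := @cmeasurable_char R m u; under eq_fun do rewrite dotC. Qed.

Lemma cintegrable_char_finite (p : {finite_measure set V -> \bar R}) (u : 'rV[R]_m) :
  cintegrable p (fun y : V => expi (dot u y)).
Proof.
by apply: (@cintegrable_bounded_finite p _ 1);
  [exact: cmeasurable_char'|move=> y; rewrite normc_expi].
Qed.

Lemma charfN (p : {finite_measure set V -> \bar R}) (u : 'rV[R]_m) :
  charf p (- u) = conjc (charf p u).
Proof.
rewrite /charf -(Cint_conj (cintegrable_char_finite p u)); apply: eq_Cint => y.
by rewrite dotNl expiN.
Qed.

Lemma rcont_charf (p : {finite_measure set V -> \bar R}) : rcont (charf p).
Proof.
move=> u z; apply: (@cdominated_cvg _ _ _ p (fun n y => expi (dot (inv_nat R n *: z + u) y))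
  (fun y => expi (dot u y)) (fun=> 1)).
- by move=> n; exact: cmeasurable_char'.
- exact: cmeasurable_char'.
- move=> y; have h : dot (inv_nat R n *: z + u) y @[n --> \oo] --> dot u y.
    have -> : (fun n => dot (inv_nat R n *: z + u) y) = (fun n => inv_nat R n * dot z y + dot u y).
      by apply/funext => n; rewrite dotDl dotZl.
    rewrite -[X in _ --> X]add0r -[X in _ --> X + _](mul0r (dot z y)).
    by apply: cvgD; [apply: cvgM; [exact: cvg_inv_nat|exact: cvg_cst]|exact: cvg_cst].
  exact: (cvg_expi h).
- by move=> n y; rewrite normc_expi.
- exact: finite_integrable_cst.
Qed.

Lemma cmeasurable_charf (p : {finite_measure set V -> \bar R}) : cmeasurable (charf p : V -> R[i]).
Proof.
(* The weight makes the integrand integrable in [u]; it is divided out at the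
   end. *)
pose f (z : V * V) : R[i] := (wexp z.1)%:C * expi (dot z.1 z.2).
have mf : cmeasurable f.
  apply: cmeasurableM; last exact: cmeasurable_char2.
  apply: cmeasurable_rc; apply: (measurableT_comp _ measurable_fst).
  exact: measurable_exp_l1.
have iw : mu.-integrable setT (EFin \o (fun u : V => wexp u)) by exact: integrable_exp_l1.
have [|_ _ h] := cFubini mf _ iw (finite_integrable_cst p 1).
  by move=> u y; rewrite normcM normc_expi normc_rc ger0_norm ?wexp_ge0.
have mw : cmeasurable (fun u : V => (expR (l1 u))%:C : R[i]).
  apply: cmeasurable_rc; have := @measurable_exp_l1 R m (-1).
  by under eq_fun do rewrite opprK mul1r.
have := cmeasurableM mw h; congr cmeasurable; apply/funext => u.
rewrite /f /= (CintZ _ (cintegrable_char_finite p u)) mulrA -rcM /wexp -expRD mulN1r subrr.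
by rewrite expR0 mul1r.
Qed.

Section fourier.
Variable nu : cmeasure R V.

Lemma fourier_charf (p1 q1 p2 q2 : {finite_measure set V -> \bar R}) :
  (forall f, cmeas_integral nu f = (Cint p1 f - Cint q1 f) + ic * (Cint p2 f - Cint q2 f)) ->
  forall u, fourier nu u = (charf p1 (- u) - charf q1 (- u)) + ic * (charf p2 (- u) - charf q2 (- u)).
Proof.
move=> E u; rewrite /fourier E /charf.
by rewrite (_ : (fun x => expi (- dot u x)) = (fun x => expi (dot (- u) x)))//;
  apply/funext => x; rewrite dotNl.
Qed.

Lemma cmeasurableN d (T : measurableType d) (f : T -> R[i]) : cmeasurable f ->
  cmeasurable (fun x => - f x).
Proof.
move=> mf; have := cmeasurableM (cmeasurable_cst _ (-1)) mf.
by under eq_fun do rewrite mulN1r.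
Qed.

Lemma rcontN (a : 'rV[R]_m -> R[i]) : rcont a -> rcont (fun u => - a u).
Proof.
move=> ca; have := rcontM (rcont_cst (-1)) ca.
by under eq_fun do rewrite mulN1r.
Qed.

Lemma fourier_regular : cmeasurable (fourier nu : V -> R[i]) /\ rcont (fourier nu).
Proof.
have [p1 [q1 [p2 [q2 [_ _ _ E]]]]] := cmeas_integral_jordan nu.
have F := fourier_charf E; rewrite (_ : fourier nu = fun u =>
  (charf p1 (- u) - charf q1 (- u)) + ic * (charf p2 (- u) - charf q2 (- u))); last exact/funext.
have mN : measurable_fun setT (fun u : V => - u : V).
  have := @measurable_affineV R m (-1) 0.
  by under eq_fun do rewrite scaleN1r addr0.
have mc (p : {finite_measure set V -> \bar R}) : cmeasurable (fun u : V => charf p (- u : 'rV[R]_m)).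
  exact: (cmeasurable_comp mN (cmeasurable_charf p)).
have rc (p : {finite_measure set V -> \bar R}) : rcont (fun u : 'rV[R]_m => charf p (- u)).
  move=> u z; have := rcont_charf p (- u) (- z).
  by under eq_fun do rewrite scalerN -opprD.
split.
  apply: cmeasurableD; first exact: (cmeasurableD (mc p1) (cmeasurableN (mc q1))).
  apply: cmeasurableM; first exact: cmeasurable_cst.
  exact: (cmeasurableD (mc p2) (cmeasurableN (mc q2))).
apply: rcontD; first exact: (rcontD (rc p1) (rcontN (rc q1))).
apply: rcontM; first exact: rcont_cst.
exact: (rcontD (rc p2) (rcontN (rc q2))).
Qed.

Section density.
Variable (B : R).
Hypotheses (is_ : cintegrable mu (fourier nu : V -> R[i]))
  (sB : forall u, normc (fourier nu u) <= B)
  (ii : cintegrable mu (ift (fourier nu) : V -> R[i])).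

Definition density (x : 'rV[R]_m) : R[i] := (((2 * pi) ^+ m)^-1)%:C * ift (fourier nu) x.

Lemma cintegrable_density : cintegrable mu (density : V -> R[i]).
Proof. exact: cintegrableZ. Qed.

Let mK := cintegrable_cmeasurable cintegrable_density.

Let ire : mu.-integrable setT (EFin \o (fun x : V => cre (density x))).
Proof. by case: cintegrable_density. Qed.

Let iim : mu.-integrable setT (EFin \o (fun x : V => cim (density x))).
Proof. by case: cintegrable_density. Qed.

Let icharM (k : V -> R) (u : 'rV[R]_m) : mu.-integrable setT (EFin \o k) ->
  cintegrable mu (fun y : V => expi (dot u y) * (k y)%:C).
Proof.
move=> ik; under eq_fun do rewrite mulrC.
apply: (cintegrableM_bounded (B := 1)); first exact: cintegrable_rc.
  exact: cmeasurable_char'.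
by move=> y; rewrite normc_expi.
Qed.

Let splitK (f : V -> R[i]) (C : R) : cmeasurable f -> (forall x, normc (f x) <= C) ->
  Cint mu (fun x => f x * density x) =
  Cint mu (fun x => f x * (cre (density x))%:C) + ic * Cint mu (fun x => f x * (cim (density x))%:C).
Proof.
move=> mf fC.
have i1 : cintegrable mu (fun x : V => f x * (cre (density x))%:C).
  under eq_fun do rewrite mulrC.
  by apply: (cintegrableM_bounded (B := C)) => //; exact: cintegrable_rc.
have i2 : cintegrable mu (fun x : V => f x * (cim (density x))%:C).
  under eq_fun do rewrite mulrC.
  by apply: (cintegrableM_bounded (B := C)) => //; exact: cintegrable_rc.
rewrite -(CintZ ic i2) -(CintD i1 (cintegrableZ ic i2)); apply: eq_Cint => x.
by apply: ceqP; rewrite !cE /=; ring.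
Qed.

Let density_fourier u : Cint mu (fun y : V => expi (dot u y) * density y) = fourier nu (- u).
Proof.
have [_ rc] := fourier_regular.
have h := fourier_inversion (- u) is_ sB rc ii.
have pi0 : (2 * pi) ^+ m != 0 :> R by rewrite expf_neq0// mulf_neq0// gt_eqF// pi_gt0.
rewrite /density.
have i0 : cintegrable mu (fun y : V => ift (fourier nu) y * expi (- dot (- u) y)).
  apply: (cintegrableM_bounded (B := 1)) => //.
    rewrite (_ : (fun y => _) = (fun y : V => expi (dot u y))).
      exact: cmeasurable_char'.
    by apply/funext => y; rewrite dotNl opprK.
  by move=> y; rewrite normc_expi.
have := CintZ (((2 * pi) ^+ m)^-1)%:C i0; rewrite h mulrA -rcM mulVf// mul1r => <-.
by apply: eq_Cint => y; rewrite dotNl opprK; ring.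
Qed.

(** The Fourier transforms of the real and imaginary parts are separated by
    conjugation, since these parts are real measures. *)
Let charf_parts (p1 q1 p2 q2 : {finite_measure set V -> \bar R}) :
  (forall f, cmeas_integral nu f = (Cint p1 f - Cint q1 f) + ic * (Cint p2 f - Cint q2 f)) ->
  forall u, charf p1 u - charf q1 u = Cint mu (fun y : V => expi (dot u y) * (cre (density y))%:C) /\
            charf p2 u - charf q2 u = Cint mu (fun y : V => expi (dot u y) * (cim (density y))%:C).
Proof.
move=> E u.
pose a v := charf p1 v - charf q1 v; pose b v := charf p2 v - charf q2 v.
pose c v := Cint mu (fun y : V => expi (dot v y) * (cre (density y))%:C).
pose e v := Cint mu (fun y : V => expi (dot v y) * (cim (density y))%:C).
have key v : a v + ic * b v = c v + ic * e v.
  rewrite /c /e -(splitK (C := 1) (cmeasurable_char' v)); last by move=> y; rewrite normc_expi.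
  by rewrite density_fourier (fourier_charf E) opprK.
have aN v : a (- v) = conjc (a v) by rewrite /a !charfN rmorphB.
have bN v : b (- v) = conjc (b v) by rewrite /b !charfN rmorphB.
have kN (k : V -> R) v : mu.-integrable setT (EFin \o k) ->
    Cint mu (fun y : V => expi (dot (- v) y) * (k y)%:C) =
    conjc (Cint mu (fun y : V => expi (dot v y) * (k y)%:C)).
  move=> ik; rewrite -(Cint_conj (icharM v ik)); apply: eq_Cint => y.
  by rewrite dotNl expiN rmorphM; congr (_ * _); apply: ceqP; rewrite /= ?oppr0.
have cN v : c (- v) = conjc (c v) by exact: kN.
have eN v : e (- v) = conjc (e v) by exact: kN.
have := key u; have := key (- u); rewrite aN bN cN eN -/(a u) -/(b u) -/(c u) -/(e u).
case: (a u) (b u) (c u) (e u) => [a1 a2] [b1 b2] [c1 c2] [e1 e2].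
move=> k1 k2.
have := congr1 (@complex.Re _) k1; have := congr1 (@complex.Im _) k1.
have := congr1 (@complex.Re _) k2; have := congr1 (@complex.Im _) k2.
rewrite /=; rewrite !mul0r !mul1r => h1 h2 h3 h4.
by split; apply: ceqP => /=; lra.
Qed.

Lemma density_has_density : has_density nu density.
Proof.
have [p1 [q1 [p2 [q2 [E1 E2 _ E]]]]] := cmeas_integral_jordan nu.
have hp := charf_parts E.
split; first exact: cintegrable_density.
move=> A mA; split.
  rewrite (E1 _ mA) (signed_density_set ire (fun u => proj1 (hp u)) mA).
  by rewrite addeAC subee ?add0e// fin_num_measure.
rewrite (E2 _ mA) (signed_density_set iim (fun u => proj2 (hp u)) mA).
by rewrite addeAC subee ?add0e// fin_num_measure.
Qed.

Lemma density_abs_continuous : abs_continuous nu.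
Proof.
have [_ h] := density_has_density; split; apply/null_content_dominatesP => A mA A0.
  have [-> _] := h A mA; apply: null_set_integral => //.
  by apply: measurable_funTS; exact: measurable_int ire.
have [_ ->] := h A mA; apply: null_set_integral => //.
by apply: measurable_funTS; exact: measurable_int iim.
Qed.

(** The Jordan parts are absolutely continuous, so an essentially bounded [f] may be
    replaced by a bounded function. *)
Lemma cmeas_integral_density (f g : V -> R[i]) (C : R) : cmeasurable f -> cmeasurable g ->
  {ae mu, forall x, f x = g x} -> (forall x, normc (g x) <= C) ->
  cmeas_integral nu f = Cint mu (fun x => g x * density x).
Proof.
have [p1 [q1 [p2 [q2 [_ _ ac E]]]]] := cmeas_integral_jordan nu.
have [[a1 a2] [a3 a4]] := ac density_abs_continuous.
have hp := charf_parts E.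
move=> mf mg fg gC; rewrite E.
have ae (p : {finite_measure set V -> \bar R}) : p `<< mu -> Cint p f = Cint p g.
  move=> /null_content_dominatesP pm; apply: ae_eq_Cint => //.
  by case: fg => N [mN N0 sN]; exists N; split => //; exact: pm.
rewrite (ae _ a1) (ae _ a2) (ae _ a3) (ae _ a4).
rewrite (signed_density_Cint ire (fun u => proj1 (hp u)) mg gC).
by rewrite (signed_density_Cint iim (fun u => proj2 (hp u)) mg gC) (splitK mg gC).
Qed.

End density.

End fourier.

End complex_measure.

(** * Holomorphic extension *)

Section complex_shift.
Variable R : realType.
Local Open Scope complex_scope.
Variable m : nat.
Local Notation ic := (0 +i* 1 : R[i]).

(** Coefficients of the form [u |-> i u . (x + i y)]. *)
Definition icoef (x y : 'rV[R]_m) : 'I_m -> R[i] := fun j => - y ord0 j +i* x ord0 j.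

Lemma cexp_icoef x y u : cexp (lin (icoef x y) u) = cexp (lin (ecoef y) u) * expi (dot u x).
Proof.
rewrite -cexp_im -cexpD; congr cexp; rewrite /lin.
apply: ceqP; rewrite ?reD ?imD ?re_sum ?im_sum /= ?addr0.
  by apply: eq_bigr => j _; rewrite /=; ring.
rewrite [X in X + _]big1 ?add0r => [|j _]; last by rewrite /=; ring.
by apply: eq_bigr => j _; rewrite /=; ring.
Qed.

Lemma gsym_shift h phi2 (Y y x u : 'rV[R]_m) :
  gsym h phi2 (Y + y) u * expi (dot u x) = gsym h phi2 Y u * cexp (lin (icoef x y) u).
Proof.
rewrite cexp_icoef mulrA; congr (_ * _); rewrite /gsym -cexpD; congr cexp.
rewrite -addrA; congr (_ + _); rewrite /lin -big_split; apply: eq_bigr => j _ /=.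
by rewrite -mulrDl /ecoef -rmorphD mxE opprD.
Qed.

Section functional.
Variables (C : R) (L : ('rV[R]_m -> R[i]) -> R[i]).
Hypothesis sL : symfun C L.

Lemma symfun_quadratic a D c (t : R) : sym D (-3) a -> (forall i, normc (c i) <= t) -> 0 <= t <= 1 ->
  normc (L (fun u => a u * cexp (lin c u)) - L a - L (fun u => a u * lin c u))
    <= C * (2 ^+ (2 * m) * D) * t ^+ 2.
Proof.
move=> sa ct /andP[tge0 t1]; have [LD LZ Lb] := sL.
have D0 := sym_ge0 sa.
have C0 : 0 <= C * (2 ^+ (2 * m) * D).
  have := le_trans (cnorm_ge0 _) (Lb _ _ (sym_le sa (lexx D) (ltac:(lra) : -3 <= -1))).
  by rewrite mulrCA => h; rewrite mulr_ge0 ?exprn_ge0.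
pose c' i := ((`|t|)^-1)%:C * c i.
have c'1 i : normc (c' i) <= 1.
  rewrite normcM normc_rc ger0_norm ?invr_ge0//.
  have [t0|t0] := eqVneq t 0; first by rewrite t0 normr0 invr0 mul0r.
  by rewrite mulrC ler_pdivrMr ?normr_gt0// mul1r (le_trans (ct i))// ler_norm.
have cE u : lin c u = `|t|%:C * lin c' u.
  rewrite /lin mulr_sumr; apply: eq_bigr => i _; rewrite /c' !mulrA -rcM.
  have [t0|t0] := eqVneq t 0; last by rewrite mulfV ?mul1r// normr_eq0.
  have -> : c i = 0.
    by apply/eq0_normc/eqP; rewrite eq_le cnorm_ge0 andbT -t0 ct.
  by rewrite !mulr0 mul0r.
have tt : `| `|t| | <= 1 by rewrite normr_id ger0_norm.
have := symfun_line sL sa c'1 tt; rewrite real_normK ?num_real//.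
have s1 := symM sa (sym_lin c'1); rewrite (_ : -3 + 2 = -1) in s1; last by ring.
rewrite -(LZ _ _ _ s1).
rewrite (_ : (fun u => a u * cexp (lin c u)) = (fun u => a u * cexp (`|t|%:C * lin c' u))); last first.
  by apply/funext => u; rewrite cE.
rewrite (_ : (fun u => a u * lin c u) = (fun u => `|t|%:C * (a u * lin c' u)))//.
by apply/funext => u; rewrite cE mulrCA.
Qed.

End functional.

End complex_shift.

Section holomorphic.
Variable R : realType.
Local Open Scope complex_scope.
Variable m : nat.
Local Notation ic := (0 +i* 1 : R[i]).
Local Notation K := (Cfield R).

Definition cre_row (z : 'rV[K]_m) : 'rV[R]_m := \row_j cre (z ord0 j).
Definition cim_row (z : 'rV[K]_m) : 'rV[R]_m := \row_j cim (z ord0 j).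

Lemma normr_normc (z : K) : `|z| = (normc (z : R[i]))%:C.
Proof. by rewrite normc_def normcE. Qed.

Lemma le_mx_norm (w : 'rV[K]_m) j : `|w ord0 j| <= `|w|.
Proof.
rewrite [leRHS]/Num.norm /= mx_normE -[leLHS]nngE num_le.
exact: (le_bigmax _ _ (ord0, j)).
Qed.

Lemma normc_le_mx_norm (w : 'rV[K]_m) j : normc (w ord0 j : R[i]) <= cre (`|w| : R[i]).
Proof. by have := le_mx_norm w j; rewrite normr_normc lecE /= => /andP[]. Qed.

Lemma mx_norm_real (w : 'rV[K]_m) : (`|w| : R[i]) = (cre (`|w| : R[i]))%:C.
Proof.
have := normr_ge0 w; rewrite lecE /= => /andP[/eqP w0 _].
by apply: ceqP => //=.
Qed.

Section linear_part.
Variable d : 'cV[K]_m.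

Definition rowform (w : 'rV[K]_m) : K^o := \sum_j w ord0 j * d j ord0.

Let rowform_linear : linear rowform.
Proof.
move=> a u v; rewrite /rowform scaler_sumr -big_split; apply: eq_bigr => j _ /=.
by rewrite !mxE mulrDl [_ *: (_ * _)]mulrA.
Qed.

HB.instance Definition _ := @GRing.isLinear.Build K 'rV[K]_m K^o _ rowform rowform_linear.

Lemma continuous_rowform : continuous (rowform : 'rV[K]_m -> K^o).
Proof.
rewrite /rowform; elim: (index_enum _) => [|j r IH] w.
  by under eq_fun do rewrite big_nil; exact: cst_continuous.
under eq_fun do rewrite big_cons.
exact: (cvgD (cvgM (@coord_continuous K 1 m ord0 j w) (@cst_continuous 'rV[K]_m K^o _ w)) (IH w)).
Qed.

(** A remainder of size [|w|^2], uniformly in the direction of [w], is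
    negligible against [|w|]. *)
Lemma differentiable_quadratic (f : 'rV[K]_m -> K^o) (z : 'rV[K]_m) (C : R) :
  (forall w : 'rV[K]_m, cre (`|w| : R[i]) <= 1 ->
    normc ((f (w + z) - f z - rowform w : K) : R[i]) <= C * cre (`|w| : R[i]) ^+ 2) ->
  differentiable f z.
Proof.
move=> H.
have E : f \o shift z = cst (f z) + (rowform : 'rV[K]_m -> K^o) +o_ (0 : 'rV[K]_m) id.
  apply/eqaddoP => eps eps0.
  have : (0 < eps :> R[i]) by [].
  rewrite ltcE /= => /andP[/eqP ei er].
  pose t : R := Num.min 1 (cre (eps : R[i]) / (`|C| + 1)).
  have C1 : 0 < `|C| + 1 by rewrite ltr_wpDl.
  have t0 : 0 < t by rewrite lt_min ltr01 divr_gt0.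
  have tC : (0 : K) < (t%:C : R[i]) by rewrite ltcE /= eqxx t0.
  apply: filterS (nbhs0_lt tC) => w; rewrite mx_norm_real ltcE /= => /andP[_ wt].
  set s := cre (`|w| : R[i]) in wt *.
  have s0 : 0 <= s by have := normr_ge0 w; rewrite lecE /= => /andP[].
  have s1 : s <= 1 by rewrite ltW// (lt_le_trans wt)// ge_min lexx.
  have se : s <= cre (eps : R[i]) / (`|C| + 1) by rewrite ltW// (lt_le_trans wt)// ge_min lexx orbT.
  have h := H w s1.
  have -> : ((f \o shift z) - (cst (f z) + (rowform : 'rV[K]_m -> K^o))) w =
      f (w + z) - f z - rowform w by rewrite !fctE /= opprD addrA.
  rewrite (normr_normc (f (w + z) - f z - rowform w)).
  have -> : (eps : R[i]) = (cre (eps : R[i]))%:C by apply: ceqP => /=.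
  rewrite -[X in _ <= X]rcM lecE /= eqxx /=.
  apply: (le_trans h); rewrite -/s expr2 mulrA ler_wpM2r//.
  rewrite ler_pdivlMr// mulrC in se.
  apply: (@le_trans _ _ ((`|C| + 1) * s)).
    by rewrite ler_wpM2r// (le_trans (ler_norm _))// lerDl.
  exact: se.
have dE := diff_unique continuous_rowform E.
by apply/diff_locallyP; rewrite dE; split => //; exact: continuous_rowform.
Qed.

End linear_part.

Variables (h : R) (phi2 : 'rV[R]_m -> R[i]).
Variables (C : R) (N : 'rV[R]_m -> ('rV[R]_m -> R[i]) -> R[i]).
Hypothesis sN : forall X, symfun C (N X).
Hypothesis shiftN : forall X x a, N (X + x) a = N X (fun u => a u * expi (dot u x)).
Hypothesis sg : forall Y, exists D, sym D (-3) (gsym h phi2 Y).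

(** The derivative in the direction [j] is the functional applied to the symbol
    multiplied by [i u_j]; a complex displacement is treated like a real one. *)
Lemma holomorphic_symfun :
  holomorphic (fun z : 'rV[K]_m => N (cre_row z) (gsym h phi2 (cim_row z)) : K).
Proof.
move=> z; have [D sD] := sg (cim_row z).
set X := cre_row z; set Y := cim_row z in sD *.
have [ND NZ _] := sN X.
pose delta (j : 'I_m) : 'I_m -> R[i] := fun i => ((i == j)%:R : R)%:C.
have dle j i : normc (delta j i) <= 1.
  by rewrite normc_rc; case: (i == j); rewrite ?normr1 ?normr0.
have linE (j : 'I_m) u : lin (delta j) u = (u ord0 j)%:C.
  rewrite /lin (bigD1 j)//= /delta eqxx mul1r big1 ?addr0// => i ij.
  by rewrite (negbTE ij) mul0r.
have sl j : sym (2 ^+ (2 * m) * (D * 2)) (-1) (fun u => gsym h phi2 Y u * lin (delta j) u).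
  have := symM sD (sym_lin (dle j)); rewrite (_ : -3 + 2 = -1)//; ring.
pose d : 'cV[K]_m := \col_j (ic * N X (fun u => gsym h phi2 Y u * lin (delta j) u) : K).
apply: (@differentiable_quadratic d _ _ (C * (2 ^+ (2 * m) * D))) => w w1.
pose x := cre_row w; pose y := cim_row w.
have ct i : normc (icoef x y i) <= cre (`|w| : R[i]).
  apply: le_trans (normc_le_mx_norm w i); rewrite /icoef !mxE !normcE /= sqrrN.
  by rewrite addrC.
have w0 : 0 <= cre (`|w| : R[i]) by have := normr_ge0 w; rewrite lecE /= => /andP[].
have w01 : 0 <= cre (`|w| : R[i]) <= 1 by rewrite w0.
have := symfun_quadratic (sN X) sD ct w01.
have -> : N X (fun u => gsym h phi2 Y u * cexp (lin (icoef x y) u)) =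
    N (cre_row (w + z)) (gsym h phi2 (cim_row (w + z))).
  have -> : cre_row (w + z) = X + x by apply/rowP => j; rewrite !mxE reD addrC.
  have -> : cim_row (w + z) = Y + y by apply/rowP => j; rewrite !mxE imD addrC.
  by rewrite shiftN; congr (N X _); apply/funext => u; rewrite gsym_shift.
suff -> : N X (fun u => gsym h phi2 Y u * lin (icoef x y) u) = rowform d w by [].
have [e _] := symfun_sum (sN X) (index_enum 'I_m)
  (fun j => symZ (ic * (w ord0 j : R[i])) (sl j)).
rewrite (_ : (fun u => _) = (fun u => \sum_j ic * (w ord0 j : R[i]) *
    (gsym h phi2 Y u * lin (delta j) u))); last first.
  apply/funext => u; rewrite [in LHS]/lin mulr_sumr; apply: eq_bigr => j _.
  rewrite linE /icoef [RHS]mulrCA mulrA -mulrA; congr (_ * _).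
  by rewrite !mxE; case: (w ord0 j) => p q; apply: ceqP => /=; ring.
rewrite e /rowform; apply: eq_bigr => j _; rewrite (NZ _ _ _ (sl j)) mxE.
by rewrite mulrA [_ * (w ord0 j : R[i])]mulrC.
Qed.

End holomorphic.

(** * The extension to pairs of points *)

Section line_derivative.
Variable R : realType.
Local Open Scope complex_scope.
Variable m : nat.

Lemma is_derive_quadratic (f : R -> R) (d K : R) :
  (forall t, `|t| <= 1 -> `|f t - f 0 - t * d| <= K * t ^+ 2) -> is_derive (0 : R) 1 f d.
Proof.
move=> H; have h : t^-1 *: ((f \o shift 0) (t *: 1) - f 0) @[t --> 0^'] --> d.
  apply/cvgrPdist_le => e e0.
  pose s : R := Num.min 1 (e / (`|K| + 1)).
  have K1 : 0 < `|K| + 1 by rewrite ltr_wpDl.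
  have s0 : 0 < s by rewrite lt_min ltr01 divr_gt0.
  near=> t; have t0 : t != 0 by near: t; exact: nbhs_dnbhs_neq.
  have ts : `|t| <= s by near: t; exact: dnbhs0_le.
  have t1 : `|t| <= 1 by rewrite (le_trans ts)// ge_min lexx.
  have te : `|t| <= e / (`|K| + 1) by rewrite (le_trans ts)// ge_min lexx orbT.
  rewrite /= addr0 [t *: 1]mulr1 distrC.
  have -> : t^-1 *: (f t - f 0) - d = t^-1 * (f t - f 0 - t * d).
    by rewrite /GRing.scale /=; field.
  rewrite normrM normfV mulrC ler_pdivrMr ?normr_gt0//.
  apply: (le_trans (H t t1)); rewrite -real_normK ?num_real// expr2 mulrA ler_wpM2r//.
  rewrite ler_pdivlMr// mulrC in te; apply: le_trans te.
  by rewrite ler_wpM2r// (le_trans (ler_norm _))// lerDl.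
by split; [exact: (cvgP _ h)|exact: (cvg_lim _ h)].
Unshelve. all: by end_near. Qed.

Lemma derive_lineE (f : 'rV[R]_m -> R) x v d :
  is_derive (0 : R) 1 (fun t => f (x + t *: v)) d -> 'D_v (f : _ -> R^o) x = d.
Proof.
case=> _ <-.
have E : (fun t : R => t^-1 *: (((fun s => f (x + s *: v)) \o shift 0) (t *: (1 : R)) -
    f (x + 0 *: v))) = (fun t : R => t^-1 *: (((f : _ -> R^o) \o shift x) (t *: v) - (f : _ -> R^o) x)).
  by apply/funext => t /=; rewrite scale0r !addr0 [t *: 1]mulr1 [_ + x]addrC.
by rewrite /derive E.
Qed.

Lemma cpartial_quadratic (j : 'I_m) (f : 'rV[R]_m -> R[i]) x d (K : R) :
  (forall t : R, `|t| <= 1 ->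
     normc (f (x + t *: delta_mx ord0 j) - f x - t%:C * d) <= K * t ^+ 2) ->
  cpartial j f x = d.
Proof.
move=> H; apply: ceqP; rewrite /cpartial /=.
  apply: derive_lineE; apply: (@is_derive_quadratic _ _ K) => t t1.
  apply: le_trans (H t t1); rewrite scale0r addr0.
  by apply: le_trans (re_le_normc _); rewrite !reD !reN reZ.
apply: derive_lineE; apply: (@is_derive_quadratic _ _ K) => t t1.
apply: le_trans (H t t1); rewrite scale0r addr0.
by apply: le_trans (im_le_normc _); rewrite !imD !imN imZ.
Qed.

Lemma real_linear_sum (f : 'rV[R]_m -> R[i]) x :
  (forall x y, f (x + y) = f x + f y) -> (forall c x, f (c *: x) = c%:C * f x) ->
  f x = \sum_i (x ord0 i)%:C * f (delta_mx ord0 i).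
Proof.
move=> fD fZ; have f0 : f 0 = 0 by rewrite -(scale0r (0 : 'rV[R]_m)) fZ (_ : 0%:C = 0)// mul0r.
rewrite {1}(row_sum_delta x).
elim: (index_enum _) => [|i r IH]; first by rewrite !big_nil.
by rewrite !big_cons fD fZ IH.
Qed.

End line_derivative.

Section gaussian_Lfun.
Variable R : realType.
Variable m : nat.
Local Notation V := (borelV R m).
Local Notation mu := (lebesgueV R m).

Definition gauss (B theta : R) (v : V) : R := B * expR (- (theta * enorm (v : 'rV[R]_m) ^+ 2)).

Lemma measurable_gauss B theta : measurable_fun setT (gauss B theta).
Proof.
apply: measurable_funM => //; apply: measurableT_comp => //; apply: measurableT_comp => //.
apply: measurable_funM => //.
rewrite (_ : (fun v : V => _) = (fun v : V => dot (v : 'rV[R]_m) v)).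
  exact: (@measurable_dot _ _ _ _ id id (@measurable_id _ _ _) (@measurable_id _ _ _)).
by apply/funext => v; rewrite enorm_sqr /dot; apply: eq_bigr => i _; rewrite expr2.
Qed.

Lemma gauss_Lfun B theta : 0 <= B -> 0 < theta ->
  gauss B theta \in Lfun mu 1 /\ gauss B theta \in Lfun mu +oo%E.
Proof.
move=> B0 t0; have mg := measurable_gauss B theta.
have g0 v : 0 <= gauss B theta v by rewrite mulr_ge0 ?expR_ge0.
have gB v : gauss B theta v <= B.
  by rewrite ler_piMr// -[leRHS]expR0 ler_expR oppr_le0 mulr_ge0 ?sqr_ge0// ltW.
have ig : mu.-integrable setT (EFin \o gauss B theta).
  apply: (@integrable_le _ _ _ _ _ (fun u : V => B * expR (m%:R * (4 * theta)^-1) * wexp u)).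
  - exact: mg.
  - move=> v; rewrite ger0_norm// /gauss -mulrA ler_wpM2l// /wexp -expRD ler_expR.
    have -> : m%:R * (4 * theta)^-1 = \sum_(i < m) (4 * theta)^-1.
      by rewrite sumr_const card_ord mulr_natl.
    rewrite enorm_sqr /l1 !mulr_sumr -sumrN -big_split; apply: ler_sum => i _ /=.
    rewrite -[X in theta * X]real_normK ?num_real//; set x := `|_|.
    rewrite -subr_ge0 (_ : _ - _ = theta * (x - (2 * theta)^-1) ^+ 2).
      by rewrite mulr_ge0 ?sqr_ge0 ?ltW.
    by field; lra.
  - exact: integrable_wexp.
split; first by apply/Lfun1_integrable.
rewrite inE; apply/andP; split; rewrite inE /=; first exact: mg.
rewrite /finite_norm unlock /= lebesgueV_gt0.
apply: (@le_lt_trans _ _ B%:E); last exact: ltry.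
apply/ess_supP; apply: nearW => v /=.
by rewrite lee_fin ger0_norm.
Qed.

End gaussian_Lfun.

Section extension.
Variable R : realType.
Local Open Scope complex_scope.
Variable n : nat.
Local Notation ic := (0 +i* 1 : R[i]).
Local Notation m := (n + n)%N.

(** The complex structure for which the extension is holomorphic in the first
    variable and antiholomorphic in the second one. *)
Definition sympl (v : 'rV[R]_(n + n)) : 'rV[R]_(n + n) := row_mx (rsubmx v) (- lsubmx v).

Lemma symplD v w : sympl (v + w) = sympl v + sympl w.
Proof. by rewrite /sympl !linearD /= add_row_mx. Qed.

Lemma symplZ c v : sympl (c *: v) = c *: sympl v.
Proof. by rewrite /sympl !linearZ /= scale_row_mx. Qed.

Lemma symplN v : sympl (- v) = - sympl v.
Proof. by rewrite -[- v]scaleN1r symplZ scaleN1r. Qed.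

Lemma sympl_lshift v j : sympl v ord0 (lshift n j) = v ord0 (rshift n j).
Proof. by rewrite row_mxEl mxE. Qed.

Lemma sympl_rshift v j : sympl v ord0 (rshift n j) = - v ord0 (lshift n j).
Proof. by rewrite row_mxEr !mxE. Qed.

Lemma sympl_le (v : 'rV[R]_(n + n)) (c : R) : (forall i, `|v ord0 i| <= c) -> forall i, `|sympl v ord0 i| <= c.
Proof.
move=> vc i; case: (split_ordP i) => k ->; first by rewrite sympl_lshift.
by rewrite sympl_rshift normrN.
Qed.

Lemma enorm_sympl v : enorm (sympl v) ^+ 2 = enorm v ^+ 2.
Proof.
rewrite !enorm_sqr !big_split_ord /= addrC; congr (_ + _); apply: eq_bigr => i _.
  by rewrite sympl_rshift sqrrN.
by rewrite sympl_lshift.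
Qed.

Variables (h : R) (phi2 : 'rV[R]_(n + n) -> R[i]).
Variables (C r : R) (N : 'rV[R]_(n + n) -> ('rV[R]_(n + n) -> R[i]) -> R[i]).
Hypothesis C0 : 0 <= C.
Hypothesis sN : forall X, symfun C (N X).
Hypothesis shiftN : forall X x a, N (X + x) a = N X (fun u => a u * expi (dot u x)).
Hypothesis sg : forall kap, exists2 D : R, 0 <= D &
  forall Y, sym (D * expR (r * enorm Y ^+ 2)) kap (gsym h phi2 Y).

(** The functional is evaluated at the complex point
    [(X + Y) / 2 + i sympl (X - Y) / 2], which is [X] on the diagonal. *)
Definition ext (X Y : 'rV[R]_(n + n)) : R[i] :=
  N (2^-1 *: (X + Y)) (gsym h phi2 (2^-1 *: sympl (X - Y))).

(** The symbol by which a displacement of the two points acts. *)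
Let dcoef (a b : 'rV[R]_(n + n)) := icoef (2^-1 *: (a + b)) (2^-1 *: sympl (a - b)).

Lemma ext_shift X Y a b : ext (X + a) (Y + b) =
  N (2^-1 *: (X + Y)) (fun u => gsym h phi2 (2^-1 *: sympl (X - Y)) u * cexp (lin (dcoef a b) u)).
Proof.
have E : 2^-1 *: sympl (X + a - (Y + b)) = 2^-1 *: sympl (X - Y) + 2^-1 *: sympl (a - b).
  by rewrite opprD addrACA (symplD (X - Y)) scalerDr.
rewrite /ext addrACA scalerDr shiftN E; congr (N _ _); apply/funext => u.
exact: gsym_shift.
Qed.

(** [sympl] is an isometry, so the imaginary part has norm [|X - Y| / 2]. *)
Lemma ext_bound : exists2 B : R, 0 <= B &
  forall X Y, normc (ext X Y) <= B * expR (r / 4 * enorm (X - Y) ^+ 2).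
Proof.
have [D D0 sD] := sg (-1); exists (C * D); first exact: mulr_ge0.
move=> X Y; have [_ _ Nb] := sN (2^-1 *: (X + Y)).
apply: (le_trans (Nb _ _ (sD _))); rewrite mulrA ler_wpM2l ?mulr_ge0// ler_expR.
rewrite -symplZ enorm_sympl !enorm_sqr !mulr_sumr le_eqVlt; apply/orP; left; apply/eqP.
by apply: eq_bigr => i _; rewrite mxE; field.
Qed.

Let icoefD (x y x' y' : 'rV[R]_(n + n)) j : icoef (x + x') (y + y') j = icoef x y j + icoef x' y' j.
Proof. by rewrite /icoef !mxE opprD. Qed.

Let icoefZ c (x y : 'rV[R]_(n + n)) j : icoef (c *: x) (c *: y) j = c%:C * icoef x y j.
Proof. by rewrite /icoef !mxE; apply: ceqP => /=; ring. Qed.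

Let dcoefD a b a' b' u : lin (dcoef (a + a') (b + b')) u = lin (dcoef a b) u + lin (dcoef a' b') u.
Proof.
rewrite /lin -big_split; apply: eq_bigr => j _ /=; rewrite -mulrDl; congr (_ * _).
by rewrite /dcoef -icoefD -!scalerDr -symplD opprD (addrACA a a' b) (addrACA a a' (- b)).
Qed.

Let dcoefZ c a b u : lin (dcoef (c *: a) (c *: b)) u = c%:C * lin (dcoef a b) u.
Proof.
rewrite /lin mulr_sumr; apply: eq_bigr => j _; rewrite mulrA; congr (_ * _).
rewrite /dcoef -icoefZ -scalerBr -scalerDr symplZ.
by congr (icoef _ _ _); rewrite !scalerA mulrC.
Qed.

Let dcoef_le (a b : 'rV[R]_(n + n)) : (forall i, `|a ord0 i + b ord0 i| <= 1) ->
  (forall i, `|a ord0 i - b ord0 i| <= 1) -> forall i, normc (dcoef a b i) <= 1.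
Proof.
move=> h1 h2 i; rewrite (le_trans (normc_le_reim _))//= normrN.
have e1 : `|(2^-1 *: (a + b)) ord0 i| <= 2^-1.
  by rewrite !mxE normrM ger0_norm ?invr_ge0// ler_piMr ?invr_ge0.
have e2 : `|(2^-1 *: sympl (a - b)) ord0 i| <= 2^-1.
  rewrite mxE normrM ger0_norm ?invr_ge0// ler_piMr ?invr_ge0//.
  by apply: sympl_le => k; rewrite !mxE.
by apply: (le_trans (lerD e2 e1)); lra.
Qed.

Let delta_le (i : 'I_(n + n)) k : `|(delta_mx ord0 i : 'rV[R]_(n + n)) ord0 k| <= 1.
Proof. by rewrite mxE; case: (_ && _); rewrite ?normr1 ?normr0. Qed.

Lemma ext_analytic : real_analytic (fun Z : 'rV[R]_((n + n) + (n + n)) =>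
  ext (lsubmx Z) (rsubmx Z)).
Proof.
move=> Z; pose X := lsubmx Z; pose Y := rsubmx Z.
have [D _ sD] := sg (- (1 + (m + m)%:R * 2)).
pose c (i : 'I_(m + m)) := dcoef (lsubmx (delta_mx ord0 i)) (rsubmx (delta_mx ord0 i)).
have c1 i j : normc (c i j) <= 1.
  apply: dcoef_le => k; rewrite !mxE; case: (split_ordP i) => l ->;
    rewrite ?eq_lshift ?eq_rshift ?eq_lrshift ?eq_rlshift ?andbF /=;
    by rewrite ?addr0 ?subr0 ?add0r ?sub0r ?normrN; case: (_ == _); rewrite ?normr0 ?normr1.
have [cf hcf] := symfun_analytic (sN (2^-1 *: (X + Y))) c1 (sD (2^-1 *: sympl (X - Y))).
exists cf, (1 / 2); split; first by lra.
move=> y y2; have [h1 h2] := hcf y y2; split; first exact: h1.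
rewrite !linearD /= (_ : ext _ _ = N (2^-1 *: (X + Y)) (fun u =>
  gsym h phi2 (2^-1 *: sympl (X - Y)) u * cexp (\sum_i (y ord0 i)%:C * lin (c i) u)))//.
rewrite ext_shift; congr (N _ _); apply/funext => u; congr (_ * cexp _).
apply: (@real_linear_sum R _ (fun y => lin (dcoef (lsubmx y) (rsubmx y)) u)).
  by move=> y1 y3; rewrite !linearD /= dcoefD.
by move=> s y1; rewrite !linearZ /= dcoefZ.
Qed.

Let cpartial_ext (j : 'I_(n + n)) X Y (a b : 'rV[R]_(n + n)) : (forall i, normc (dcoef a b i) <= 1) ->
  forall f : 'rV[R]_(n + n) -> R[i], forall x,
  (forall t : R, f (x + t *: delta_mx ord0 j) = ext (X + t *: a) (Y + t *: b)) ->
  cpartial j f x = N (2^-1 *: (X + Y))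
    (fun u => gsym h phi2 (2^-1 *: sympl (X - Y)) u * lin (dcoef a b) u).
Proof.
move=> c1 f x fE; have [D _ sD] := sg (-3).
have sD' := sD (2^-1 *: sympl (X - Y)).
apply: cpartial_quadratic => t t1.
have := symfun_line (sN (2^-1 *: (X + Y))) sD' c1 t1; rewrite fE ext_shift.
have -> : f x = ext X Y by have := fE 0; rewrite !scale0r !addr0.
congr (normc (N _ _ - _ - _) <= _); apply/funext => u; congr (_ * cexp _).
by rewrite dcoefZ.
Qed.

Let CR_aux (s : R[i]) (a b a' b' X Y : 'rV[R]_(n + n)) : (forall i, normc (dcoef a b i) <= 1) ->
  (forall i, dcoef a' b' i = s * dcoef a b i) ->
  N (2^-1 *: (X + Y)) (fun u => gsym h phi2 (2^-1 *: sympl (X - Y)) u * lin (dcoef a' b') u) =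
  s * N (2^-1 *: (X + Y)) (fun u => gsym h phi2 (2^-1 *: sympl (X - Y)) u * lin (dcoef a b) u).
Proof.
move=> c1 cs; have [_ NZ _] := sN (2^-1 *: (X + Y)); have [D _ sD] := sg (-3).
have := symM (sD (2^-1 *: sympl (X - Y))) (sym_lin c1).
rewrite (_ : -3 + 2 = -1); last by ring.
move=> /NZ <-; congr (N _ _); apply/funext => u; rewrite mulrCA; congr (_ * _).
by rewrite /lin mulr_sumr; apply: eq_bigr => i _; rewrite cs mulrA.
Qed.

(** The linear forms attached to two conjugate coordinates differ by a factor
    [i] for the first point, and [- i] for the second one. *)
Lemma ext_cauchy_riemann (j : 'I_n) X Y :
  cpartial (lshift n j) (fun X' => ext X' Y) X +
    ic * cpartial (rshift n j) (fun X' => ext X' Y) X = 0 /\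
  cpartial (lshift n j) (fun Y' => ext X Y') Y -
    ic * cpartial (rshift n j) (fun Y' => ext X Y') Y = 0.
Proof.
pose e (i : 'I_(n + n)) : 'rV[R]_(n + n) := delta_mx ord0 i.
have l1 i k : normc (dcoef (e i) 0 k) <= 1.
  by apply: dcoef_le => l; rewrite [_ 0 _ _]mxE ?addr0 ?subr0 delta_le.
have l2 i k : normc (dcoef 0 (e i) k) <= 1.
  by apply: dcoef_le => l; rewrite [(0 : 'rV_ _) _ _]mxE ?add0r ?sub0r ?normrN delta_le.
have p1 i := @cpartial_ext i X Y (e i) 0 (l1 i) (fun X' => ext X' Y) X
  (fun t => ltac:(by rewrite scaler0 addr0)).
have p2 i := @cpartial_ext i X Y 0 (e i) (l2 i) (fun Y' => ext X Y') Y
  (fun t => ltac:(by rewrite scaler0 addr0)).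
have E1 : sympl (e (rshift n j)) = e (lshift n j).
  apply/rowP => k; case: (split_ordP k) => l ->; rewrite ?sympl_lshift ?sympl_rshift !mxE
    ?eq_lshift ?eq_rshift ?eq_lrshift ?eq_rlshift ?oppr0 //=.
have E2 : sympl (e (lshift n j)) = - e (rshift n j).
  apply/rowP => k; case: (split_ordP k) => l ->; rewrite ?sympl_lshift ?sympl_rshift !mxE
    ?eq_lshift ?eq_rshift ?eq_lrshift ?eq_rlshift ?oppr0 //=.
rewrite !p1 !p2; split.
  rewrite (@CR_aux ic (e (lshift n j)) 0 (e (rshift n j)) 0)//.
    rewrite mulrA (_ : ic * ic = -1); first by rewrite mulN1r subrr.
    by apply: ceqP => /=; ring.
  move=> i; rewrite /dcoef !addr0 !subr0 E1 E2 !icoefZ mulrCA; congr (_ * _).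
  by rewrite /icoef !mxE; apply: ceqP => /=; ring.
rewrite (@CR_aux (- ic) 0 (e (lshift n j)) 0 (e (rshift n j)))//.
  rewrite mulrA (_ : ic * - ic = 1); first by rewrite mul1r subrr.
  by apply: ceqP => /=; ring.
move=> i; rewrite /dcoef !add0r !symplN E1 E2 opprK !icoefZ mulrCA; congr (_ * _).
by rewrite /icoef !mxE; apply: ceqP => /=; ring.
Qed.

(** The gap between [r] and [1 / kappa] leaves a Gaussian of [X - Y]. *)
Lemma D_class_symfun (kappa : R) (F : 'rV[R]_(n + n) -> R[i]) : 0 < kappa -> r < kappa^-1 ->
  (forall X, N X (gsym h phi2 0) = F X) -> D_class kappa F.
Proof.
move=> k0 rk NF; have [B B0 hB] := ext_bound.
exists ext; split.
- exact: ext_analytic.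
- by move=> j X Y; exact: ext_cauchy_riemann.
- move=> X; rewrite -NF /ext subrr.
  have -> : sympl 0 = 0 by have := symplZ 0 0; rewrite !scale0r.
  have -> : 2^-1 *: (X + X) = X.
    by rewrite -[X + X]mulr2n -[X *+ 2]scaler_nat scalerA mulVf ?scale1r// pnatr_eq0.
  by rewrite scaler0.
pose theta := (4 * kappa)^-1 - r / 4.
have t0 : 0 < theta.
  by rewrite /theta invfM subr_gt0 mulrC ltr_pM2l// invr_gt0.
have [g1 g2] := @gauss_Lfun R (n + n) B theta B0 t0.
exists (gauss B theta); split => // X Y.
rewrite /gauss mulrCA -expRD; apply: (le_trans (hB X Y)).
rewrite ler_wpM2l// ler_expR le_eqVlt; apply/orP; left; apply/eqP.
by rewrite /theta; ring.
Qed.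

End extension.

(** * The density and its convolutions *)

Section reflection.
Variable R : realType.
Variable m : nat.
Local Notation V := (borelV R m).
Local Notation mu := (lebesgueV R m).

Lemma ae_reflect (P : 'rV[R]_m -> Prop) (X : 'rV[R]_m) :
  {ae mu, forall t : V, P t} -> {ae mu, forall t : V, P (X - (t : 'rV[R]_m))}.
Proof.
case=> N [mN N0 sN].
have mr : measurable_fun setT (fun t : V => X - t : V).
  have := @measurable_affineV R m (-1) X.
  by under eq_fun do rewrite scaleN1r addrC.
have mN' : measurable ((fun t : V => X - t : V) @^-1` N).
  by rewrite -[X in measurable X]setTI; exact: mr.
exists ((fun t : V => X - t : V) @^-1` N); split => //; last by move=> t /=; exact: sN.
have h := @ge0_integral_reflect R m X (fun t : V => (\1_N t)%:E).
have e : (\int[mu]_x (\1_N ((X - x)%R : 'rV[R]_m))%:E = \int[mu]_x (\1_N x)%:E)%E.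
  apply: h; first by apply/measurable_EFin; exact: measurable_indic.
  by move=> x; rewrite lee_fin.
have e2 : (\int[mu]_x (\1_N x)%:E = 0)%E by rewrite integral_indic// setIT.
rewrite -e2 -e; have := @integral_indic _ _ _ mu setT measurableT _ mN'.
by rewrite setIT => <-.
Qed.

End reflection.

Section truncation.
Variable R : realType.
Local Open Scope complex_scope.
Variable m : nat.
Local Notation V := (borelV R m).

Definition trunc (B : R) (F : 'rV[R]_m -> R[i]) : 'rV[R]_m -> R[i] :=
  fun x => (if normc (F x) <= B then 1 else 0 : R)%:C * F x.

Lemma cmeasurable_trunc B F : cmeasurable (F : V -> R[i]) -> cmeasurable (trunc B F : V -> R[i]).
Proof.
move=> mF; apply: cmeasurableM => //; apply: cmeasurable_rc.
apply: measurable_fun_ifT => //; apply: measurable_fun_ler => //.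
exact: measurable_normc.
Qed.

Lemma trunc_le B F x : 0 <= B -> normc (trunc B F x) <= B.
Proof.
move=> B0; rewrite /trunc; case: ifP => h; rewrite normcM normc_rc.
  by rewrite normr1 mul1r.
by rewrite normr0 mul0r.
Qed.

Lemma truncE B F x : normc (F x) <= B -> F x = trunc B F x.
Proof. by rewrite /trunc => ->; rewrite mul1r. Qed.

End truncation.

Section symfun_scale.
Variable R : realType.
Variable m : nat.

Lemma symfun_scale (c : R[i]) (C : R) (L : ('rV[R]_m -> R[i]) -> R[i]) :
  symfun C L -> symfun (normc c * C) (fun a => c * L a).
Proof.
move=> [LD LZ Lb]; split.
- by move=> a b D D' sa sb; rewrite (LD _ _ _ _ sa sb) mulrDr.
- by move=> s a D sa; rewrite (LZ _ _ _ sa) mulrCA.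
- by move=> a D sa; rewrite normcM -mulrA ler_wpM2l ?cnorm_ge0//; exact: Lb.
Qed.

End symfun_scale.

Section convolution.
Variable R : realType.
Local Open Scope complex_scope.
Variable m : nat.
Variable nu : cmeasure R (borelV R m).

Lemma convolution_has_symbol : has_symbol (convolution nu) (fourier nu).
Proof.
split.
  move=> a F _; apply: nearW => x _; rewrite /convolution /translate.
  by congr cmeas_integral; apply/funext => t; rewrite addrAC.
move=> a; apply: nearW => x _; rewrite /convolution /fourier.
have [p1 [q1 [p2 [q2 [_ _ _ E]]]]] := cmeas_integral_jordan nu.
have hc (p : {finite_measure set (borelV R m) -> \bar R}) :
    Cint p (fun t : borelV R m => character a (x - t : 'rV[R]_m)) =
    character a x * Cint p (fun t : borelV R m => expi (- dot a t)).
  have ip : cintegrable p (fun t : borelV R m => expi (- dot a t)).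
    have := cintegrable_char_finite p (- a).
    by under eq_fun do rewrite dotNl.
  rewrite -(CintZ _ ip); apply: eq_Cint => t.
  by rewrite /character dotDr dotNr expiD.
by rewrite !E !hc; ring.
Qed.

End convolution.

Section heat.
Variables (R : realType) (n : nat) (gamma delta h : R).
Local Open Scope complex_scope.
Local Notation m := (n + n)%N.
Local Notation V := (borelV R (n + n)).
Local Notation mu := (lebesgueV R (n + n)).
Variables (nu : cmeasure R (borelV R (n + n))) (phi phi1 phi2 : 'rV[R]_(n + n) -> R[i]).
Hypotheses (gamma_lt0 : gamma < 0) (delta_gt0 : 0 < delta) (delta_lt : delta < 4 * - gamma).
Hypothesis h0 : 0 < h.
Hypothesis phiE : forall u, phi u = phi1 u + phi2 u.
Hypothesis sym1 : exists T, bounded_operator T /\ has_symbol T phi1.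
Hypothesis smooth2 : smooth phi2.
Hypothesis bound2 : forall al, exists A : R, 0 < A /\
  forall u, normc (partial_multi al phi2 u) <= A * (enorm u ^+ 2 + 1).
Hypothesis growth2 : exists M : R, forall u, M <= enorm u ->
  complex.Re (phi2 u) <= gamma * enorm u ^+ 2.
Hypothesis nuE : forall u, fourier nu u = cexp (h%:C * phi u).

Let psi u := cexp (h%:C * phi1 u).

Let psiA : exists A, multiplier_bound A psi.
Proof. by have [T [bT sT]] := sym1; exact: (multiplier_bound_cexp bT sT (ltW h0)). Qed.

Let gsym0 u : gsym h phi2 0 u = cexp (h%:C * phi2 u).
Proof.
rewrite /gsym (_ : lin _ u = 0) ?addr0// /lin big1// => i _.
by rewrite /ecoef mxE oppr0 mul0r.
Qed.

Let fourierE u : gsym h phi2 0 u * psi u = fourier nu u.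
Proof. by rewrite gsym0 -cexpD nuE phiE -mulrDr [phi1 u + _]addrC. Qed.

(** [phi1] has no regularity of its own; [psi] is measurable as the quotient of
    a Fourier transform by a continuous function. *)
Let mpsi : cmeasurable (psi : V -> R[i]).
Proof.
have [mf _] := fourier_regular nu.
have [c2 _] := smooth2 [::].
have mp : cmeasurable (fun u : V => h%:C * phi2 u).
  apply: (cmeasurableM (cmeasurable_cst _ _)).
  exact: (cmeasurable_ccontinuous c2).
have := cmeasurableM (cmeasurable_cexp (cmeasurableN mp)) mf.
congr cmeasurable; apply/funext => u.
by rewrite -fourierE gsym0 mulrA -cexpD addNr cexp0 mul1r.
Qed.

(** The room between [delta] and [delta'] makes the bound on the extension
    integrable in [X - Y]. *)
Let delta' := (delta + 4 * - gamma) / 2.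
Let r := (delta' * h)^-1.

Let delta'_gt : delta < delta'. Proof. by rewrite /delta'; move: delta_lt; lra. Qed.
Let delta'_lt : delta' < 4 * - gamma. Proof. by rewrite /delta'; move: delta_lt; lra. Qed.

Let r_lt : r < (delta * h)^-1.
Proof.
have d' : 0 < delta' := lt_trans delta_gt0 delta'_gt.
have dh : 0 < delta * h by exact: mulr_gt0.
have dh' : delta * h < delta' * h by rewrite (ltr_pM2r h0).
by rewrite /r ltf_pV2// posrE// (lt_trans dh).
Qed.

Let sg kap : exists2 D : R, 0 <= D &
  forall Y, sym (D * expR (r * enorm Y ^+ 2)) kap (gsym h phi2 Y).
Proof.
exact: (@sym_gsym R (n + n) h gamma delta' kap phi2 h0 gamma_lt0
  (lt_trans delta_gt0 delta'_gt) delta'_lt smooth2 bound2 growth2).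
Qed.

Let sg' kap Y : exists D : R, sym D kap (gsym h phi2 Y).
Proof. by have [D _ h1] := sg kap; exists (D * expR (r * enorm Y ^+ 2)). Qed.

Let cst : R := ((2 * pi) ^+ m)^-1.

Let cst0 : 0 <= cst.
Proof. by rewrite invr_ge0 exprn_ge0// mulr_ge0// pi_ge0. Qed.

Let ift_fourier x : ift (fourier nu) x = kern psi (gsym h phi2 0) x.
Proof. by rewrite /kern /ift; apply: eq_Cint => u; rewrite fourierE. Qed.

Let densityE x : density nu x = cst%:C * kern psi (gsym h phi2 0) x.
Proof. by rewrite /density ift_fourier. Qed.

Let regular : exists B : R, [/\ cintegrable mu (fourier nu : V -> R[i]),
  forall u, normc (fourier nu u) <= B & cintegrable mu (ift (fourier nu) : V -> R[i])].
Proof.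
have [A bA] := psiA; have [A0 pA] := multiplier_bound_le bA.
have [D sD] := sg' (-1) 0; have D0 := sym_ge0 sD.
exists (D * A); split.
- have := cintegrable_sym_psi mpsi bA sD.
  by congr cintegrable; apply/funext => u; exact: fourierE.
- move=> u; rewrite -fourierE normcM ler_pM ?cnorm_ge0//.
  have [_ _ b _] := sD; apply: (le_trans (b u)).
  by rewrite ler_piMr// -[leRHS]expR0 ler_expR mulN1r oppr_le0 l1_ge0.
- have := cintegrable_kern mpsi bA sD.
  by congr cintegrable; apply/funext => u; rewrite ift_fourier.
Qed.

Definition heat_kernel (z : 'rV[Cfield R]_(n + n)) : Cfield R :=
  cst%:C * kern psi (gsym h phi2 (cim_row z)) (cre_row z).

Lemma heat_kernel_toC X Y :
  heat_kernel (toC X Y) = cst%:C * kern psi (gsym h phi2 Y) X.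
Proof.
rewrite /heat_kernel; have -> : cre_row (toC X Y) = X by apply/rowP => j; rewrite !mxE.
by have -> : cim_row (toC X Y) = Y by apply/rowP => j; rewrite !mxE.
Qed.

Lemma holomorphic_heat_kernel : holomorphic heat_kernel.
Proof.
have [A bA] := psiA.
apply: (@holomorphic_symfun R (n + n) h phi2 _ (fun X a => cst%:C * kern psi a X)).
- by move=> X; apply: symfun_scale; exact: (symfun_kern mpsi bA).
- by move=> X x a; rewrite kern_shift.
- by move=> Y; exact: sg'.
Qed.

Lemma heat_kernel_density :
  abs_continuous nu /\ has_density nu (fun X => heat_kernel (toC X 0)).
Proof.
have [B [i1 b1 i2]] := regular; split; first exact: density_abs_continuous i1 b1 i2.
have := density_has_density i1 b1 i2; congr has_density; apply/funext => X.
by rewrite densityE heat_kernel_toC.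
Qed.

Lemma heat_kernel_L1 : exists C : R, forall Y : 'rV[R]_(n + n),
  (\int[mu]_X (normc (heat_kernel (toC X Y)))%:E
    <= (C * expR ((delta * h)^-1 * enorm Y ^+ 2))%:E)%E.
Proof.
have [A bA] := psiA; have [A0 _] := multiplier_bound_le bA.
have [D D0 sD] := sg (-1).
have k0 : 0 <= kern_cst (n + n) A.
  by rewrite /kern_cst !mulr_ge0 ?exprn_ge0 ?Iwexp_ge0 ?pi_ge0.
exists (cst * (kern_cst (n + n) A * D)) => Y.
have ik := cintegrable_kern mpsi bA (sD Y).
apply: (@le_trans _ _ (cst%:E * \int[mu]_X (normc (kern psi (gsym h phi2 Y) X))%:E)%E).
  rewrite -ge0_integralZl//; first last.
  - by move=> x _; rewrite lee_fin cnorm_ge0.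
  - by apply/measurable_EFin; apply: measurable_normc; exact: cintegrable_cmeasurable ik.
  rewrite le_eqVlt; apply/orP; left; apply/eqP; apply: eq_integral => X _.
  by rewrite heat_kernel_toC normcM normc_rc ger0_norm// EFinM.
apply: (@le_trans _ _ (cst%:E * (kern_cst (n + n) A * (D * expR (r * enorm Y ^+ 2)))%:E)%E).
  by apply: lee_wpmul2l; [rewrite lee_fin|exact: (kern_L1 mpsi bA (sD Y))].
rewrite -EFinM lee_fin -!(mulrA cst); apply: (ler_wpM2l cst0).
rewrite -mulrA; apply: (ler_wpM2l k0); apply: (ler_wpM2l D0).
by rewrite ler_expR ler_wpM2r ?sqr_ge0// ltW.
Qed.

Lemma heat_convolution_D_class F : Linfty F -> D_class (delta * h) (convolution nu F).
Proof.
move=> LF; have [B B0 FB] := Linfty_bounded LF; have [mF _] := LF.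
have [A bA] := psiA; have [A0 _] := multiplier_bound_le bA.
have [B' [i1 b1 i2]] := regular.
(* [F] is bounded only up to a null set, and the functional needs a bounded
   function. *)
pose G := trunc B F.
have mG : cmeasurable (G : V -> R[i]) := cmeasurable_trunc B mF.
have GB x : normc (G x) <= B by exact: trunc_le.
have k0 : 0 <= kern_cst (n + n) A.
  by rewrite /kern_cst !mulr_ge0 ?exprn_ge0 ?Iwexp_ge0 ?pi_ge0.
apply: (@D_class_symfun R n h phi2 (normc (cst%:C : R[i]) * (kern_cst (n + n) A * B)) r
  (fun X a => cst%:C * convk psi G X a)).
- by rewrite mulr_ge0 ?cnorm_ge0// mulr_ge0.
- by move=> X; apply: symfun_scale; exact: (symfun_convk mpsi bA mG GB).
- by move=> X x a; rewrite convk_shift.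
- exact: sg.
- exact: mulr_gt0.
- exact: r_lt.
- move=> X; have mr : measurable_fun setT (fun t : V => X - t : V).
    have := @measurable_affineV R (n + n) (-1) X.
    by under eq_fun do rewrite scaleN1r addrC.
  have ae : {ae mu, forall t : V, F (X - (t : 'rV[R]_(n + n))) = G (X - (t : 'rV[R]_(n + n)))}.
    apply: (@ae_reflect R (n + n) (fun x => F x = G x)).
    by move: FB; apply: filterS => x; exact: truncE.
  rewrite /convolution (cmeas_integral_density i1 b1 i2 (cmeasurable_comp mr mF)
    (cmeasurable_comp mr mG) ae (fun t => GB _)).
  have [D sD] := sg' (-1) 0.
  rewrite /convk -(CintZ _ (cintegrable_convk mpsi bA mG GB X sD)).
  have ic : cintegrable mu (fun t : V => G t * density nu (X - t : 'rV[R]_(n + n))).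
    have [i3 _] := Cint_reflect X (cintegrable_density i2).
    under eq_fun do rewrite mulrC.
    exact: (cintegrableM_bounded (B := B)).
  have [_ e] := Cint_reflect X ic.
  transitivity (Cint mu (fun t : V => G t * density nu (X - t : 'rV[R]_(n + n)))).
    by apply: eq_Cint => t; rewrite densityE; ring.
  rewrite -e; apply: eq_Cint => t; congr (_ * density nu _).
  by rewrite opprB addrCA subrr addr0.
Qed.

End heat.

Theorem theorem2p12 (R : realType) (n : nat) (gamma delta : R)
    (nu : R -> cmeasure R (borelV R (n + n))) (phi : 'rV[R]_(n + n) -> R[i])
    (hgamma : gamma < 0) (hnu : M_class gamma nu) (hphi : has_exponent nu phi)
    (hdelta : 0 < delta < 4 * `|gamma|) (h : R) (hh : 0 < h) :
  [/\ abs_continuous (nu h) /\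
      (exists Phi : 'rV[Cfield R]_(n + n) -> Cfield R,
        [/\ holomorphic Phi,
            has_density (nu h) (fun X => Phi (toC X 0)) &
            exists C : R, forall Y : 'rV[R]_(n + n),
              (\int[lebesgueV R (n + n)]_X (normc (Phi (toC X Y)))%:E
                <= (C * expR ((delta * h)^-1 * enorm Y ^+ 2))%:E)%E]),
      (forall F, Linfty F -> D_class (delta * h) (convolution (nu h) F)) &
      has_symbol (convolution (nu h)) (fun u => cexp (h%:C%C * phi u))].
Proof.
have [phi0 [[phi1 [phi2 [phiE s1 sm bd gr]]] he]] := hnu.
have nuE := he h hh.
move: hdelta; rewrite ltr0_norm// => /andP[d0 dg].
have [ac hd] := heat_kernel_density hgamma d0 dg hh phiE s1 sm bd gr nuE.
split.
- split => //; exists (heat_kernel h phi1 phi2); split => //.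
  + exact: (holomorphic_heat_kernel hgamma d0 dg hh phiE s1 sm bd gr nuE).
  + exact: (heat_kernel_L1 hgamma d0 dg hh phiE s1 sm bd gr nuE).
- exact: (heat_convolution_D_class hgamma d0 dg hh phiE s1 sm bd gr nuE).
- have := convolution_has_symbol (nu h); congr has_symbol; apply/funext => u.
  exact: hphi.
Qed.
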